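(* Let $\gamma\subset\mathbb{C}$ be a Jordan curve with interior $G$, let $J\subseteq\gamma$ be a rectifiable open arc, and let $J'\subseteq J$ be a compact arc. Let $\Phi:D\to G$ be a conformal mapping from the open unit disk $D$ onto $G$, extended to a homeomorphism $\Phi:\overline{D}\to\overline{G}$, and let $a<b<a+2\pi$ be real numbers such that $J'=\{\Phi(e^{it}): a\le t\le b\}$. Then $$\int_a^b\left|\Phi'(r_1e^{it})-\Phi'(r_2e^{it})\right|dt\longrightarrow 0\quad\text{as } r_1,r_2\to 1^-.$$
   Context: $D=\{z\in\mathbb{C}:|z|<1\}$. A Jordan curve is a homeomorphic image of the unit circle in $\mathbb{C}$; its interior is the bounded component of its complement. An open arc of a Jordan curve $\gamma$ is a subset of the form $\gamma((s,t))$ for an open parameter interval $(s,t)$ on which the parametrization of $\gamma$ is injective; a compact arc is defined likewise with a compact interval. An arc is rectifiable if it has finite length (supremum of the lengths of inscribed polygonal lines). A conformal mapping onto $G$ means a holomorphic bijection onto $G$. By the Osgood–Carathéodory theorem every conformal mapping of $D$ onto the interior of a Jordan curve extends to a homeomorphism of $\overline{D}$ onto the closure of that interior; this extension is also denoted $\Phi$. *)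

(* Defs.v *)
From mathcomp Require Import all_boot all_order all_algebra.
From mathcomp Require Import all_classical all_reals all_analysis.
From mathcomp Require Export complex.
Import Order.TTheory GRing.Theory Num.Theory.
Import numFieldNormedType.Exports.

Set Implicit Arguments.
Unset Strict Implicit.
Unset Printing Implicit Defensive.

Local Open Scope classical_set_scope.
Local Open Scope ring_scope.
Local Open Scope complex_scope.

(* The complex plane is [R[i]^o], i.e. the field [R[i]] seen as a normed space
   over itself: differentiability over these scalars is complex
   differentiability. Its norm [`|z|] takes (nonnegative real) values in [R[i]];
   the [R]-valued modulus is [Normc.normc]. *)

Section Plane.
Context {R : realType}.
Local Notation C := (R[i]^o).

Definition expi (t : R) : C := cos t +i* sin t.

Definition unit_disk : set C := [set z : C | `|z| < 1].

Definition unit_circle : set C := [set z : C | `|z| = 1].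

Definition homeomorphism (A B : set C) (f : C -> C) : Prop :=
  [/\ set_bij A B f, {within A, continuous f} &
      exists2 g : C -> C, {within B, continuous g} & {in A, cancel f g}].

Definition holomorphic_on (A : set C) (f : C -> C) : Prop :=
  forall z : C, A z -> derivable f z 1.

Definition conformal_onto (A B : set C) (f : C -> C) : Prop :=
  holomorphic_on A f /\ set_bij A B f.

(* A Jordan curve, as a homeomorphic image of the circle, is given by its
   2 pi-periodic parametrization; the curve itself is [range gamma]. *)
Definition jordan_curve (gamma : R -> C) : Prop :=
  exists h : C -> C,
    homeomorphism unit_circle (h @` unit_circle) h /\ gamma = h \o expi.

Definition jordan_interior (gamma : R -> C) (G : set C) : Prop :=
  bounded_set G /\
  exists2 z : C, (~` range gamma) z &
    G = connected_component (~` range gamma) z.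

(* The arc described by [gamma] on the parameter interval [I]. *)
Definition is_arc (gamma : R -> C) (I : interval R) (J : set C) : Prop :=
  {in I &, injective gamma} /\ J = gamma @` [set` I].

Definition polygon_length (gamma : R -> C) (p : seq R) : R :=
  \sum_(0 <= k < (size p).-1) Normc.normc (gamma p`_k.+1 - gamma p`_k).

Definition arc_length (gamma : R -> C) (I : interval R) : \bar R :=
  ereal_sup [set (polygon_length gamma p)%:E |
             p in [set p : seq R | sorted <=%R p /\ {subset p <= I}]].

Definition rectifiable (gamma : R -> C) (I : interval R) : Prop :=
  (arc_length gamma I < +oo)%E.

End Plane.

(* Main.v *)
Require Import Defs.
From mathcomp Require Import all_boot all_order all_algebra.
From mathcomp Require Import all_classical all_reals all_analysis.
From mathcomp Require Import ring lra.
Import Order.TTheory GRing.Theory Num.Theory.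
Import numFieldNormedType.Exports.

Set Implicit Arguments.
Unset Strict Implicit.
Unset Printing Implicit Defensive.

Local Open Scope classical_set_scope.
Local Open Scope ring_scope.
Local Open Scope complex_scope.

(** Put [Psi(zeta) = Phi(e^{i zeta})] on the upper half-plane; it is continuous up
    to the real axis and has bounded variation near [[a, b]], because the boundary
    map lifts monotonically to the parameter of the rectifiable arc. For a small
    real [w] the quotient [q_w(zeta) = (Psi(zeta + w) - Psi(zeta)) / w] is holomorphic,
    continuous up to the boundary and never zero, hence equals [h^2] with [h]
    holomorphic. Let [chi >= 0] be a cutoff in [t = Re zeta] and
    [K(y) = int chi(t) |q_w(t + iy)| dt]. Since
    [h(t + i(m+u)) conj h(t + i(m-u))] is holomorphic in [t + iu], integrating by
    parts twice gives
    [int chi |h(t + i(m+d)) - h(t + i(m-d))|^2 <= K(m+d) + K(m-d) - 2 K(m) + c m].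
    With Cauchy's estimate [|q_w| <= N / y] and [K(0) <= V], this almost convexity
    first bounds [K] uniformly in [w]. Letting [w -> 0], it passes to
    [K(y) = int chi |Psi'(t + iy)| dt], which therefore has a limit at [0]; so the
    right-hand side tends to [0], the square roots are Cauchy in [L^2(chi)], and
    [Psi'] is Cauchy in [L^1(chi)]. *)

(** * The complex plane over a real type *)

(** [Psi'] has no boundary values to begin with, so an argument that moves up from the real axis
    cannot start from it. Difference quotients do have them, and their mean at height 0 is an
    average of polygon sums of the boundary curve. Square roots replace L^1 by L^2, where expanding
    a square shows that the midpoint defect of the means dominates, up to an error of order [m], the
    squared distance of two slices. They also halve the singularity: a quotient may grow like
    [1 / y], its root only like [y^(-1/2)], which is integrable, so that the crude estimate of
    Cauchy suffices. The error constant contains the bound that is sought, hence the work takes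
    place in a strip so thin that this occurrence can be absorbed. Since the compact arc lies inside
    an open one, [[a, b]] can be enlarged at both ends, which leaves room for the cutoff to
    decay. *)

Section ComplexPlane.
Context {R : realType}.
Local Notation C := (R[i]^o).
Local Notation normc := (@Normc.normc R).
Local Notation Re := (@complex.Re R).
Local Notation Im := (@complex.Im R).
Implicit Types (z w : C) (r s t e : R).

Lemma normE z : `|z| = (normc z)%:C.
Proof. by []. Qed.

Lemma normc_ge0 z : 0 <= normc z.
Proof. by case: z => a b; exact: sqrtr_ge0. Qed.

Lemma normc_eq0 z : (normc z == 0) = (z == 0).
Proof.
apply/eqP/eqP => [/Normc.eq0_normc//|->]; exact: Normc.normc0.
Qed.

Lemma normc_gt0 z : (0 < normc z) = (z != 0).
Proof. by rewrite lt_neqAle normc_ge0 andbT eq_sym normc_eq0. Qed.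

Lemma normcD z w : normc (z + w) <= normc z + normc w.
Proof. exact: le_normcD. Qed.

Lemma normcB z w : normc (z - w) = normc (w - z).
Proof. by rewrite -(normcN (w - z)) opprB. Qed.

Lemma normc_triB z w : normc z - normc w <= normc (z - w).
Proof. by rewrite lerBlDr -{1}(subrK w z) normcD. Qed.

Lemma normcR r : normc r%:C = `|r|.
Proof. by rewrite /= expr0n addr0 sqrtr_sqr. Qed.

Lemma normcX z n : normc (z ^+ n) = normc z ^+ n.
Proof.
by elim: n => [|n IH]; rewrite ?expr0 ?Normc.normc1// !exprS Normc.normcM IH.
Qed.

Lemma sqr_normcE z : normc z ^+ 2 = Re z ^+ 2 + Im z ^+ 2.
Proof. by case: z => a b /=; rewrite sqr_sqrtr// addr_ge0// sqr_ge0. Qed.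

Lemma ler_Re_normc z : `|Re z| <= normc z.
Proof.
by rewrite -(@ler_pXn2r _ 2)// ?nnegrE ?normc_ge0// sqr_normcE real_normK ?num_real// lerDl sqr_ge0.
Qed.

Lemma ler_Im_normc z : `|Im z| <= normc z.
Proof.
by rewrite -(@ler_pXn2r _ 2)// ?nnegrE ?normc_ge0// sqr_normcE real_normK ?num_real// lerDr sqr_ge0.
Qed.

Lemma normc_le_ReIm z : normc z <= `|Re z| + `|Im z|.
Proof.
rewrite -(@ler_pXn2r _ 2)// ?nnegrE ?normc_ge0 ?addr_ge0//.
rewrite sqr_normcE sqrrD !real_normK ?num_real// lerD2r lerDl.
by rewrite mulrn_wge0// mulr_ge0.
Qed.

Lemma normcJ z : normc (conjc z) = normc z.
Proof. by case: z => a b /=; rewrite sqrrN. Qed.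

Lemma cReD z w : Re (z + w) = Re z + Re w. Proof. by case: z w => a b []. Qed.
Lemma cImD z w : Im (z + w) = Im z + Im w. Proof. by case: z w => a b []. Qed.
Lemma cReN z : Re (- z) = - Re z. Proof. by case: z. Qed.
Lemma cImN z : Im (- z) = - Im z. Proof. by case: z. Qed.
Lemma cReM z w : Re (z * w) = Re z * Re w - Im z * Im w.
Proof. by case: z w => a b []. Qed.
Lemma cImM z w : Im (z * w) = Re z * Im w + Im z * Re w.
Proof. by case: z w => a b []. Qed.
Lemma cReJ z : Re (conjc z) = Re z. Proof. by case: z. Qed.
Lemma cImJ z : Im (conjc z) = - Im z. Proof. by case: z. Qed.

Lemma cReZ r z : Re (r%:C * z) = r * Re z.
Proof. by rewrite cReM /= mul0r subr0. Qed.
Lemma cImZ r z : Im (r%:C * z) = r * Im z.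
Proof. by rewrite cImM /= mul0r addr0. Qed.

Lemma complex_eqP z w : Re z = Re w -> Im z = Im w -> z = w.
Proof. by case: z w => a b [c d] /= -> ->. Qed.

Definition CE := (cReD, cImD, cReN, cImN, cReM, cImM, cReJ, cImJ).

(** Positive elements of [R[i]] are real, so the radii of the norm topology can be taken in [R]. *)
Lemma cvgcP {T : Type} (F : set_system T) {FF : Filter F} (f : T -> C) (l : C) :
  f @ F --> l <-> forall e : R, 0 < e -> \forall x \near F, normc (f x - l) < e.
Proof.
split.
  move=> /cvgrPdist_lt fl e e0.
  have e0' : 0 < e%:C :> R[i] by rewrite ltcR.
  by apply: filterS (fl _ e0') => x; rewrite normE ltcR normcB.
move=> H; apply/cvgrPdist_lt => -[e e'].
rewrite ltcE/= => /andP[/eqP -> e0].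
by apply: filterS (H _ e0) => x; rewrite normE ltcR normcB.
Qed.

Lemma nbhscP z (A : set C) :
  nbhs z A <-> exists2 e : R, 0 < e & forall w, normc (w - z) < e -> A w.
Proof.
split.
  move=> /nbhs_ballP[[e e']]; rewrite /= ltcE/= => /andP[/eqP -> e0] H.
  by exists e => // w wz; apply: H; rewrite /ball/= normE ltcR normcB.
move=> [e e0 H]; apply/nbhs_ballP; exists e%:C; first by rewrite /= ltcR.
by move=> w; rewrite /ball/= normE ltcR normcB => /H.
Qed.

Lemma nbhs_normc z e : 0 < e -> \forall w \near z, normc (w - z) < e.
Proof. by move=> e0; apply/nbhscP; exists e. Qed.

Lemma cvg_of_normc_le {T : Type} (F : set_system T) {FF : Filter F}
    (f : T -> C) (l : C) (g : T -> R) :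
  (\forall x \near F, normc (f x - l) <= g x) -> g @ F --> (0 : R) ->
  f @ F --> l.
Proof.
move=> H /cvgr0_norm_lt g0; apply/cvgcP => e e0.
near=> x; have: normc (f x - l) <= g x by near: x.
move=> /le_lt_trans; apply; apply: le_lt_trans (ler_norm _) _.
by near: x; exact: g0.
Unshelve. all: by end_near. Qed.

Lemma cvg_lipR {T : Type} (F : set_system T) {FF : Filter F} (f : T -> C) (l : C)
    (p : C -> R) : (forall z w, `|p z - p w| <= normc (z - w)) ->
  f @ F --> l -> (p \o f) @ F --> p l.
Proof.
move=> pl /cvgcP H; apply/cvgrPdist_lt => e e0; apply: filterS (H _ e0) => x.
by apply: le_lt_trans; rewrite distrC; exact: pl.
Qed.

Lemma cvgRe {T : Type} (F : set_system T) {FF : Filter F} (f : T -> C) (l : C) :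
  f @ F --> l -> (fun x => Re (f x)) @ F --> Re l.
Proof.
by apply: (@cvg_lipR _ F FF f l Re) => z w; rewrite -cReN -cReD ler_Re_normc.
Qed.

Lemma cvgIm {T : Type} (F : set_system T) {FF : Filter F} (f : T -> C) (l : C) :
  f @ F --> l -> (fun x => Im (f x)) @ F --> Im l.
Proof.
by apply: (@cvg_lipR _ F FF f l Im) => z w; rewrite -cImN -cImD ler_Im_normc.
Qed.

Lemma cvg_normc {T : Type} (F : set_system T) {FF : Filter F} (f : T -> C) (l : C) :
  f @ F --> l -> (fun x => normc (f x)) @ F --> normc l.
Proof.
apply: (@cvg_lipR _ F FF f l normc) => z w.
by rewrite ler_norml normc_triB andbT lerNl opprB normcB normc_triB.
Qed.

Lemma cvgConj {T : Type} (F : set_system T) {FF : Filter F} (f : T -> C) (l : C) :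
  f @ F --> l -> (fun x => conjc (f x) : C) @ F --> (conjc l : C).
Proof.
move=> /cvgcP H; apply/cvgcP => e e0; apply: filterS (H _ e0) => x.
by rewrite -rmorphB normcJ.
Qed.

Lemma cvgReIm {T : Type} (F : set_system T) {FF : Filter F} (f : T -> C) (l : C) :
  (fun x => Re (f x)) @ F --> Re l -> (fun x => Im (f x)) @ F --> Im l ->
  f @ F --> l.
Proof.
move=> H1 H2.
apply: (@cvg_of_normc_le _ _ _ _ _ (fun x => `|Re (f x) - Re l| + `|Im (f x) - Im l|)).
  by near=> x; rewrite (le_trans (normc_le_ReIm _))// !CE.
rewrite -[0 in X in _ --> X]addr0; apply: cvgD.
  by apply/norm_cvg0P; apply/subr_cvg0.
by apply/norm_cvg0P; apply/subr_cvg0.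
Unshelve. all: by end_near. Qed.

Lemma cvgMkC {T : Type} (F : set_system T) {FF : Filter F} (f g : T -> R) (a b : R) :
  f @ F --> a -> g @ F --> b -> (fun x => f x +i* g x : C) @ F --> (a +i* b : C).
Proof. by move=> fa gb; exact: cvgReIm. Qed.

Lemma cvgR2C {T : Type} (F : set_system T) {FF : Filter F} (f : T -> R) (a : R) :
  f @ F --> a -> (fun x => (f x)%:C : C) @ F --> (a%:C : C).
Proof. by move=> fa; apply: cvgMkC => //; exact: cvg_cst. Qed.

Section Continuity.
Context {T : topologicalType}.
Implicit Types (f g : T -> C) (x : T).

(** These rules fix the target type and the pointwise form of the function, so that a continuity
    proof can be written as one term that mirrors the function. *)
Lemma ccst (c : C) x : {for x, continuous (fun _ : T => c)}.
Proof. exact: (@cvg_cst C c T (nbhs x) _). Qed.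

Lemma ccontD f g x : {for x, continuous f} -> {for x, continuous g} ->
  {for x, continuous (fun y => f y + g y)}.
Proof. exact: (@cvgD _ _ T (nbhs x) _ f g). Qed.

Lemma ccontB f g x : {for x, continuous f} -> {for x, continuous g} ->
  {for x, continuous (fun y => f y - g y)}.
Proof. exact: (@cvgB _ _ T (nbhs x) _ f g). Qed.

Lemma ccontN f x : {for x, continuous f} -> {for x, continuous (fun y => - f y)}.
Proof. exact: (@cvgN _ _ T (nbhs x) _ f). Qed.

Lemma ccontM f g x : {for x, continuous f} -> {for x, continuous g} ->
  {for x, continuous (fun y => f y * g y)}.
Proof. exact: (@cvgM R[i] T (nbhs x) _ f g). Qed.

Lemma ccontV f x : {for x, continuous f} -> f x != 0 ->
  {for x, continuous (fun y => (f y)^-1)}.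
Proof. move=> cf f0; exact: (@cvgV R[i] T (nbhs x) _ f _ f0 cf). Qed.

Lemma ccont_comp (h : C -> C) f x : {for x, continuous f} -> {for f x, continuous h} ->
  {for x, continuous (fun y => h (f y))}.
Proof. exact: (@continuous_comp _ _ _ f h). Qed.

Lemma ccontRe f x : {for x, continuous f} -> {for x, continuous (fun y => Re (f y))}.
Proof. exact: (@cvgRe T (nbhs x) _ f). Qed.

Lemma ccontIm f x : {for x, continuous f} -> {for x, continuous (fun y => Im (f y))}.
Proof. exact: (@cvgIm T (nbhs x) _ f). Qed.

Lemma ccont_normc f x : {for x, continuous f} -> {for x, continuous (fun y => normc (f y))}.
Proof. exact: (@cvg_normc T (nbhs x) _ f). Qed.

Lemma ccontJ f x : {for x, continuous f} -> {for x, continuous (fun y => conjc (f y) : C)}.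
Proof. exact: (@cvgConj T (nbhs x) _ f). Qed.

Lemma ccontMk (u v : T -> R) x : {for x, continuous u} -> {for x, continuous v} ->
  {for x, continuous (fun y => u y +i* v y : C)}.
Proof. exact: (@cvgMkC T (nbhs x) _ u v). Qed.

Lemma ccontR (u : T -> R) x : {for x, continuous u} ->
  {for x, continuous (fun y => (u y)%:C : C)}.
Proof. exact: (@cvgR2C T (nbhs x) _ u). Qed.

Lemma rcst (c : R) x : {for x, continuous (fun _ : T => c)}.
Proof. exact: (@cvg_cst R c T (nbhs x) _). Qed.

Lemma rcontD (u v : T -> R) x : {for x, continuous u} -> {for x, continuous v} ->
  {for x, continuous (fun y => u y + v y)}.
Proof. exact: (@cvgD _ _ T (nbhs x) _ u v). Qed.

Lemma rcontB (u v : T -> R) x : {for x, continuous u} -> {for x, continuous v} ->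
  {for x, continuous (fun y => u y - v y)}.
Proof. exact: (@cvgB _ _ T (nbhs x) _ u v). Qed.

Lemma rcontN (u : T -> R) x : {for x, continuous u} -> {for x, continuous (fun y => - u y)}.
Proof. exact: (@cvgN _ _ T (nbhs x) _ u). Qed.

Lemma rcontM (u v : T -> R) x : {for x, continuous u} -> {for x, continuous v} ->
  {for x, continuous (fun y => u y * v y)}.
Proof. exact: (@cvgM R T (nbhs x) _ u v). Qed.

Lemma rcont_comp (h : R -> R) (u : T -> R) x :
  {for x, continuous u} -> {for u x, continuous h} ->
  {for x, continuous (fun y => h (u y))}.
Proof. exact: (@continuous_comp _ _ _ u h). Qed.

End Continuity.

Lemma cidc z : {for z, continuous (fun w : C => w)}.
Proof. exact: (@cvg_id C (nbhs z)). Qed.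

Lemma idr (t : R) : {for t, continuous (fun s : R => s)}.
Proof. exact: (@cvg_id R (nbhs t)). Qed.

End ComplexPlane.

Arguments rcst {R T} c x.
Arguments ccst {R T} c x.
Arguments idr {R} t.
Arguments cidc {R} z.

(** * Integrals of continuous functions *)

Section RealIntegral.
Context {R : realType}.
Local Notation mu := (@lebesgue_measure R).
Implicit Types (f g : R -> R) (a b c : R).

Definition rint a b f : R := (\int[mu]_(x in `[a, b]) f x)%R.

Lemma cont_within a b f : {in `[a, b], continuous f} ->
  {within `[a, b], continuous f}.
Proof. by move=> cf; apply: continuous_in_subspaceT => x; rewrite inE => /cf. Qed.

Lemma cont_integrable a b f : {in `[a, b], continuous f} ->
  mu.-integrable `[a, b] (EFin \o f).
Proof.
move=> cf; apply: continuous_compact_integrable; first exact: segment_compact.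
exact: cont_within.
Qed.

Lemma eq_rint a b f g : {in `[a, b], f =1 g} -> rint a b f = rint a b g.
Proof. by move=> fg; apply: eq_Rintegral => x; rewrite inE; exact: fg. Qed.

Lemma rintD a b f g : {in `[a, b], continuous f} -> {in `[a, b], continuous g} ->
  rint a b (fun x => f x + g x) = rint a b f + rint a b g.
Proof. by move=> cf cg; rewrite /rint RintegralD//; exact: cont_integrable. Qed.

Lemma rintB a b f g : {in `[a, b], continuous f} -> {in `[a, b], continuous g} ->
  rint a b (fun x => f x - g x) = rint a b f - rint a b g.
Proof. by move=> cf cg; rewrite /rint RintegralB//; exact: cont_integrable. Qed.

Lemma rintZ a b c f : {in `[a, b], continuous f} ->
  rint a b (fun x => c * f x) = c * rint a b f.
Proof. by move=> cf; rewrite /rint RintegralZl//; exact: cont_integrable. Qed.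

Lemma rint_cst a b c : a <= b -> rint a b (fun=> c) = c * (b - a).
Proof.
by move=> ab; rewrite /rint Rintegral_cst//= lebesgue_measure_itv/= lte_fin;
  case: ltgtP ab => //= -> _; rewrite subrr.
Qed.

Lemma le_rint a b f g : {in `[a, b], continuous f} -> {in `[a, b], continuous g} ->
  {in `[a, b], forall x, f x <= g x} -> rint a b f <= rint a b g.
Proof.
move=> cf cg fg; apply: le_Rintegral => //; exact: cont_integrable.
Qed.

Lemma rint_ge0 a b f : {in `[a, b], forall x, 0 <= f x} -> 0 <= rint a b f.
Proof. by move=> f0; apply: Rintegral_ge0 => x; exact: f0. Qed.

Lemma rint_norm a b f : {in `[a, b], continuous f} ->
  `|rint a b f| <= rint a b (fun x => `|f x|).
Proof. by move=> cf; apply: le_normr_Rintegral => //; exact: cont_integrable. Qed.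

Lemma cont_norm a b f : {in `[a, b], continuous f} ->
  {in `[a, b], continuous (fun x => `|f x|)}.
Proof. by move=> cf x xab; apply: cvg_norm; exact: cf. Qed.

Lemma cont_cst a b c : {in `[a, b], continuous (fun _ : R => c)}.
Proof. by move=> x _; exact: cvg_cst. Qed.

Lemma rint_bound a b f c : a <= b -> {in `[a, b], continuous f} ->
  {in `[a, b], forall x, `|f x| <= c} -> `|rint a b f| <= c * (b - a).
Proof.
move=> ab cf fc; rewrite (le_trans (rint_norm cf))// -rint_cst//.
by apply: le_rint => //; [exact: cont_norm|exact: cont_cst].
Qed.

Lemma rint_itv1 a f : rint a a f = 0.
Proof. by rewrite /rint set_itv1 Rintegral_set1. Qed.

Lemma rint_cat b a c f : a <= b -> b <= c -> {in `[a, c], continuous f} ->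
  rint a c f = rint a b f + rint b c f.
Proof.
move=> ab bc cf; have := cont_integrable cf => intf.
have := @Rintegral_itvB _ f (BLeft a) (BRight c) b intf.
rewrite !bnd_simp => /(_ ab bc) /eqP; rewrite subr_eq => /eqP E.
rewrite /rint E addrC; congr (_ + _).
rewrite Rintegral_itv_obnd_cbnd//.
by apply: integrableS intf => //; apply: subset_itvr; rewrite bnd_simp.
Qed.

Lemma rint_FTC a b F f : a <= b ->
  {in `[a, b], forall x, is_derive x (1 : R) F (f x)} ->
  {in `[a, b], continuous f} -> rint a b f = F b - F a.
Proof.
rewrite le_eqVlt => /predU1P[<- _ _|ab dF cf]; first by rewrite rint_itv1 subrr.
have cF : {in `[a, b], continuous F}.
  move=> x xab; apply/differentiable_continuous/derivable1_diffP.
  by have [] := dF _ xab.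
have E := @continuous_FTC2 R f F a b ab (cont_within cf).
rewrite /rint /Rintegral E//.
- split.
  + by move=> x /subset_itv_oo_cc xab; have [] := dF _ xab.
  + by apply: cvg_at_right_filter; apply: cF; rewrite in_itv/= lexx ltW.
  + by apply: cvg_at_left_filter; apply: cF; rewrite in_itv/= lexx ltW.
- move=> x /subset_itv_oo_cc xab.
  by rewrite derive1E; have [_] := dF _ xab.
Qed.

Lemma rint_shift a b c f : a <= b -> {in `[a + c, b + c], continuous f} ->
  rint a b (fun x => f (x + c)) = rint (a + c) (b + c) f.
Proof.
move=> ab cf; have dE : derive1 (fun x : R => x + c) = cst 1.
  apply/funext => x; rewrite derive1E derive_val.
  by rewrite addr0.
have := @integration_by_substitution_increasing R (fun x => x + c) f a b ab.
rewrite dE => H; rewrite /rint /Rintegral; congr fine.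
rewrite H.
- by apply: eq_integral => x _ /=; rewrite mulr1.
- by move=> x y _ _; rewrite ltrD2r.
- by move=> x _; exact: cvg_cst.
- exact: is_cvg_cst.
- exact: is_cvg_cst.
- split.
  + by move=> x _; exact: ex_derive.
  + by apply: cvg_at_right_filter; apply: cvgD; [exact: cvg_id|exact: cvg_cst].
  + by apply: cvg_at_left_filter; apply: cvgD; [exact: cvg_id|exact: cvg_cst].
- exact: cont_within.
Qed.

End RealIntegral.

(** * Continuity and differentiation of integrals depending on a parameter *)

Section ParametricIntegral.
Context {R : realType}.
Local Notation mu := (@lebesgue_measure R).

(** The tube lemma: finitely many product neighbourhoods cover the compact set. *)
Lemma compact_near_uniform {S T : topologicalType} (K : set T) (z0 : S)
    (P : S -> T -> Prop) : compact K ->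
  (forall t, K t -> \forall p \near (z0, t), P p.1 p.2) ->
  \forall z \near z0, forall t, K t -> P z t.
Proof.
move=> /compact_near_coveringP cK H.
apply: (cK S (nbhs z0) P) => t Kt.
have [[A B] /= [zA tB] AB] := H t Kt.
by exists (B, A) => // -[x y] [/= Bx Ay]; exact: (AB (y, x)).
Qed.

Lemma param_near {S : topologicalType} (g : S -> R -> R) (z0 : S) (a b : R) :
  {in `[a, b], forall t, (fun p => g p.1 p.2) @ (z0, t) --> g z0 t} ->
  forall e, 0 < e -> \forall z \near z0, {in `[a, b], forall t, `|g z t - g z0 t| < e}.
Proof.
move=> cg e e0.
apply: (@compact_near_uniform S R `[a, b] z0 (fun z t => `|g z t - g z0 t| < e)).
  exact: segment_compact.
move=> t tab; have e20 : 0 < e / 2 by rewrite divr_gt0.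
have /cvgrPdist_lt /(_ _ e20) H := cg t tab.
(* On the slice [z0] the joint neighbourhood compares [g z0] at [p.2] and at [t]. *)
have H2 : \forall p \near (z0, t), `|g z0 t - g z0 p.2| < e / 2.
  have [[A B] /= [zA tB] AB] := H; exists (setT, B) => /=; first by split => //; exact: filterT.
  move=> [x y] /= [_ By]; apply: (AB (z0, y)); split => //=; exact: nbhs_singleton.
near=> p; rewrite -(subrKA (g z0 t)) (splitr e).
rewrite (le_lt_trans (ler_normD _ _))// ltrD//.
  by rewrite distrC; near: p.
by near: p.
Unshelve. all: by end_near. Qed.

Lemma param_continuous {S : topologicalType} (g : S -> R -> R) (z0 : S) (a b : R) :
  a <= b ->
  (\forall z \near z0, {in `[a, b], continuous (g z)}) ->
  {in `[a, b], forall t, (fun p => g p.1 p.2) @ (z0, t) --> g z0 t} ->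
  (fun z => rint a b (g z)) @ z0 --> rint a b (g z0).
Proof.
move=> ab cg cg2; apply/cvgrPdist_lt => e e0.
(* The [+ 1] keeps the denominator positive when [a = b]. *)
have e1 : 0 < e / (2 * (b - a + 1)).
  by rewrite divr_gt0// mulr_gt0// ltr_wpDl// subr_ge0.
have cz0 : {in `[a, b], continuous (g z0)} by exact: nbhs_singleton cg.
near=> z.
have cgz : {in `[a, b], continuous (g z)} by near: z.
rewrite distrC -rintB//.
apply: (@le_lt_trans _ _ (e / (2 * (b - a + 1)) * (b - a))).
  apply: rint_bound => //.
    by move=> x xab; apply: cvgB; [exact: cgz|exact: cz0].
  move=> t tab; apply: ltW; move: t tab; near: z; exact: param_near.
have ba : 0 <= b - a by rewrite subr_ge0.
rewrite mulrAC ltr_pdivrMr; first by nra.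
by rewrite mulr_gt0// ltr_wpDl.
Unshelve. all: by end_near. Qed.

(** Joint continuity and compactness keep [dg u] within 1 of [dg u0] for [u] near [u0]; the constant
    [M + 1] then dominates all partial derivatives. *)
Lemma param_derive (g dg : R -> R -> R) (u0 a b : R) : a <= b ->
  (\forall u \near u0, {in `[a, b], continuous (g u)}) ->
  (\forall u \near u0, {in `[a, b], forall t, is_derive u (1 : R) (g ^~ t) (dg u t)}) ->
  {in `[a, b], continuous (dg u0)} ->
  {in `[a, b], forall t, (fun p => dg p.1 p.2) @ (u0, t) --> dg u0 t} ->
  is_derive u0 (1 : R) (fun u => rint a b (g u)) (rint a b (dg u0)).
Proof.
move=> ab cg dgu cdg cdg2.
have [M Mdg] : exists M, {in `[a, b], forall t, `|dg u0 t| <= M}.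
  have [c _ Hc] := EVT_max ab (cont_within (cont_norm cdg)).
  by exists `|dg u0 c| => t /Hc.
have P1near := @param_near R dg u0 a b cdg2 _ ltr01.
have H : \forall u \near u0, [/\ {in `[a, b], continuous (g u)},
    {in `[a, b], forall t, is_derive u (1 : R) (g ^~ t) (dg u t)} &
    {in `[a, b], forall t, `|dg u t| <= M + 1}].
  near=> u; split; [by near: u|by near: u|].
  move=> t tab; rewrite -(subrK (dg u0 t) (dg u t)).
  rewrite addrC (le_trans (ler_normD _ _))// lerD ?Mdg// ltW//.
  by move: t tab; near: u; exact: P1near.
have [d /= d0 Hd] := H.
pose I := `]u0 - d, u0 + d[.
have Id u : u \in I -> ball u0 d u.
  by rewrite in_itv/= /ball/= ltr_distlC.
have Iu0 : `]u0 - d, u0 + d[%classic u0.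
  by rewrite /= in_itv/= ltrBlDr ltrDl d0.
have der u : u \in I -> {in `[a, b], forall t,
    derivable (g ^~ t) u 1 /\ partial1of2 g u t = dg u t}.
  move=> uI t tab; have [_ dd _] := Hd _ (Id _ uI).
  have [d1 d2] := dd t tab; split => //.
  by rewrite partial1of2E.
have M0 : 0 <= M + 1.
  have aab : a \in `[a, b] by rewrite in_itv/= lexx.
  by rewrite addr_ge0// (le_trans _ (Mdg a aab)).
have int1 u : `]u0 - d, u0 + d[%classic u -> mu.-integrable `[a, b] (EFin \o g u).
  by move=> uI; apply: cont_integrable; have [] := Hd _ (Id _ uI).
have dr x y : `]u0 - d, u0 + d[%classic x -> `[a, b]%classic y -> derivable (g ^~ y) x 1.
  by move=> xI yab; have [] := der x xI y yab.
have intG : mu.-integrable `[a, b] (EFin \o (fun=> M + 1)).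
  exact/cont_integrable/cont_cst.
have Gub x y : `]u0 - d, u0 + d[%classic x -> `[a, b]%classic y ->
    `|partial1of2 g x y| <= M + 1.
  move=> xI yab; have [_ ->] := der x xI y yab.
  by have [_ _ ] := Hd _ (Id _ xI); exact.
have mab : measurable (`[a, b] : set R) by [].
have := @derivable_under_integral R _ _ mu g `[a, b] mab u0 _ _ Iu0 int1 dr
  (fun=> M + 1) (fun=> M0) intG Gub.
have := @differentiation_under_integral R _ _ mu g `[a, b] mab u0 _ _ Iu0 int1 dr
  (fun=> M + 1) (fun=> M0) intG Gub.
move=> E1 E2; apply: DeriveDef => //.
rewrite -derive1E E1; apply: eq_rint => t tab.
by have [_ ->] := der u0 Iu0 t tab.
Unshelve. all: by end_near. Qed.

End ParametricIntegral.

(** * Goursat's theorem *)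

Section Goursat.
Context {R : realType}.
Implicit Types (P Q : R -> R -> R) (t y l m : R).

Lemma near_dist t e : 0 < e -> \forall t' \near t, `|t' - t| < e.
Proof. by move=> e0; apply/nbhs_ballP; exists e => // s; rewrite /ball/= distrC. Qed.

(** The counterclockwise integral of [P dt + Q dy] around a rectangle of sides [l] and [m], with
    opposite sides paired. *)
Definition loop P Q t y l m : R :=
  rint t (t + l) (fun s => P s y - P s (y + m)) +
  rint y (y + m) (fun v => Q (t + l) v - Q t v).

(* Pointwise differentiability of the 1-form [P dt + Q dy], with [P_y = Q_t]. *)
Definition closed_form_at P Q t y : Prop :=
  exists p c q : R, forall e : R, 0 < e -> exists2 d : R, 0 < d &
    forall t' y' : R, `|t' - t| < d -> `|y' - y| < d ->
    `|P t' y' - P t y - p * (t' - t) - c * (y' - y)| <= e * (`|t' - t| + `|y' - y|) /\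
    `|Q t' y' - Q t y - c * (t' - t) - q * (y' - y)| <= e * (`|t' - t| + `|y' - y|).

Lemma closed_form_slices P Q t y : closed_form_at P Q t y ->
  [/\ {for t, continuous (P ^~ y)} & {for y, continuous (Q t)}].
Proof.
move=> [p [c [q H]]]; split; apply/cvgrPdist_lt => e e0.
(* Accuracy 1 suffices: the increment is at most [(1 + |p|) |t' - t|]. *)
- have [d d0 Hd] := H 1 ltr01.
  near=> t'; have td : `|t' - t| < d by near: t'; exact: near_dist.
  have [|+ _] := Hd t' y td; [by rewrite subrr normr0|rewrite subrr normr0].
  rewrite mulr0 subr0 addr0 mul1r => H1.
  rewrite distrC -[_ - _](subrK (p * (t' - t))) (le_lt_trans (ler_normD _ _))//.
  rewrite normrM (le_lt_trans (lerD H1 (lexx _)))//.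
  rewrite -[X in X + _]mul1r -mulrDl -ltr_pdivlMl ?ltr_wpDr//.
  by near: t'; apply: near_dist; rewrite mulr_gt0// invr_gt0 ltr_wpDr.
- have [d d0 Hd] := H 1 ltr01.
  near=> t'; have td : `|t' - y| < d by near: t'; exact: near_dist.
  have [|//|_] := Hd t t'; [by rewrite subrr normr0|].
  rewrite subrr normr0 mulr0 subr0 add0r mul1r => H1.
  rewrite distrC -[_ - _](subrK (q * (t' - y))) (le_lt_trans (ler_normD _ _))//.
  rewrite normrM (le_lt_trans (lerD H1 (lexx _)))//.
  rewrite -[X in X + _]mul1r -mulrDl -ltr_pdivlMl ?ltr_wpDr//.
  by near: t'; apply: near_dist; rewrite mulr_gt0// invr_gt0 ltr_wpDr.
Unshelve. all: by end_near. Qed.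

Variables (P Q : R -> R -> R) (a b c d : R).
Hypothesis PQ : forall t y, a <= t <= b -> c <= y <= d -> closed_form_at P Q t y.

Let contP t t' y : a <= t -> t' <= b -> c <= y <= d -> {in `[t, t'], continuous (P ^~ y)}.
Proof.
move=> at_ tb cyd s /[!in_itv]/= /andP[ts st].
have sab : a <= s <= b by rewrite (le_trans at_ ts) (le_trans st tb).
by have [] := closed_form_slices (PQ sab cyd).
Qed.

Let contQ y y' t : c <= y -> y' <= d -> a <= t <= b -> {in `[y, y'], continuous (Q t)}.
Proof.
move=> cy yd atb s /[!in_itv]/= /andP[ys sy].
have scd : c <= s <= d by rewrite (le_trans cy ys) (le_trans sy yd).
by have [] := closed_form_slices (PQ atb scd).
Qed.

(** Each inner side is traversed twice in opposite directions. Writing the sides as [l + l] and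
    [m + m] avoids divisions. *)
Lemma loop_split t y l m : 0 <= l -> 0 <= m ->
  a <= t -> t + (l + l) <= b -> c <= y -> y + (m + m) <= d ->
  loop P Q t y (l + l) (m + m) =
  loop P Q t y l m + loop P Q (t + l) y l m +
  (loop P Q t (y + m) l m + loop P Q (t + l) (y + m) l m).
Proof.
move=> l0 m0 at_ tb cy yd; rewrite /loop.
have h1 : {in `[t, t + l + l], continuous (fun s => P s y)} by apply: contP; lra.
have h2 : {in `[t, t + l + l], continuous (fun s => P s (y + m))} by apply: contP; lra.
have h3 : {in `[t, t + l + l], continuous (fun s => P s (y + m + m))} by apply: contP; lra.
have h4 : {in `[y, y + m + m], continuous (Q t)} by apply: contQ; lra.
have h5 : {in `[y, y + m + m], continuous (Q (t + l))} by apply: contQ; lra.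
have h6 : {in `[y, y + m + m], continuous (Q (t + l + l))} by apply: contQ; lra.
have sub (u v l' : R) (f : R -> R) : 0 <= l' -> {in `[u, v + l'], continuous f} ->
    {in `[u, v], continuous f}.
  by move=> l'0 H s /[!in_itv]/= /andP[us sv]; apply: H; rewrite in_itv/= us; lra.
have sub2 (u v l' : R) (f : R -> R) : 0 <= l' -> {in `[u, v], continuous f} ->
    {in `[u + l', v], continuous f}.
  by move=> l'0 H s /[!in_itv]/= /andP[us sv]; apply: H; rewrite in_itv/= sv; lra.
rewrite !addrA (rintB h1 h3) (rintB h6 h4).
rewrite (rintB (sub _ _ _ _ l0 h1) (sub _ _ _ _ l0 h2)) (rintB (sub _ _ _ _ m0 h5) (sub _ _ _ _ m0 h4)).
rewrite (rintB (sub2 _ _ _ _ l0 h1) (sub2 _ _ _ _ l0 h2)) (rintB (sub _ _ _ _ m0 h6) (sub _ _ _ _ m0 h5)).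
rewrite (rintB (sub _ _ _ _ l0 h2) (sub _ _ _ _ l0 h3)) (rintB (sub2 _ _ _ _ m0 h5) (sub2 _ _ _ _ m0 h4)).
rewrite (rintB (sub2 _ _ _ _ l0 h2) (sub2 _ _ _ _ l0 h3)) (rintB (sub2 _ _ _ _ m0 h6) (sub2 _ _ _ _ m0 h5)).
rewrite (@rint_cat _ (t + l) t (t + l + l) (fun s => P s y)) ?lerDl//.
rewrite (@rint_cat _ (t + l) t (t + l + l) (fun s => P s (y + m + m))) ?lerDl//.
rewrite (@rint_cat _ (y + m) y (y + m + m) (Q t)) ?lerDl//.
rewrite (@rint_cat _ (y + m) y (y + m + m) (Q (t + l + l))) ?lerDl//.
ring.
Qed.

(** The affine part of the form is closed, as both mixed coefficients are [k], so only the remainder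
    contributes: it is at most [e * (l + m)] at each point of the four sides. *)
Lemma loop_small t0 y0 p k q e t y l m : 0 <= e -> 0 <= l -> 0 <= m ->
  a <= t -> t + l <= b -> c <= y -> y + m <= d ->
  t <= t0 <= t + l -> y <= y0 <= y + m ->
  (forall t' y', t <= t' <= t + l -> y <= y' <= y + m ->
    `|P t' y' - P t0 y0 - p * (t' - t0) - k * (y' - y0)| <= e * (`|t' - t0| + `|y' - y0|) /\
    `|Q t' y' - Q t0 y0 - k * (t' - t0) - q * (y' - y0)| <= e * (`|t' - t0| + `|y' - y0|)) ->
  `|loop P Q t y l m| <= e * (l + m) ^+ 2 *+ 2.
Proof.
move=> e0 l0 m0 at_ tb cy yd tt0 yy0 H.
have bnd t' y' : t <= t' <= t + l -> y <= y' <= y + m ->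
    e * (`|t' - t0| + `|y' - y0|) <= e * (l + m).
  by move=> ? ?; rewrite ler_wpM2l// lerD// ler_norml; lra.
have b1 : {in `[t, t + l], continuous (fun s => P s y - P s (y + m))}.
  by move=> s sI; apply: cvgB; apply: (@contP t (t + l)) => //; lra.
have b2 : {in `[y, y + m], continuous (fun v => Q (t + l) v - Q t v)}.
  by move=> s sI; apply: cvgB; apply: (@contQ y (y + m)) => //; lra.
have c1 : {in `[t, t + l], continuous (fun s => P s y - P s (y + m) + k * m)}.
  by move=> s sI; apply: cvgD; [exact: b1|exact: cvg_cst].
have c2 : {in `[y, y + m], continuous (fun v => Q (t + l) v - Q t v - k * l)}.
  by move=> s sI; apply: cvgB; [exact: b2|exact: cvg_cst].
(* The affine part contributes [- k * m] over length [l] and [k * l] over length [m], which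
   cancel. *)
have -> : loop P Q t y l m = rint t (t + l) (fun s => P s y - P s (y + m) + k * m) +
    rint y (y + m) (fun v => Q (t + l) v - Q t v - k * l).
  rewrite /loop (rintD b1 (@cont_cst _ _ _ (k * m))).
  rewrite (rintB b2 (@cont_cst _ _ _ (k * l))).
  rewrite !rint_cst ?lerDl// (addrC t) (addrC y) !addrK; ring.
rewrite (le_trans (ler_normD _ _))//.
have -> : e * (l + m) ^+ 2 *+ 2 =
  e * (l + m) *+ 2 * (t + l - t) + e * (l + m) *+ 2 * (y + m - y).
  rewrite (addrC t) (addrC y) !addrK; ring.
apply: lerD; apply: rint_bound; rewrite ?lerDl//.
  move=> s; rewrite in_itv/= => sI.
  have yI : y <= y <= y + m by lra. have yI' : y <= y + m <= y + m by lra.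
  have [H1 _] := H s y sI yI; have [H2 _] := H s (y + m) sI yI'.
  move: H1 H2 (bnd _ _ sI yI) (bnd _ _ sI yI').
  by rewrite !ler_norml; lra.
move=> s; rewrite in_itv/= => sI.
have yI : t <= t <= t + l by lra. have yI' : t <= t + l <= t + l by lra.
have [_ H1] := H _ _ yI sI; have [_ H2] := H _ _ yI' sI.
move: H1 H2 (bnd _ _ yI sI) (bnd _ _ yI' sI).
by rewrite !ler_norml; lra.
Qed.

(* Goursat's bisection: only pointwise differentiability is available. *)
Lemma goursat : a <= b -> c <= d -> loop P Q a c (b - a) (d - c) = 0.
Proof.
move=> ab cd; apply/eqP; apply: contraT => w0.
set w := `|loop P Q a c (b - a) (d - c)|.
have {}w0 : 0 < w by rewrite normr_gt0.
pose l n : R := (b - a) / 2 ^+ n; pose m n : R := (d - c) / 2 ^+ n.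
have lS n : l n = l n.+1 + l n.+1.
  by rewrite /l exprS; field; rewrite expf_neq0// pnatr_eq0.
have mS n : m n = m n.+1 + m n.+1.
  by rewrite /m exprS; field; rewrite expf_neq0// pnatr_eq0.
have l0 n : 0 <= l n by rewrite divr_ge0 ?exprn_ge0// subr_ge0.
have m0 n : 0 <= m n by rewrite divr_ge0 ?exprn_ge0// subr_ge0.
pose Inv n (x : R * R) := [/\ a <= x.1, x.1 + l n <= b, c <= x.2, x.2 + m n <= d &
  w / 4 ^+ n <= `|loop P Q x.1 x.2 (l n) (m n)|].
(* The invariant is a premise inside the existential, so that [choice] can be applied to every pair;
   the witness [(0, 0)] is a dummy for pairs that violate it. *)
have step (nx : nat * (R * R)) : exists x' : R * R, Inv nx.1 nx.2 ->
    [/\ Inv nx.1.+1 x', nx.2.1 <= x'.1, x'.1 + l nx.1.+1 <= nx.2.1 + l nx.1,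
     nx.2.2 <= x'.2 & x'.2 + m nx.1.+1 <= nx.2.2 + m nx.1].
  case: nx => n [t y] /=; have [|nI] := pselect (Inv n (t, y)); last by exists (0, 0).
  move=> [/= at_ tb cy yd wI].
  have := l0 n.+1; have := m0 n.+1 => m1 l1.
  rewrite lS in tb; rewrite mS in yd.
  have E := loop_split l1 m1 at_ tb cy yd.
  have w4 : w / 4 ^+ n = w / 4 ^+ n.+1 *+ 4.
    by rewrite exprS; field; rewrite expf_neq0// pnatr_eq0.
  rewrite lS mS E w4 in wI.
  have good (t' y' : R) : (t' = t \/ t' = t + l n.+1) -> (y' = y \/ y' = y + m n.+1) ->
     w / 4 ^+ n.+1 <= `|loop P Q t' y' (l n.+1) (m n.+1)| ->
     exists x' : R * R, Inv n (t, y) ->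
    [/\ Inv n.+1 x', t <= x'.1, x'.1 + l n.+1 <= t + l n,
     y <= x'.2 & x'.2 + m n.+1 <= y + m n].
    move=> Ht Hy Hw; exists (t', y') => _.
    have {}Ht : t <= t' <= t + l n.+1 by case: Ht => ->; rewrite ?lexx ?lerDl ?l1.
    have {}Hy : y <= y' <= y + m n.+1 by case: Hy => ->; rewrite ?lexx ?lerDl ?m1.
    move: Ht Hy => /andP[Ht Ht'] /andP[Hy Hy'].
    rewrite (lS n) (mS n) !addrA !lerD2r; split => //; split => //=.
    - exact: le_trans Ht.
    - by rewrite (le_trans _ tb)// addrA lerD2r.
    - exact: le_trans Hy.
    - by rewrite (le_trans _ yd)// addrA lerD2r.
  have [g1|g1] := leP (w / 4 ^+ n.+1) `|loop P Q t y (l n.+1) (m n.+1)|.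
    by apply: good g1; left.
  have [g2|g2] := leP (w / 4 ^+ n.+1) `|loop P Q (t + l n.+1) y (l n.+1) (m n.+1)|.
    by apply: good g2; [right|left].
  have [g3|g3] := leP (w / 4 ^+ n.+1) `|loop P Q t (y + m n.+1) (l n.+1) (m n.+1)|.
    by apply: good g3; [left|right].
  have [g4|g4] := leP (w / 4 ^+ n.+1) `|loop P Q (t + l n.+1) (y + m n.+1) (l n.+1) (m n.+1)|.
    by apply: good g4; [right|right].
  exfalso; have := le_lt_trans (le_trans wI (le_trans (ler_normD _ _)
    (lerD (ler_normD _ _) (ler_normD _ _)))) (ltrD (ltrD g1 g2) (ltrD g3 g4)).
  by rewrite -mulr_natl; lra.
have [F HF] := choice step.
pose x := fix x n := if n is n'.+1 then F (n', x n') else (a, c).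
have xI n : Inv n (x n).
  elim: n => [|n IH]; last by have [] := HF (n, x n) IH.
  by rewrite /Inv /= /l /m expr0 !divr1; split => //; rewrite ?subrKC ?expr0 ?divr1 // addrC subrK.
have xS n := HF (n, x n) (xI n).
have nest (u : nat -> R) (h : nat -> R) : (forall n, u n <= u n.+1) ->
    (forall n, u n.+1 + h n.+1 <= u n + h n) -> (forall n, 0 <= h n) ->
    exists s, forall n, u n <= s <= u n + h n.
  move=> u1 u2 h0.
  have um i j : u i <= u (i + j)%N by elim: j => [|j IH]; rewrite ?addn0// addnS (le_trans IH).
  have uh i j : u (i + j)%N + h (i + j)%N <= u i + h i.
    by elim: j => [|j IH]; rewrite ?addn0// addnS (le_trans _ IH).
  have uv i j : u i <= u j + h j.
    have [ij|/ltnW ij] := leqP i j.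
      by rewrite -(subnKC ij) (le_trans (um _ (j - i)%N))// lerDl.
    by rewrite -{1}(subnKC ij) (le_trans _ (uh _ (i - j)%N))// lerDl.
  have hs : has_sup (range u).
    by split; [exists (u 0%N), 0%N|exists (u 0%N + h 0%N) => _ [i _ <-]].
  exists (sup (range u)) => n; apply/andP; split.
    by apply: sup_upper_bound => //; exists n.
  by apply: sup_le_ub; [exists (u 0%N), 0%N|move=> _ [i _ <-]].
have [t0 t0P] : exists s, forall n, (x n).1 <= s <= (x n).1 + l n.
  by apply: nest => // n; have [] := xS n.
have [y0 y0P] : exists s, forall n, (x n).2 <= s <= (x n).2 + m n.
  by apply: nest => // n; have [] := xS n.
have [p [k [q H]]] : closed_form_at P Q t0 y0.
  have [h1 h2 h3 h4 _] := xI 0%N.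
  have /andP[t1 t2] := t0P 0%N; have /andP[y1 y2] := y0P 0%N.
  by apply: PQ; rewrite ?(le_trans h1 t1) ?(le_trans h3 y1) ?(le_trans t2 h2) ?(le_trans y2 h4).
pose L := b - a + (d - c) + 1.
have L0 : 0 < L by rewrite /L; lra.
(* With this [e] the bound [2 * e * (L / 2 ^+ n) ^+ 2] of [loop_small] is half of [w / 4 ^+ n],
   against the invariant. *)
pose e := w / (4 * L ^+ 2).
have e0 : 0 < e by rewrite divr_gt0// mulr_gt0// exprn_gt0.
have [r r0 Hr] := H e e0.
have [n nr] : exists n : nat, L / 2 ^+ n < r.
  exists (Num.bound (L / r)); rewrite ltr_pdivrMr ?exprn_gt0// -ltr_pdivrMl// mulrC.
  rewrite (lt_trans (archi_boundP _)) ?divr_ge0 ?ltW//.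
  by rewrite -natrX ltr_nat ltn_expl.
have lL : l n + m n <= L / 2 ^+ n by rewrite -mulrDl ler_pM2r ?invr_gt0 ?exprn_gt0// /L; lra.
have [x1 x2 x3 x4 x5] := xI n.
have := l0 n; have := m0 n => mn ln.
have B := @loop_small t0 y0 p k q e (x n).1 (x n).2 (l n) (m n) (ltW e0) ln mn x1 x2 x3 x4
  (t0P n) (y0P n).
have {B} : `|loop P Q (x n).1 (x n).2 (l n) (m n)| <= e * (l n + m n) ^+ 2 *+ 2.
  apply: B => t' y' tI yI; apply: Hr; have := t0P n; have := y0P n; rewrite ltr_norml; lra.
move=> /(le_trans x5); rewrite leNgt => /negP; case.
apply: (@le_lt_trans _ _ (e * (L / 2 ^+ n) ^+ 2 *+ 2)).
  by rewrite lerMn2r/= ler_pM2l// lerXn2r// nnegrE; lra.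
rewrite /e expr_div_n -exprM mulnC exprM -(natrX _ 2 2).
have -> : w / (4 * L ^+ 2) * (L ^+ 2 / (2 ^ 2)%:R ^+ n) *+ 2 = w / 4 ^+ n / 2.
  rewrite -mulr_natl.
  by field; rewrite !expf_neq0 ?pnatr_eq0 ?gt_eqF.
by rewrite ltr_pdivrMr// ltr_pMr ?ltr1n// divr_gt0// exprn_gt0.
Qed.

End Goursat.

(** * Complex differentiability *)

Section ComplexDerivative.
Context {R : realType}.
Local Notation C := (R[i]^o).
Local Notation normc := (@Normc.normc R).
Local Notation Re := (@complex.Re R).
Local Notation Im := (@complex.Im R).
Implicit Types (f g : C -> C) (z w d : C).

(* Caratheodory's form: products, composition, conjugation and square roots
   become algebraic identities plus continuity. *)
Definition cder f z d : Prop :=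
  exists g : C -> C, [/\ forall w, f w - f z = g w * (w - z),
    {for z, continuous g} & g z = d].

(** [cder] asks for a factorization on the whole plane; away from [z] the difference quotient
    supplies it. *)
Lemma cder_near f g z : (\forall w \near z, f w - f z = g w * (w - z)) ->
  {for z, continuous g} -> cder f z (g z).
Proof.
move=> fg cg.
exists (fun w => if w == z then g z else (f w - f z) / (w - z)); split.
- by move=> w; case: eqVneq => [->|wz]; rewrite ?subrr ?mulr0// divfK// subr_eq0.
- rewrite /prop_for /continuous_at eqxx.
  apply: (cvg_trans _ cg); apply: (@near_eq_cvg _ _ (nbhs z) _ g).
  near=> w; case: eqVneq => [->//|wz].
  have -> : f w - f z = g w * (w - z) by near: w.
  by rewrite mulfK// subr_eq0.
- by rewrite eqxx.
Unshelve. all: by end_near. Qed.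

Lemma cder_small f z d (eta : C -> R) :
  (forall w, normc (f w - f z - d * (w - z)) <= eta w * normc (w - z)) ->
  eta @ z --> (0 : R) -> cder f z d.
Proof.
move=> fe e0.
exists (fun w => if w == z then d else (f w - f z) / (w - z)); split.
- by move=> w; case: eqVneq => [->|wz]; rewrite ?subrr ?mulr0// divfK// subr_eq0.
- rewrite /prop_for /continuous_at eqxx.
  apply: (@cvg_of_normc_le _ _ (nbhs z) _ _ _ (fun w => `|eta w|)); last exact/norm_cvg0P.
  apply: nearW => w; case: eqVneq => [->|wz]; first by rewrite subrr Normc.normc0.
  have wz0 : 0 < normc (w - z) by rewrite normc_gt0 subr_eq0.
  rewrite (le_trans _ (ler_norm _))// -(ler_pM2r wz0) -Normc.normcM mulrBl divfK//.
  by rewrite subr_eq0.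
- by rewrite eqxx.
Qed.

Lemma cder_eps f z d : cder f z d -> forall e : R, 0 < e ->
  \forall w \near z, normc (f w - f z - d * (w - z)) <= e * normc (w - z).
Proof.
move=> [g [fg + <-]] e e0 => /cvgcP /(_ e e0); apply: filterS => w gw.
by rewrite fg -mulrBl Normc.normcM ler_wpM2r ?normc_ge0// ltW.
Qed.

Lemma derivable_cder f z : derivable f z 1 -> cder f z (derive1 f z).
Proof.
move=> df; exists (fun w => if w == z then derive1 f z else (f w - f z) / (w - z)).
split; last by rewrite eqxx.
- by move=> w; case: eqVneq => [->|wz]; rewrite ?subrr ?mulr0// divfK// subr_eq0.
- have D : h^-1 * (f (h + z) - f z) @[h --> (0 : C)^'] --> derive1 f z.
    have -> : derive1 f z = 'D_1 f z by rewrite derive1E.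
    have -> : (fun h : C => h^-1 * (f (h + z) - f z)) =
        (fun h : C => h^-1 *: ((f \o shift z) (h *: 1) - f z)).
      by apply/funext => h /=; rewrite -[h *: 1]/(h * 1) mulr1.
    exact: df.
  apply/(continuous_withinNshiftx _ _).1; rewrite eqxx.
  apply: (cvg_trans _ D).
  apply: (@near_eq_cvg _ _ ((0 : C)^') _ (fun h => h^-1 * (f (h + z) - f z))).
  near=> h.
  have h0 : h != 0 by near: h; exact: nbhs_dnbhs_neq.
  rewrite /= ifN; last by rewrite -subr_eq0 addrK.
  by rewrite addrK mulrC.
Unshelve. all: by end_near. Qed.

Lemma cder_cont f z d : cder f z d -> {for z, continuous f}.
Proof.
move=> [g [fg cg _]].
have E : f = fun w => f z + g w * (w - z).
  by apply/funext => w; rewrite -fg addrC subrK.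
rewrite E; apply: ccontD; first exact: ccst.
apply: ccontM; first exact: cg.
apply: ccontB; first exact: cidc.
exact: ccst.
Qed.

Lemma cder_id z : cder id z 1.
Proof. by exists (fun=> 1); split; [move=> w; rewrite mul1r|exact: ccst|]. Qed.

Lemma cder_cst c z : cder (fun=> c) z 0.
Proof.
by exists (fun=> 0); split; [move=> w; rewrite mul0r subrr|exact: ccst|].
Qed.

Lemma cderD f1 f2 z d1 d2 : cder f1 z d1 -> cder f2 z d2 ->
  cder (fun w => f1 w + f2 w) z (d1 + d2).
Proof.
move=> [g1 [E1 c1 <-]] [g2 [E2 c2 <-]].
exists (fun w => g1 w + g2 w); split; last by [].
2: exact: ccontD c1 c2.
by move=> w; rewrite mulrDl -E1 -E2; ring.
Qed.

Lemma cderM f1 f2 z d1 d2 : cder f1 z d1 -> cder f2 z d2 ->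
  cder (fun w => f1 w * f2 w) z (d1 * f2 z + f1 z * d2).
Proof.
move=> D1 D2; have c2 := cder_cont D2; move: D1 D2.
move=> [g1 [E1 c1 <-]] [g2 [E2 cg2 <-]].
exists (fun w => g1 w * f2 w + f1 z * g2 w); split; last by [].
  move=> w; rewrite mulrDl -mulrA (mulrC (f2 w)) mulrA -E1 -mulrA -E2; ring.
apply: ccontD; first exact: ccontM c1 c2.
apply: ccontM cg2; exact: ccst.
Qed.

Lemma cderZ c f z d : cder f z d -> cder (fun w => c * f w) z (c * d).
Proof.
move=> [g [E cg <-]]; exists (fun w => c * g w); split; last by [].
  by move=> w; rewrite -mulrA -E; ring.
by apply: ccontM cg; exact: ccst.
Qed.

Lemma cderB f1 f2 z d1 d2 : cder f1 z d1 -> cder f2 z d2 ->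
  cder (fun w => f1 w - f2 w) z (d1 - d2).
Proof.
move=> [g1 [E1 c1 <-]] [g2 [E2 c2 <-]].
exists (fun w => g1 w - g2 w); split; last by [].
2: exact: ccontB c1 c2.
by move=> w; rewrite mulrBl -E1 -E2; ring.
Qed.

Lemma cder_comp f g z d1 d2 : cder g z d1 -> cder f (g z) d2 ->
  cder (fun w => f (g w)) z (d2 * d1).
Proof.
move=> D1; have cg := cder_cont D1; move: D1 => [k [E ck <-]] [l [E2 cl <-]].
exists (fun w => l (g w) * k w); split; last by [].
  by move=> w; rewrite E2 E mulrA.
by apply: ccontM ck; exact: ccont_comp cg cl.
Qed.

Lemma cder_conj f z d : cder f (conjc z) d ->
  cder (fun w => conjc (f (conjc w))) z (conjc d).
Proof.
move=> [g [E cg <-]]; exists (fun w => conjc (g (conjc w))); split; last by [].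
  by move=> w; rewrite -rmorphB E rmorphM rmorphB /= !conjcK.
apply: ccontJ; apply: (@ccont_comp _ _ g (fun w => conjc w)); last exact: cg.
by apply: ccontJ; exact: cidc.
Qed.

Lemma cder_shift f z c d : cder f (z + c) d -> cder (fun w => f (w + c)) z d.
Proof.
move=> H; rewrite -[d]mulr1; apply: (@cder_comp f (fun w => w + c)); last exact: H.
rewrite -[1]addr0; apply: cderD; [exact: cder_id|exact: cder_cst].
Qed.

(** Near [z], [f w - f z] is [(q w - q z) / (f w + f z)], and the denominator tends to [2 f z],
    which is not zero. *)
Lemma cder_sqrt f q z d : q z != 0 -> (\forall w \near z, f w ^+ 2 = q w) ->
  {for z, continuous f} -> cder q z d -> cder f z (d / (f z *+ 2)).
Proof.
move=> qz fq cf [g [E cg <-]].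
have fz0 : f z != 0.
  by apply: contraNneq qz => fz; rewrite -(nbhs_singleton fq) fz expr0n.
have f2 : f z + f z != 0 by rewrite -mulr2n mulrn_eq0.
have cs : {for z, continuous (fun w => f w + f z)}.
  by apply: ccontD cf _; exact: ccst.
rewrite mulr2n; apply: (@cder_near f (fun w => g w / (f w + f z))); last first.
  exact: (ccontM cg (ccontV cs f2)).
have nz : \forall w \near z, f w + f z != 0.
  have : 0 < normc (f z + f z) by rewrite normc_gt0.
  move/cvgcP: cs => /[apply]; apply: filterS => w; apply: contraTneq => ->.
  by rewrite sub0r normcN ltxx.
near=> w; have fw0 : f w + f z != 0 by near: w.
apply: (mulIf fw0); rewrite mulrAC -(mulrA (g w)) mulVf// mulr1.
have -> : (f w - f z) * (f w + f z) = f w ^+ 2 - f z ^+ 2 by ring.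
rewrite (nbhs_singleton fq) -E; congr (_ - _); near: w; exact: fq.
Unshelve. all: by end_near. Qed.

Lemma cder_line f z (e : C) d (s0 : R) : cder f (z + s0%:C * e) d ->
  is_derive s0 (1 : R) (fun s : R => Re (f (z + s%:C * e))) (Re (d * e)).
Proof.
move=> [g [E cg <-]]; apply/is_derive1_caratheodory.
exists (fun s : R => Re (g (z + s%:C * e) * e)); split; last by [].
  move=> s; rewrite -cReN -cReD E.
  have -> : z + s%:C * e - (z + s0%:C * e) = (s - s0)%:C * e.
    by rewrite rmorphB/=; ring.
  by rewrite mulrCA cReZ mulrC.
apply: ccontRe; apply: ccontM; last exact: ccst.
apply: (@ccont_comp _ _ g (fun s : R => z + s%:C * e)); last exact: cg.
apply: ccontD; first exact: ccst.
by apply: ccontM; [apply: ccontR; exact: idr|exact: ccst].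
Qed.

Definition cexp (z : C) : C := (expR (Re z))%:C * expi (Im z).

Lemma expiD (s t : R) : expi (s + t) = expi s * expi t :> C.
Proof.
rewrite /expi; apply: complex_eqP; rewrite !CE /= ?sinD ?cosD; ring.
Qed.

Lemma normc_expi (t : R) : normc (expi t) = 1.
Proof. by rewrite /expi /= cos2Dsin2 sqrtr1. Qed.

Lemma cexpD z w : cexp (z + w) = cexp z * cexp w.
Proof. by rewrite /cexp !CE expRD expiD rmorphM; ring. Qed.

Lemma normc_cexp z : normc (cexp z) = expR (Re z).
Proof. by rewrite Normc.normcM normcR normc_expi mulr1 ger0_norm ?expR_ge0. Qed.

Lemma cexp_neq0 z : cexp z != 0.
Proof. by rewrite -normc_gt0 normc_cexp expR_gt0. Qed.

Lemma cexp0 : cexp 0 = 1.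
Proof. by rewrite /cexp /expi /= expR0 cos0 sin0; apply: complex_eqP; rewrite !CE/=; ring. Qed.

Lemma cexpN z : cexp (- z) = (cexp z)^-1.
Proof.
by apply: (mulIf (cexp_neq0 z)); rewrite -cexpD addNr cexp0 mulVf// cexp_neq0.
Qed.

Lemma cder_cexp0 : cder cexp 0 1.
Proof.
have /is_derive1_caratheodory[A [EA cA A0]] := is_derive_expR (0 : R).
have /is_derive1_caratheodory[B [EB cB B0]] := is_derive_cos (0 : R).
have /is_derive1_caratheodory[S [ES cS S0]] := is_derive_sin (0 : R).
rewrite expR0 in A0 EA; rewrite sin0 oppr0 in B0; rewrite cos0 in EB; rewrite cos0 sin0 in S0 ES.
(* Near 0, [expR x = 1 + A x * x], [cos y = 1 + B y * y] and [sin y = S y * y]. Then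
   [cexp w - 1 - w] is a combination of [Re w] and [Im w] with coefficients vanishing at 0, and
   [eta] adds up their moduli. *)
pose eta (w : C) : R := `|(A (Re w) - 1) * cos (Im w) + (cos (Im w) - 1)| + `|B (Im w)|
  + (`|(expR (Re w) - 1) * S (Im w) + (S (Im w) - 1)|).
apply: (@cder_small _ _ _ eta).
  move=> w; rewrite cexp0 subr0 mul1r.
  have EA' := EA (Re w); have EB' := EB (Im w); have ES' := ES (Im w).
  rewrite !subr0 in EA' EB' ES'.
  have -> : cexp w - 1 - w = (((A (Re w) - 1) * cos (Im w) + (cos (Im w) - 1)) * Re w + B (Im w) * Im w)
    +i* (((expR (Re w) - 1) * S (Im w) + (S (Im w) - 1)) * Im w).
    apply: complex_eqP; rewrite /cexp /expi !CE /=.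
      have -> : expR (Re w) = A (Re w) * Re w + 1 by rewrite -EA' subrK.
      rewrite -EB'.
      ring.
    by rewrite ES'; ring.
  rewrite (le_trans (normc_le_ReIm _))//=.
  rewrite (le_trans (lerD (ler_normD _ _) (lexx _)))// !normrM.
  by rewrite /eta !mulrDl !lerD// ler_wpM2l// ?ler_Re_normc ?ler_Im_normc.
have cRe : {for (0 : C), continuous (fun w : C => Re w)} by apply: ccontRe; exact: cidc.
have cIm : {for (0 : C), continuous (fun w : C => Im w)} by apply: ccontIm; exact: cidc.
have comp (h : R -> R) (p : C -> R) : {for (0 : C), continuous p} -> p 0 = 0 -> {for (0 : R), continuous h} ->
    {for (0 : C), continuous (fun w => h (p w))}.
  move=> cp p0 ch; have ch' : {for p 0, continuous h} by rewrite p0.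
  exact: (rcont_comp cp ch').
have ce0 : {for (0 : C), continuous eta}.
  have cc := comp _ _ cIm erefl (@continuous_cos R 0).
  have cA' := comp _ _ cRe erefl cA; have cB' := comp _ _ cIm erefl cB.
  have cS' := comp _ _ cIm erefl cS.
  have ce := comp _ _ cRe erefl (@continuous_expR R 0).
  have nrm (u : C -> R) : {for (0 : C), continuous u} -> {for (0 : C), continuous (fun w => `|u w|)}.
    by move=> cu; apply: (@cvg_norm _ _ _ (nbhs (0 : C))).
  have c1 : {for (0 : C), continuous (fun _ : C => (1 : R))} by exact: rcst.
  apply: rcontD; [apply: rcontD|]; apply: nrm.
  - exact: (rcontD (rcontM (rcontB cA' c1) cc) (rcontB cc c1)).
  - exact: cB'.
  - exact: (rcontD (rcontM (rcontB ce c1) cS') (rcontB cS' c1)).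
have <- : eta 0 = 0; last exact: ce0.
by rewrite /eta /= A0 B0 S0 expR0 cos0 !subrr !mul0r !addr0 normr0 !addr0.
Qed.

Lemma cder_cexp z : cder cexp z (cexp z).
Proof.
have -> : cexp = fun w => cexp z * cexp (w - z).
  by apply/funext => w; rewrite -cexpD addrC subrK.
rewrite subrr cexp0 mulr1 -[X in cder _ _ X]mulr1; apply: cderZ; apply: cder_shift.
rewrite subrr; exact: cder_cexp0.
Qed.

End ComplexDerivative.

(** * The derivative as a mean over circles *)

Section CircleFormula.
Context {R : realType}.
Local Notation C := (R[i]^o).
Local Notation normc := (@Normc.normc R).
Local Notation Re := (@complex.Re R).
Local Notation Im := (@complex.Im R).
Implicit Types (f : C -> C) (z w d : C).

(** The form is the imaginary part of [G dz]. By the Cauchy-Riemann equations both of its mixed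
    coefficients are [Re d]. *)
Lemma cder_closed_form (G : C -> C) (t y : R) d : cder G (t +i* y) d ->
  closed_form_at (fun t y => Im (G (t +i* y))) (fun t y => Re (G (t +i* y))) t y.
Proof.
move=> H; exists (Im d), (Re d), (- Im d) => e e0.
have [r r0 Hr] := (nbhscP _ _).1 (cder_eps H e0).
exists (r / 2); first by rewrite divr_gt0.
move=> t' y' tr yr.
have := Hr (t' +i* y'); have -> : (t' +i* y' - (t +i* y) : C) = (t' - t) +i* (y' - y) by [].
set D : C := (t' - t) +i* (y' - y).
have DN : normc D <= `|t' - t| + `|y' - y| by exact: normc_le_ReIm.
have Dr : normc D < r by rewrite (le_lt_trans DN)// (splitr r) ltrD.
move=> /(_ Dr) H1.
have {}H1 := le_trans H1 (ler_wpM2l (ltW e0) DN).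
split; apply: le_trans H1.
  apply: le_trans (ler_Im_normc _); rewrite !CE /= /D.
  by rewrite le_eqVlt; apply/orP; left; apply/eqP; congr (`|_|); ring.
apply: le_trans (ler_Re_normc _); rewrite !CE /= /D.
by rewrite le_eqVlt; apply/orP; left; apply/eqP; congr (`|_|); ring.
Qed.

Lemma expi_periodic (t : R) : expi (t + 2 * pi) = expi t :> C.
Proof. by rewrite /expi mulr_natl sinD2pi cosD2pi. Qed.

Lemma cexp_periodic (x t : R) : cexp (x +i* (t + 2 * pi) : C) = cexp (x +i* t : C).
Proof. by rewrite /cexp /= expi_periodic. Qed.

Lemma continuous_imline (x : R) : continuous (fun t : R => x +i* t : C).
Proof. by move=> t; exact: (ccontMk (rcst x t) (idr t)). Qed.

Lemma continuous_trig (u v : R) : continuous (fun t : R => u * cos t + v * sin t).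
Proof.
move=> t; exact: (rcontD (rcontM (rcst u t) (@continuous_cos R t))
  (rcontM (rcst v t) (@continuous_sin R t))).
Qed.

Lemma rint_trig (u v : R) : rint 0 (2 * pi) (fun t => u * cos t + v * sin t) = 0.
Proof.
rewrite (@rint_FTC _ _ _ (fun t => u * sin t - v * cos t)); last first.
- by move=> t _; exact: continuous_trig.
- move=> t _; have -> : (fun t : R => u * sin t - v * cos t) = (u \*: sin) - (v \*: cos).
    by apply/funext.
  by apply: is_derive_eq; rewrite /GRing.scale /=; ring.
- by rewrite mulr_ge0// pi_ge0.
- by rewrite -[2 * pi]add0r mulr_natl sinD2pi cosD2pi subrr.
Qed.

Section Formula.
Variables (f : C -> C) (z d : C) (r : R).
Hypothesis df : forall w, normc (w - z) < r -> exists d', cder f w d'.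
Hypothesis dz : cder f z d.

(** The substitution [zeta = z + cexp w] turns [f(zeta) / (zeta - z)^2 dzeta] into [G(w) dw].
    Circles about [z] become vertical segments of length [2 * pi], so rectangles take the place of
    annuli. *)
Let G (w : C) : C := f (z + cexp w) * cexp (- w).

Let cderG w : expR (Re w) < r -> exists d', cder G w d'.
Proof.
move=> wr; have [d' Hd'] : exists d', cder f (z + cexp w) d'.
  by apply: df; rewrite addrC addKr normc_cexp.
eexists; apply: cderM.
  apply: (@cder_comp _ f (fun w => z + cexp w)); last exact: Hd'.
  by apply: cderD; [exact: cder_cst|exact: cder_cexp].
apply: (@cder_comp _ cexp (fun w => - w)); last exact: cder_cexp.
have -> : (fun w : C => - w) = (fun w : C => -1 * w) by apply/funext => u; rewrite mulN1r.
by apply: cderZ; exact: cder_id.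
Qed.

Lemma circle_integrand_continuous (x : R) : expR x < r ->
  {in `[0, 2 * pi], continuous (fun t => Re (G (x +i* t)))}.
Proof.
move=> xr t _; have [d' /cder_cont cG] := @cderG (x +i* t) xr.
exact: (ccontRe (ccont_comp (@continuous_imline x t) cG)).
Qed.

Lemma circle_mean_const (x1 x2 : R) : x1 <= x2 -> expR x2 < r ->
  rint 0 (2 * pi) (fun t => Re (G (x1 +i* t))) =
  rint 0 (2 * pi) (fun t => Re (G (x2 +i* t))).
Proof.
move=> x12 x2r; have pi0 : 0 <= 2 * pi :> R by rewrite mulr_ge0// pi_ge0.
have H t y : x1 <= t <= x2 -> 0 <= y <= 2 * pi -> closed_form_at
   (fun t y => Im (G (t +i* y))) (fun t y => Re (G (t +i* y))) t y.
  move=> /andP[_ tx] _; have [|d' H] := @cderG (t +i* y).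
    by rewrite (le_lt_trans _ x2r)// ler_expR.
  exact: cder_closed_form H.
have := @goursat _ _ _ _ _ _ _ H x12 pi0; rewrite /loop !subr0 add0r.
(* [G] has period [2 pi i], hence the two horizontal sides cancel. *)
rewrite (eq_rint (g := fun=> 0)); last first.
  move=> s _; rewrite -[in X in _ - Im (G (_ +i* X))](add0r (2 * pi)) /G !cexpN.
  by rewrite cexp_periodic subrr.
rewrite rint_cst; last by rewrite addrC subrK.
have x1r : expR x1 < r by rewrite (le_lt_trans _ x2r)// ler_expR.
have c1 := circle_integrand_continuous x1r; have c2 := circle_integrand_continuous x2r.
rewrite mul0r add0r (addrC x1) subrK (rintB c2 c1) => /eqP; rewrite subr_eq0 => /eqP E.
exact/esym/E.
Qed.

(* The mean over small circles tends to the derivative, and it does not depend on the radius. *)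
Lemma circle_formula (x : R) : expR x < r ->
  rint 0 (2 * pi) (fun t => Re (G (x +i* t))) = 2 * pi * Re d.
Proof.
move=> xr; apply/eqP; rewrite -subr_eq0 -normr_le0; apply/ler_addgt0Pl => e e0.
rewrite addr0; have pi2 : 0 < 2 * pi :> R by rewrite mulr_gt0// pi_gt0.
have e1 : 0 < e / (2 * pi) by rewrite divr_gt0.
have [s s0 Hs] := (nbhscP _ _).1 (cder_eps dz e1).
(* A circle of radius at most [s / 2], small enough for the first-order expansion of [f] at [z]. *)
pose y := Num.min x (ln (s / 2)).
have yx : y <= x by rewrite ge_min lexx.
have ys : expR y < s.
  rewrite (@le_lt_trans _ _ (s / 2))//; last by rewrite ltr_pdivrMr// ltr_pMr// ltr1n.
  by rewrite -[leRHS]lnK ?posrE ?divr_gt0// ler_expR ge_min lexx orbT.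
rewrite -(circle_mean_const yx xr).
have yr : expR y < r by rewrite (le_lt_trans _ xr)// ler_expR.
(* The contribution of the constant term [f z], whose integral over the circle is 0. *)
pose T t := Re (f z * cexp (- (y +i* t))).
have TE : T = fun t => (expR (- y) * Re (f z)) * cos t + (expR (- y) * Im (f z)) * sin t.
  by apply/funext => t; rewrite /T /cexp /expi !CE /= cosN sinN; ring.
have cT : {in `[0, 2 * pi], continuous T}.
  by rewrite TE => t _; exact: continuous_trig.
have cG := circle_integrand_continuous yr.
have -> : rint 0 (2 * pi) (fun t => Re (G (y +i* t))) - 2 * pi * Re d =
   rint 0 (2 * pi) (fun t => Re (G (y +i* t)) - T t - Re d).
  rewrite rintB; last exact: cont_cst.
    have T0 : rint 0 (2 * pi) T = 0 by rewrite TE rint_trig.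
    by rewrite rintB// T0 subr0 rint_cst ?ltW// subr0 (mulrC (Re d)).
  by move=> t tI; exact: (rcontB (cG t tI) (cT t tI)).
apply: (le_trans (@rint_bound _ 0 (2 * pi) _ (e / (2 * pi)) (ltW pi2) _ _)).
- by move=> t tI; exact: (rcontB (rcontB (cG t tI) (cT t tI)) (rcst _ t)).
- move=> t _; rewrite -cReN -!cReN -!cReD (le_trans (ler_Re_normc _))//.
  set w : C := y +i* t.
  have zE : z + cexp w - z = cexp w by rewrite addrC addKr.
  have -> : G w - f z * cexp (- w) - d =
      (f (z + cexp w) - f z - d * cexp w) * cexp (- w).
    by rewrite /G !mulrBl -(mulrA d) cexpN mulfV ?mulr1// cexp_neq0.
  have := Hs (z + cexp w); rewrite zE normc_cexp => /(_ ys) H.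
  by rewrite Normc.normcM (normc_cexp (- w)) cReN /= expRN ler_pdivrMr ?expR_gt0.
- by rewrite subr0 divfK ?gt_eqF.
Qed.

End Formula.

(** On the circle of radius [r / 2] the integrand of [circle_formula] is at most [M / (r / 2)]. *)
Lemma Re_cder_bound f z d (r M : R) : 0 < r ->
  (forall w, normc (w - z) < r -> exists d', cder f w d') -> cder f z d ->
  (forall w, normc (w - z) < r -> normc (f w) <= M) -> `|Re d| <= M / (r / 2).
Proof.
move=> r0 df dz fM; have pi2 : 0 < 2 * pi :> R by rewrite mulr_gt0// pi_gt0.
pose x := ln (r / 2).
have ex : expR x = r / 2 by rewrite lnK// posrE divr_gt0.
have xr : expR x < r by rewrite ex ltr_pdivrMr// ltr_pMr// ltr1n.
have := circle_formula df dz xr; move/(congr1 (fun u => `|u|)).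
rewrite normrM (gtr0_norm pi2) => E.
rewrite -(ler_pM2l pi2) -E [leRHS](_ : _ = M / (r / 2) * (2 * pi - 0)); last first.
  by rewrite subr0 mulrC.
apply: rint_bound.
- exact: ltW.
- exact: (circle_integrand_continuous df).
- move=> t _; rewrite (le_trans (ler_Re_normc _))// Normc.normcM normc_cexp cReN/= expRN ex.
  rewrite ler_wpM2r ?invr_ge0 ?divr_ge0 ?(ltW r0)//.
  by apply: fM; rewrite addrC addKr normc_cexp.
Qed.

Lemma cder_muli f z d : cder f z d -> cder (fun w => - 'i%C * f w) z (- 'i%C * d).
Proof. exact: cderZ. Qed.

Lemma Re_muli z : Re (- 'i%C * z) = Im z.
Proof. by rewrite !CE /=; ring. Qed.

Lemma Im_muli z : Im (- 'i%C * z) = - Re z.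
Proof. by rewrite !CE /=; ring. Qed.

Lemma normc_muli z : normc (- 'i%C * z) = normc z.
Proof. by rewrite Normc.normcM normcN /= expr0n expr1n add0r sqrtr1 mul1r. Qed.

(** The imaginary part of [d] is the real part of the derivative of [- 'i%C * f]; each part is at
    most [2 * M / r]. *)
Lemma cauchy_bound f z d (r M : R) : 0 < r ->
  (forall w, normc (w - z) < r -> exists d', cder f w d') -> cder f z d ->
  (forall w, normc (w - z) < r -> normc (f w) <= M) -> normc d <= 4 * M / r.
Proof.
move=> r0 df dz fM; rewrite (le_trans (normc_le_ReIm _))//.
have H1 := Re_cder_bound r0 df dz fM.
have H2 : `|Im d| <= M / (r / 2).
  rewrite -Re_muli; apply: (Re_cder_bound r0 _ (cder_muli dz)).
    by move=> w /df[d' Hd']; exists (- 'i%C * d'); exact: cder_muli.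
  by move=> w wr; rewrite normc_muli; exact: fM.
rewrite (le_trans (lerD H1 H2))// invfM invrK le_eqVlt; apply/orP; left; apply/eqP.
ring.
Qed.

(** One radius, [r / 4], serves all centres within [r / 2] of [z]. The derivative is thus an
    integral whose integrand is continuous in the centre. *)
Lemma Re_cder_continuous f (df : C -> C) z (r : R) : 0 < r ->
  (forall w, normc (w - z) < r -> cder f w (df w)) ->
  (fun w => Re (df w)) @ z --> Re (df z).
Proof.
move=> r0 dfH; have pi2 : 0 < 2 * pi :> R by rewrite mulr_gt0// pi_gt0.
pose x := ln (r / 4).
have r4 : 0 < r / 4 by rewrite divr_gt0.
have ex : expR x = r / 4 by rewrite lnK// posrE.
pose F (w : C) (t : R) := Re (f (w + cexp (x +i* t)) * cexp (- (x +i* t))).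
have r2 : 0 < r / 2 by rewrite divr_gt0.
have small w : normc (w - z) < r / 2 -> forall w', normc (w' - w) < r / 2 ->
    cder f w' (df w').
  move=> wr w' w'r; apply: dfH; rewrite -(subrKA w) (splitr r).
  by rewrite (le_lt_trans (normcD _ _))// ltrD.
have xr : expR x < r / 2 by rewrite ex; lra.
have formula w : normc (w - z) < r / 2 -> Re (df w) = (2 * pi)^-1 * rint 0 (2 * pi) (F w).
  move=> wr; rewrite (@circle_formula f w (df w) (r / 2) _ _ x xr).
  - by rewrite mulrA mulVf ?mul1r// gt_eqF.
  - by move=> w' w'r; exists (df w'); exact: small w'r.
  - by apply: small wr _ _; rewrite subrr Normc.normc0.
have zr : normc (z - z) < r / 2 by rewrite subrr Normc.normc0.
rewrite (formula z zr).
have E : \forall w \near z, (2 * pi)^-1 * rint 0 (2 * pi) (F w) = Re (df w).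
  by near=> w; rewrite formula//; near: w; exact: nbhs_normc.
apply: (cvg_trans (near_eq_cvg E)).
have cF : (fun w => rint 0 (2 * pi) (F w)) @ z --> rint 0 (2 * pi) (F z).
  apply: param_continuous; first exact: ltW.
    near=> w; have wr : normc (w - z) < r / 2 by near: w; exact: nbhs_normc.
    apply: (@circle_integrand_continuous f w (r / 2)); last exact: xr.
    by move=> w' w'r; exists (df w'); exact: small wr _ w'r.
  move=> t _.
  have c2 : {for (z, t), continuous (fun p : C * R => p.2)} by exact: cvg_snd.
  have c1 : {for (z, t), continuous (fun p : C * R => p.1)} by exact: cvg_fst.
  have cl := ccontMk (rcst x (z, t)) c2.
  have ce := ccont_comp cl (cder_cont (cder_cexp (x +i* t))).
  have ce' := ccont_comp (ccontN cl) (cder_cont (cder_cexp (- (x +i* t)))).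
  have cf : {for z + cexp (x +i* t), continuous f}.
    by apply: cder_cont (dfH _ _); rewrite addrC addKr normc_cexp /= ex; lra.
  exact: (ccontRe (ccontM (ccont_comp (ccontD c1 ce) cf) ce')).
exact: (rcontM (rcst _ z) cF).
Unshelve. all: by end_near. Qed.

Lemma cder_continuous f (df : C -> C) z (r : R) : 0 < r ->
  (forall w, normc (w - z) < r -> cder f w (df w)) -> {for z, continuous df}.
Proof.
move=> r0 dfH; have H1 := Re_cder_continuous r0 dfH.
have dfH' w : normc (w - z) < r -> cder (fun w => - 'i%C * f w) w (- 'i%C * df w).
  by move=> /dfH; exact: cder_muli.
have H2 : (fun w => Im (df w)) @ z --> Im (df z).
  have := Re_cder_continuous r0 dfH'; rewrite Re_muli.
  by under eq_fun do rewrite Re_muli.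
exact: (@cvgReIm _ _ (nbhs z) _ df _ H1 H2).
Qed.

End CircleFormula.

(** * Square roots of nonvanishing functions *)

Section SquareRoot.
Context {R : realType}.
Local Notation C := (R[i]^o).
Local Notation normc := (@Normc.normc R).
Local Notation Re := (@complex.Re R).
Local Notation Im := (@complex.Im R).
Implicit Types (q : C -> C) (z w : C).

(** The principal root on the right half-plane: [w + |w|] bisects the angle between [w] and the
    positive axis, and its squared modulus is [2 |w| (|w| + Re w)]. *)
Definition psqrt w : C :=
  (w + (normc w)%:C) * ((Num.sqrt (2 * (normc w + Re w)))^-1)%:C.

Lemma psqrt_arg_gt0 w : 0 < Re w -> 0 < 2 * (normc w + Re w).
Proof. by move=> w0; rewrite mulr_gt0// ltr_wpDl// normc_ge0. Qed.

Lemma sqr_psqrt w : 0 < Re w -> psqrt w ^+ 2 = w.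
Proof.
move=> /psqrt_arg_gt0; set s := 2 * _ => s0.
have ss : Num.sqrt s ^+ 2 = s by rewrite sqr_sqrtr// ltW.
have sC : (s%:C : C) != 0 by rewrite -normc_gt0 normcR gtr0_norm.
rewrite /psqrt -/s exprMn -rmorphXn/= exprVn ss fmorphV.
apply: (mulIf sC); rewrite divfK//.
apply: complex_eqP; rewrite !CE/= /s; have := sqr_normcE w => E; last by ring.
have -> : (Re w + normc w) * (Re w + normc w) - (Im w + 0) * (Im w + 0) =
  Re w ^+ 2 - Im w ^+ 2 + 2 * Re w * normc w + normc w ^+ 2 by ring.
by rewrite E; ring.
Qed.

Lemma psqrt_continuous w : 0 < Re w -> {for w, continuous psqrt}.
Proof.
move=> w0; have s0 := psqrt_arg_gt0 w0; have cn := ccont_normc (cidc w).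
have cs : {for w, continuous (fun w => 2 * (normc w + Re w))}.
  exact: (rcontM (rcst 2 w) (rcontD cn (ccontRe (cidc w)))).
have cs2 : {for w, continuous (fun w => Num.sqrt (2 * (normc w + Re w)))}.
  exact: (rcont_comp cs (@sqrt_continuous R _)).
have cs3 : {for w, continuous (fun w => (Num.sqrt (2 * (normc w + Re w)))^-1)}.
  apply: (@cvgV R _ (nbhs w)); last exact: cs2.
  by rewrite gt_eqF// sqrtr_gt0.
exact: (ccontM (ccontD (cidc w) (ccontR cn)) (ccontR cs3)).
Qed.

Definition csquare (r : R) : set C :=
  (fun p : R * R => p.1 +i* p.2 : C) @` (`[- r, r] `*` `[- r, r]).

Lemma in_csquare (r : R) z : `|Re z| <= r -> `|Im z| <= r -> csquare r z.
Proof.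
move=> zr zi; exists (Re z, Im z); last by case: z {zr zi}.
by split; rewrite /= in_itv/= -ler_norml.
Qed.

Lemma csquare_compact (r : R) : compact (csquare r).
Proof.
apply: continuous_compact; last by apply: compact_setX; exact: segment_compact.
apply: continuous_subspaceT => p.
have c1 : {for p, continuous (fun p : R * R => p.1)} by exact: cvg_fst.
have c2 : {for p, continuous (fun p : R * R => p.2)} by exact: cvg_snd.
exact: (ccontMk c1 c2).
Qed.

(** This keeps the ratio [q w / q z] in the open unit disk about 1, hence in the half-plane where
    [psqrt] is continuous. The distance [d] plays the part of the parameter in the tube lemma. *)
Lemma nonvanishing_uniform q (r : R) : continuous q -> (forall z, q z != 0) ->
  exists2 d : R, 0 < d & forall z w, csquare r z -> normc (w - z) < d ->
    normc (q w - q z) < normc (q z).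
Proof.
move=> cq q0.
have := @compact_near_uniform R C (csquare r) 0 (fun d z =>
  forall w, normc (w - z) < d -> normc (q w - q z) < normc (q z)) (@csquare_compact r).
have H z : csquare r z -> \forall p \near (0 : R, z),
    forall w, normc (w - p.2) < p.1 -> normc (q w - q p.2) < normc (q p.2).
  (* If [q v] and [q w] are within a third of [|q z|] of [q z], they differ by less than two thirds
     of [|q z|], while [|q v|] exceeds that amount. *)
  move=> _; have e0 : 0 < normc (q z) / 3 by rewrite divr_gt0// normc_gt0.
  have /cvgcP /(_ _ e0) /nbhscP[d d0 Hd] := cq z.
  have d2 : 0 < d / 2 by rewrite divr_gt0.
  exists ([set u : R | `|u - 0| < d / 2], [set v : C | normc (v - z) < d / 2]).
    split; first exact: near_dist.
    exact: nbhs_normc.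
  move=> [u v] /= [ud vd] w wu.
  have vd' : normc (v - z) < d by rewrite (lt_trans vd)// ltr_pdivrMr// ltr_pMr// ltr1n.
  have wd : normc (w - z) < d.
    rewrite -(subrKA v) (le_lt_trans (normcD _ _))// (splitr d) ltrD//.
    by rewrite (lt_trans wu)// (le_lt_trans (ler_norm _))// -[u]subr0.
  have h1 := Hd _ vd'; have h2 := Hd _ wd.
  have h3 : normc (q w - q v) <= normc (q w - q z) + normc (q v - q z).
    by rewrite -(subrKA (q z)) (le_trans (normcD _ _))// lerD2l normcB.
  have h4 : normc (q z) - normc (q v) <= normc (q v - q z).
    by rewrite normcB normc_triB.
  lra.
move=> /(_ H) /nbhs_ballP[e /= e0 He].
exists (e / 2); first by rewrite divr_gt0.
move=> z w Kz wz; apply: (He (e / 2)) => //.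
by rewrite /ball/= sub0r normrN gtr0_norm ?divr_gt0// ltr_pdivrMr// ltr_pMr// ltr1n.
Qed.

(* The square root is continued along the segment from 0, as a finite product
   of principal square roots of ratios close to 1. *)
Lemma continuous_sqrt q (r : R) : continuous q -> (forall z, q z != 0) ->
  exists h : C -> C, forall z, `|Re z| <= r -> `|Im z| <= r ->
    h z ^+ 2 = q z /\ {for z, continuous h}.
Proof.
move=> cq q0; have [d d0 Hd] := nonvanishing_uniform r cq q0.
(* Enough pieces for [|z| / n <= 2 * r / n < d] throughout the square. *)
pose n := (Num.bound (2 * r / d)).+1.
have n0 : 0 < n%:R :> R by rewrite ltr0n.
have nd z : `|Re z| <= r -> `|Im z| <= r -> normc (n%:R^-1%:C * z) < d.
  move=> zr zi; rewrite Normc.normcM normcR ger0_norm ?invr_ge0 ?ltW//.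
  rewrite mulrC ltr_pdivrMr// (le_lt_trans (normc_le_ReIm _))//.
  have r0 : 0 <= r by exact: le_trans (normr_ge0 _) zr.
  have : 2 * r / d < n%:R.
    rewrite (lt_le_trans (archi_boundP _))//; last by rewrite ler_nat.
    by rewrite divr_ge0 ?mulr_ge0// ltW.
  by rewrite ltr_pdivrMr//; lra.
pose p (k : nat) z : C := (k%:R / n%:R)%:C * z.
pose rho k z := q (p k.+1 z) / q (p k z).
have pS k z : p k.+1 z - p k z = n%:R^-1%:C * z.
  by rewrite /p -mulrBl -rmorphB/= -mulrBl -natrB// subSnn mul1r.
have rhoP k z : (k < n)%N -> `|Re z| <= r -> `|Im z| <= r -> 0 < Re (rho k z).
  move=> kn zr zi; have : normc (rho k z - 1) < 1.
    have -> : rho k z - 1 = (q (p k.+1 z) - q (p k z)) / q (p k z).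
      by rewrite mulrBl divff.
    rewrite Normc.normcM Normc.normcV ltr_pdivrMr ?normc_gt0// mul1r.
    apply: Hd; last by rewrite pS; exact: nd.
    have k1 : `|k%:R / n%:R : R| <= 1.
      by rewrite ger0_norm ?divr_ge0// ler_pdivrMr// mul1r ler_nat ltnW.
    have shrink (u : R) : `|u| <= r -> `|k%:R / n%:R * u| <= r.
      by move=> ur; rewrite normrM (le_trans _ ur)// ler_piMl.
    by apply: in_csquare; rewrite /p ?cReZ ?cImZ shrink.
  move=> /(le_lt_trans (ler_Re_normc _)); rewrite !CE/= ltr_norml; lra.
have cp k z : {for z, continuous (p k)}.
  exact: (ccontM (ccst _ z) (cidc z)).
have crho k z : {for z, continuous (rho k)}.
  exact: (ccontM (ccont_comp (cp k.+1 z) (cq _)) (ccontV (ccont_comp (cp k z) (cq _)) (q0 _))).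
(* The squares of the factors telescope to [q (p m z)]. *)
pose h m z : C := sqrtc (q 0) * \prod_(k < m) psqrt (rho k z).
have hP m z : (m <= n)%N -> `|Re z| <= r -> `|Im z| <= r ->
    h m z ^+ 2 = q (p m z) /\ {for z, continuous (h m)}.
  move=> + zr zi; elim: m => [_|m IH mn].
    split; first by rewrite /h big_ord0 mulr1 sqr_sqrtc /p mul0r mul0r.
    have -> : h 0%N = fun=> sqrtc (q 0) by apply/funext => u; rewrite /h big_ord0 mulr1.
    exact: ccst.
  have [h1 h2] := IH (ltnW mn).
  have hS : h m.+1 = fun z => h m z * psqrt (rho m z).
    by apply/funext => u; rewrite /h big_ord_recr /= mulrA.
  have r0 := rhoP m z mn zr zi.
  rewrite hS; split; last first.
    exact: (ccontM h2 (ccont_comp (crho m z) (psqrt_continuous r0))).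
  by rewrite exprMn h1 sqr_psqrt// /rho mulrC divfK.
exists (h n) => z zr zi; have [h1 h2] := hP n z (leqnn n) zr zi; split => //.
by rewrite h1 /p divff ?mul1r// gt_eqF.
Qed.

End SquareRoot.

(** * Differentiation in height of weighted integrals of holomorphic functions *)

Section WeightedIntegrals.
Context {R : realType}.
Local Notation C := (R[i]^o).
Local Notation normc := (@Normc.normc R).
Local Notation Re := (@complex.Re R).
Local Notation Im := (@complex.Im R).
Implicit Types (H : C -> C) (z w d : C) (t u : R).

Lemma cder_Re_t H t u d : cder H (t +i* u) d ->
  is_derive t (1 : R) (fun s : R => Re (H (s +i* u))) (Re d).
Proof.
move=> Hd; have E (s : R) : (0 +i* u : C) + s%:C * 1 = s +i* u.
  by apply: complex_eqP; rewrite !CE/=; ring.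
have := @cder_line _ H (0 +i* u) 1 d t; rewrite E => /(_ Hd).
by under eq_fun do rewrite E; rewrite mulr1.
Qed.

Lemma cder_Re_u H t u d : cder H (t +i* u) d ->
  is_derive u (1 : R) (fun s : R => Re (H (t +i* s))) (- Im d).
Proof.
move=> Hd; have E (s : R) : (t +i* 0 : C) + s%:C * 'i%C = t +i* s.
  by apply: complex_eqP; rewrite !CE/=; ring.
have := @cder_line _ H (t +i* 0) 'i%C d u; rewrite E => /(_ Hd).
under eq_fun do rewrite E; rewrite cReM /=.
by rewrite mulr0 mulr1 sub0r.
Qed.

Lemma cder_Im_t H t u d : cder H (t +i* u) d ->
  is_derive t (1 : R) (fun s : R => Im (H (s +i* u))) (Im d).
Proof.
move=> /cder_muli /cder_Re_t; rewrite Re_muli.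
by under eq_fun do rewrite Re_muli.
Qed.

Lemma continuous_reline (u : R) : continuous (fun t : R => t +i* u : C).
Proof. by move=> t; exact: (ccontMk (idr t) (rcst u t)). Qed.

(* Since [H_u = i H_t], integrating by parts in [t] moves the derivative in
   [u] onto the weight. *)
Lemma weighted_derive (A B u1 u2 : R) (H dH : C -> C) (om dom : R -> R) (u : R) :
  A <= B -> u1 < u < u2 ->
  (forall t v, A <= t <= B -> u1 < v < u2 ->
    cder H (t +i* v) (dH (t +i* v)) /\ {for (t +i* v : C), continuous dH}) ->
  (forall t, is_derive t (1 : R) om (dom t)) -> continuous dom ->
  om A = 0 -> om B = 0 ->
  is_derive u (1 : R) (fun v => rint A B (fun t => om t * Re (H (t +i* v))))
    (rint A B (fun t => dom t * Im (H (t +i* u)))).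
Proof.
move=> AB uI HH dO cdom omA omB.
have com t : {for t, continuous om}.
  by apply/differentiable_continuous/derivable1_diffP; have [] := dO t.
have cH t v : A <= t <= B -> u1 < v < u2 -> {for (t +i* v : C), continuous H}.
  by move=> tI vI; have [/cder_cont] := HH t v tI vI.
have inAB t : t \in `[A, B] -> A <= t <= B by rewrite in_itv.
have nearu : \forall v \near u, u1 < v < u2.
  have /andP[a b] := uI; near=> v; apply/andP; split; near: v.
    exact: lt_nbhsr.
  exact: lt_nbhsl.
have c1 : {in `[A, B], continuous (fun t => dom t * Im (H (t +i* u)))}.
  move=> t /inAB tI; have cHt := cH t u tI uI.
  exact: (rcontM (cdom t) (ccontIm (ccont_comp (@continuous_reline u t) cHt))).
have c2 : {in `[A, B], continuous (fun t => om t * Im (dH (t +i* u)))}.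
  move=> t /inAB tI; have [_ cHt] := HH t u tI uI.
  exact: (rcontM (com t) (ccontIm (ccont_comp (@continuous_reline u t) cHt))).
have parts : rint A B (fun t => dom t * Im (H (t +i* u)) + om t * Im (dH (t +i* u))) = 0.
  rewrite (@rint_FTC _ A B (fun t => om t * Im (H (t +i* u)))) ?omA ?omB ?mul0r ?subrr//.
    move=> t /inAB tI; have [/cder_Im_t dI _] := HH t u tI uI.
    have := @is_deriveM _ _ om (fun s => Im (H (s +i* u))) t 1 _ _ (dO t) dI.
    rewrite [X in is_derive _ _ X](_ : _ = fun t => om t * Im (H (t +i* u)))//.
    by move=> ?; apply: is_derive_eq; rewrite /GRing.scale/= addrC mulrC.
  by move=> t tI; exact: (rcontD (c1 t tI) (c2 t tI)).
rewrite rintD// in parts.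
have -> : rint A B (fun t => dom t * Im (H (t +i* u))) =
          rint A B (fun t => om t * - Im (dH (t +i* u))).
  under [in RHS]eq_fun do rewrite mulrN -mulN1r.
  by rewrite rintZ// mulN1r; apply/eqP; rewrite -addr_eq0 parts.
apply: (@param_derive _ (fun v t => om t * Re (H (t +i* v)))
  (fun v t => om t * - Im (dH (t +i* v)))) => //.
- near=> v; move=> t /inAB tI; have vI : u1 < v < u2 by near: v.
  exact: (rcontM (com t) (ccontRe (ccont_comp (@continuous_reline v t) (cH t v tI vI)))).
- near=> v; move=> t /inAB tI; have vI : u1 < v < u2 by near: v.
  have [/cder_Re_u dR _] := HH t v tI vI.
  have := is_deriveZ (om t) dR.
  by rewrite [X in is_derive _ _ X](_ : _ = fun v => om t * Re (H (t +i* v))).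
- move=> t /inAB tI; have [_ cHt] := HH t u tI uI.
  exact: (rcontM (com t) (rcontN (ccontIm (ccont_comp (@continuous_reline u t) cHt)))).
- move=> t /inAB tI; have [_ cHt] := HH t u tI uI.
  have p1 : {for (u, t), continuous (fun p : R * R => p.1)} by exact: cvg_fst.
  have p2 : {for (u, t), continuous (fun p : R * R => p.2)} by exact: cvg_snd.
  exact: (rcontM (rcont_comp p2 (com t)) (rcontN (ccontIm (ccont_comp (ccontMk p2 p1) cHt)))).
Unshelve. all: by end_near. Qed.

End WeightedIntegrals.

(** * Almost convexity of weighted means *)

Section AlmostConvexity.
Context {R : realType}.
Local Notation C := (R[i]^o).
Local Notation normc := (@Normc.normc R).
Local Notation Re := (@complex.Re R).
Local Notation Im := (@complex.Im R).
Implicit Types (t u y : R).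

Section Weight.
Variables A B : R.

(* The fourth power makes the second derivative of [chi] at most a constant
   times the square root of [chi]. *)
Definition bump t : R := (t - A) * (B - t).
Definition dbump t : R := A + B - 2 * t.
Definition chi t : R := bump t ^+ 4.
Definition dchi t : R := 4 * bump t ^+ 3 * dbump t.
Definition ddchi t : R := 12 * bump t ^+ 2 * dbump t ^+ 2 - 8 * bump t ^+ 3.

Lemma is_derive_bump t : is_derive t (1 : R) bump (dbump t).
Proof.
have -> : bump = (id - cst A) * (cst B - id) by apply/funext.
by apply: is_derive_eq; rewrite !fctE /GRing.scale /= /dbump; ring.
Qed.

Lemma is_derive_dbump t : is_derive t (1 : R) dbump (- 2).
Proof.
have -> : dbump = cst (A + B) - (2 \*: id) by apply/funext.
by apply: is_derive_eq; rewrite /GRing.scale /=; ring.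
Qed.

Lemma is_derive_chi t : is_derive t (1 : R) chi (dchi t).
Proof.
have d := is_derive_bump t; have -> : chi = bump ^+ 4 by apply/funext.
by apply: is_derive_eq; rewrite ?fctE /GRing.scale /= /dchi; ring.
Qed.

Lemma is_derive_dchi t : is_derive t (1 : R) dchi (ddchi t).
Proof.
have d := is_derive_bump t; have d' := is_derive_dbump t.
have -> : dchi = (4 \*: bump ^+ 3) * dbump by apply/funext.
by apply: is_derive_eq; rewrite ?fctE /= /GRing.scale /= /ddchi; ring.
Qed.

Lemma continuous_bump : continuous bump.
Proof. by move=> t; exact: (rcontM (rcontB (idr t) (rcst A t)) (rcontB (rcst B t) (idr t))). Qed.

Lemma continuous_dbump : continuous dbump.
Proof. by move=> t; exact: (rcontB (rcst (A + B) t) (rcontM (rcst 2 t) (idr t))). Qed.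

Lemma rcontX n (f : R -> R) t : {for t, continuous f} -> {for t, continuous (fun s => f s ^+ n)}.
Proof.
move=> cf; elim: n => [|n IH]; first exact: rcst.
have -> : (fun s => f s ^+ n.+1) = fun s => f s * f s ^+ n.
  by apply/funext => s; rewrite exprS.
exact: (rcontM cf IH).
Qed.

Lemma continuous_chi : continuous chi.
Proof. by move=> t; exact: rcontX (@continuous_bump t). Qed.

Lemma continuous_dchi : continuous dchi.
Proof.
move=> t; rewrite /dchi.
exact: (rcontM (rcontM (rcst 4 t) (@rcontX 3 _ _ (@continuous_bump t)))
  (@continuous_dbump t)).
Qed.

Lemma continuous_ddchi : continuous ddchi.
Proof.
move=> t; rewrite /ddchi.
exact: (rcontB (rcontM (rcontM (rcst 12 t) (@rcontX 2 _ _ (@continuous_bump t)))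
  (@rcontX 2 _ _ (@continuous_dbump t))) (rcontM (rcst 8 t) (@rcontX 3 _ _ (@continuous_bump t)))).
Qed.

Lemma bump_ge0 t : A <= t <= B -> 0 <= bump t.
Proof. by move=> /andP[a b]; rewrite mulr_ge0// subr_ge0. Qed.

Lemma bump_le t : A <= t <= B -> bump t <= (B - A) ^+ 2.
Proof.
by move=> tI; rewrite expr2; apply: ler_pM; lra.
Qed.

Lemma chi_ge0 t : 0 <= chi t.
Proof. by rewrite /chi (exprM _ 2 2) sqr_ge0. Qed.

Lemma chi_le t : A <= t <= B -> chi t <= (B - A) ^+ 8.
Proof.
move=> tI; rewrite /chi (exprM _ 2 4) lerXn2r// ?nnegrE ?bump_ge0 ?sqr_ge0//.
exact: bump_le.
Qed.

(** With [|dbump| <= B - A] and [bump <= (B - A)^2] the coefficients 12 and 8 add up to 20. The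
    factor [bump ^+ 2] left over is the square root of [chi]. *)
Lemma ddchi_le t : A <= t <= B -> `|ddchi t| <= 20 * (B - A) ^+ 2 * bump t ^+ 2.
Proof.
move=> tI; have s0 := bump_ge0 tI; have sL := bump_le tI.
have d2 : dbump t ^+ 2 <= (B - A) ^+ 2.
  by rewrite -ler_sqrt ?sqr_ge0// !sqrtr_sqr [leRHS]ger0_norm ?ler_norml /dbump; move: tI; lra.
have -> : ddchi t = (12 * dbump t ^+ 2 - 8 * bump t) * bump t ^+ 2.
  by rewrite /ddchi; ring.
rewrite normrM (ger0_norm (sqr_ge0 (bump t))) ler_wpM2r ?sqr_ge0//.
have := sqr_ge0 (dbump t); rewrite ler_norml; lra.
Qed.

Lemma chi_ends : [/\ chi A = 0, chi B = 0, dchi A = 0 & dchi B = 0].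
Proof. by rewrite /chi /dchi /bump !subrr ?mul0r ?mulr0 !expr0n /= ?mulr0 ?mul0r. Qed.

End Weight.

Section Core.
Variables (A B Y N S : R) (h dh : C -> C).
Hypotheses (AB : A <= B) (N0 : 0 <= N).
Hypothesis hD : forall t y, A <= t <= B -> 0 < y < Y ->
  cder h (t +i* y) (dh (t +i* y)) /\ {for (t +i* y : C), continuous dh}.
Hypothesis hN : forall t y, A <= t <= B -> 0 < y < Y -> normc (h (t +i* y)) ^+ 2 <= N / y.
Local Notation chi := (chi A B).
Local Notation K y := (rint A B (fun t => chi t * normc (h (t +i* y)) ^+ 2)).
Hypothesis KS : forall y, 0 < y < Y -> K y <= S.

Let L := B - A.
(** In the bound of [j'], 10 is half of the 20 of [ddchi_le], by the arithmetic-geometric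
    inequality, [L + S] bounds the integral of [1 + chi |h|^2], and [Num.sqrt N] comes from the
    pointwise bound of [h]. *)
Let c := 10 * L ^+ 2 * (L + S) * Num.sqrt N.

Let conth t y : A <= t <= B -> 0 < y < Y -> {for t, continuous (fun t => h (t +i* y))}.
Proof.
move=> tI yI; have [/cder_cont ch _] := hD tI yI.
exact: (ccont_comp (@continuous_reline R y t) ch).
Qed.

Let inAB t : t \in `[A, B] -> A <= t <= B. Proof. by rewrite in_itv. Qed.

(* [k u] is the integral of [chi(t) Re (h(t + i(m+u)) conj h(t + i(m-u)))].
   The integrand is the real part of a holomorphic function [H] of [t + iu],
   so both derivatives in [u] fall on the weight: [k' = j], [j 0 = 0], and
   [j'] is an integral against [chi'']. Expanding [|h_+ - h_-|^2] then
   bounds the midpoint defect of [K]. *)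
Section Height.
Variable m : R.
Hypotheses (m0 : 0 < m) (mY : 2 * m < Y).

Let H (z : C) : C := h (z + (0 +i* m)) * conjc (h (conjc z + (0 +i* m))).
Let dH (z : C) : C := dh (z + (0 +i* m)) * conjc (h (conjc z + (0 +i* m))) +
   h (z + (0 +i* m)) * conjc (dh (conjc z + (0 +i* m))).

Let zm t u : (t +i* u : C) + (0 +i* m) = t +i* (m + u).
Proof. by apply: complex_eqP; rewrite !CE/=; ring. Qed.
Let zJm t u : (conjc (t +i* u) : C) + (0 +i* m) = t +i* (m - u).
Proof. by apply: complex_eqP; rewrite !CE/=; ring. Qed.

Let HE t u : H (t +i* u) = h (t +i* (m + u)) * conjc (h (t +i* (m - u))).
Proof. by rewrite /H zm zJm. Qed.

Let HdH t u : A <= t <= B -> - m < u < m ->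
  cder H (t +i* u) (dH (t +i* u)) /\ {for (t +i* u : C), continuous dH}.
Proof.
move=> tI uI; have m0' := m0; have mY' := mY; have up : 0 < m + u < Y by lra.
have um : 0 < m - u < Y by lra.
have [d1 c1] := hD tI up; have [d2 c2] := hD tI um.
rewrite -zm in d1 c1; rewrite -zJm in d2 c2.
have cs : {for (t +i* u : C), continuous (fun z : C => z + (0 +i* m))}.
  exact: (ccontD (cidc _) (ccst _ _)).
have cj : {for (t +i* u : C), continuous (fun z : C => conjc z + (0 +i* m) : C)}.
  exact: (ccontD (ccontJ (cidc _)) (ccst _ _)).
split.
  apply: cderM; first exact: cder_shift d1.
  apply: (@cder_conj _ (fun z => h (z + (0 +i* m)))); exact: cder_shift d2.
have h1 := ccont_comp cs (cder_cont d1); have h2 := ccont_comp cj (cder_cont d2).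
exact: (ccontD (ccontM (ccont_comp cs c1) (ccontJ h2)) (ccontM h1 (ccontJ (ccont_comp cj c2)))).
Qed.

Let k u := rint A B (fun t => chi t * Re (H (t +i* u))).
Let j u := rint A B (fun t => dchi A B t * Im (H (t +i* u))).
Let j' u := rint A B (fun t => ddchi A B t * - Re (H (t +i* u))).

Let dk u : - m < u < m -> is_derive u (1 : R) k (j u).
Proof.
move=> uI; have [e1 e2 _ _] := chi_ends A B.
apply: (@weighted_derive _ A B (- m) m H dH chi (dchi A B)) => //.
- by move=> t; exact: is_derive_chi.
- exact: continuous_dchi.
Qed.

Let dj u : - m < u < m -> is_derive u (1 : R) j (j' u).
Proof.
move=> uI; have [_ _ e1 e2] := chi_ends A B.
have := @weighted_derive _ A B (- m) m (fun z => - 'i%C * H z) (fun z => - 'i%C * dH z)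
  (dchi A B) (ddchi A B) u AB uI.
have -> : (fun v => rint A B (fun t => dchi A B t * Re (- 'i%C * H (t +i* v)))) = j.
  by apply/funext => v; apply: eq_rint => t _; rewrite Re_muli.
have -> : rint A B (fun t => ddchi A B t * Im (- 'i%C * H (t +i* u))) = j' u.
  by apply: eq_rint => t _; rewrite Im_muli.
apply; [| | |exact: e1|exact: e2].
- move=> t v tI vI; have [d1 c1] := HdH tI vI; split; first exact: cder_muli.
  exact: (ccontM (ccst _ _) c1).
- by move=> t; exact: is_derive_dchi.
- exact: continuous_ddchi.
Qed.

Let contH t u : A <= t <= B -> - m < u < m -> {for t, continuous (fun t => H (t +i* u))}.
Proof.
move=> tI uI; have [/cder_cont cH _] := HdH tI uI.
exact: (ccont_comp (@continuous_reline R u t) cH).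
Qed.

Let j0 : j 0 = 0.
Proof.
rewrite /j (eq_rint (g := fun=> 0)) ?rint_cst ?mul0r// => t _.
rewrite HE addr0 subr0 !CE; ring.
Qed.

(** Only the factor at the lower height [m - u] is estimated pointwise, by [sqrt (N / (m - u))]. The
    factor at [m + u] enters through its weighted mean, at most [S]. *)
Let j'_le u : 0 <= u < m -> `|j' u| <= c / Num.sqrt (m - u).
Proof.
have m0' := m0; have mY' := mY; have AB' := AB.
move=> uI; have uI' : - m < u < m by lra.
have um : 0 < m - u < Y by lra.
have up : 0 < m + u < Y by lra.
set r := Num.sqrt N / Num.sqrt (m - u).
have r0 : 0 <= r by rewrite divr_ge0 ?sqrtr_ge0.
have cj' : {in `[A, B], continuous (fun t => ddchi A B t * - Re (H (t +i* u)))}.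
  move=> t /inAB tI.
  exact: (rcontM (@continuous_ddchi A B t) (rcontN (ccontRe (contH tI uI')))).
have ch : {in `[A, B], continuous (fun t => chi t * normc (h (t +i* (m + u))) ^+ 2)}.
  move=> t /inAB tI.
  exact: (rcontM (@continuous_chi A B t) (@rcontX 2 _ _ (ccont_normc (conth tI up)))).
have cb : {in `[A, B], continuous (fun t =>
    10 * L ^+ 2 * r * (1 + chi t * normc (h (t +i* (m + u))) ^+ 2))}.
  by move=> t tI; exact: (rcontM (rcst _ t) (rcontD (rcst 1 t) (ch t tI))).
rewrite /j' (le_trans (rint_norm cj'))//.
apply: (@le_trans _ _ (rint A B (fun t =>
    10 * L ^+ 2 * r * (1 + chi t * normc (h (t +i* (m + u))) ^+ 2)))).
  apply: le_rint; [exact: cont_norm|exact: cb|].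
  move=> t /inAB tI; rewrite normrM normrN.
  have b0 := bump_ge0 tI; have d0 := ddchi_le tI.
  set hp := normc (h (t +i* (m + u))); set hm := normc (h (t +i* (m - u))).
  have hp0 : 0 <= hp by exact: normc_ge0.
  have hm0 : 0 <= hm by exact: normc_ge0.
  have hmr : hm <= r.
    rewrite -(@ler_pXn2r _ 2)// ?nnegrE// /r expr_div_n !sqr_sqrtr//; last by lra.
    exact: hN.
  have HR : `|Re (H (t +i* u))| <= hp * hm.
    by rewrite (le_trans (ler_Re_normc _))// HE Normc.normcM normcJ.
  (* AM-GM *)
  have am : bump A B t ^+ 2 * hp <= (1 + chi t * hp ^+ 2) / 2.
    rewrite /chi ler_pdivlMr//; have := sqr_ge0 (bump A B t ^+ 2 * hp - 1); nra.
  apply: (le_trans (ler_pM _ _ d0 HR)) => //.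
  have -> : 20 * (B - A) ^+ 2 * bump A B t ^+ 2 * (hp * hm) =
    20 * L ^+ 2 * ((bump A B t ^+ 2 * hp) * hm) by rewrite /L; ring.
  have -> : 10 * L ^+ 2 * r * (1 + chi t * hp ^+ 2) =
    20 * L ^+ 2 * ((1 + chi t * hp ^+ 2) / 2 * r) by field.
  apply: ler_wpM2l; first by rewrite mulr_ge0// sqr_ge0.
  by apply: ler_pM => //; rewrite mulr_ge0// sqr_ge0.
rewrite rintZ; last by move=> t tI; exact: (rcontD (rcst 1 t) (ch t tI)).
rewrite rintD//; last exact: cont_cst.
rewrite rint_cst// mul1r -/L.
have -> : c / Num.sqrt (m - u) = 10 * L ^+ 2 * r * (L + S) by rewrite /c /r; ring.
apply: ler_wpM2l.
  by apply: mulr_ge0 r0; apply: mulr_ge0 => //; exact: sqr_ge0.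
by rewrite lerD2l; exact: KS.
Qed.

Let c0 : 0 <= c.
Proof.
have m0' := m0; have mY' := mY; have AB' := AB.
have S0 : 0 <= S.
  have mI : 0 < m < Y by lra.
  apply: le_trans (KS mI); apply: rint_ge0 => t _.
  by rewrite mulr_ge0 ?chi_ge0 ?sqr_ge0.
apply: mulr_ge0; last exact: sqrtr_ge0.
apply: mulr_ge0; first by apply: mulr_ge0 => //; exact: sqr_ge0.
by rewrite addr_ge0// /L subr_ge0.
Qed.

Let j_le u : 0 <= u < m -> `|j u| <= c * m / Num.sqrt (m - u).
Proof.
have m0' := m0; have mY' := mY; have AB' := AB.
move=> uI; have [|||s sI E] := @MVT_segment R j j' 0 u; first by lra.
- by move=> s; rewrite in_itv/= => sI; apply: dj; lra.
- apply: derivable_within_continuous => s; rewrite in_itv/= => sI.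
  by have [] : is_derive s (1 : R) j (j' s) by apply: dj; lra.
move: sI; rewrite in_itv/= => sI.
move: E; rewrite j0 !subr0 => ->; rewrite normrM (ger0_norm (_ : 0 <= u)); last by lra.
have sm : 0 <= s < m by lra.
rewrite mulrAC; apply: ler_pM => //; [by lra| |by lra].
apply: (le_trans (j'_le sm)); rewrite ler_wpM2l// lef_pV2 ?posrE ?sqrtr_gt0; try lra.
by rewrite ler_sqrt; lra.
Qed.

Let k_ge d : 0 < d < m -> K m - 2 * c * m * Num.sqrt m <= k d.
Proof.
have m0' := m0; have mY' := mY; have AB' := AB.
(* The derivative of the subtracted term makes up for the lower bound [- c * m / sqrt (m - u)] of
   [j], so [f] does not decrease. *)
move=> dI; pose f u := k u - (2 * c * m) * Num.sqrt (m - u).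
have Df u : 0 <= u < m -> is_derive u (1 : R) f (j u + c * m / Num.sqrt (m - u)).
  move=> uI; have mu : 0 < m - u by lra.
  have d1 : is_derive u (1 : R) k (j u) by apply: dk; lra.
  have d2 : is_derive u (1 : R) (fun s : R => m - s) (- 1).
    have -> : (fun s : R => m - s) = cst m - id by apply/funext.
    by apply: is_derive_eq; rewrite sub0r.
  have d3 := @is_derive1_comp R _ _ u _ _ (is_derive1_sqrt mu) d2.
  have d4 := is_deriveB d1 (is_deriveZ (2 * c * m) d3).
  have -> : f = k - (2 * c * m) \*: (Num.sqrt \o (fun s : R => m - s)) by apply/funext.
  move: d4; congr is_derive; rewrite /GRing.scale /=.
  by field; rewrite gt_eqF// sqrtr_gt0.
have [|||s sI E] := @MVT_segment R f (fun u => j u + c * m / Num.sqrt (m - u)) 0 d; first by lra.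
- by move=> s; rewrite in_itv/= => sI; apply: Df; lra.
- apply: derivable_within_continuous => s; rewrite in_itv/= => sI.
  by have [] : is_derive s (1 : R) f (j s + c * m / Num.sqrt (m - s)) by apply: Df; lra.
move: sI; rewrite in_itv/= => sI.
have sm : 0 <= s < m by lra.
have := j_le sm; rewrite ler_norml => /andP[js _].
have pos : 0 <= (j s + c * m / Num.sqrt (m - s)) * (d - 0).
  by rewrite mulr_ge0//; lra.
have k0 : k 0 = K m.
  apply: eq_rint => t _; congr (_ * _).
  by rewrite HE addr0 subr0 sqr_normcE !CE; ring.
have sq : 0 <= 2 * c * m * Num.sqrt (m - d).
  by apply: mulr_ge0 (sqrtr_ge0 _); apply: mulr_ge0 (ltW m0); exact: mulr_ge0 c0.
rewrite -E /f subr0 k0 in pos; lra.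
Qed.

Lemma midpoint_defect d : 0 < d < m ->
  rint A B (fun t => chi t * normc (h (t +i* (m + d)) - h (t +i* (m - d))) ^+ 2) <=
  K (m + d) + K (m - d) - 2 * K m + 4 * c * m * Num.sqrt m.
Proof.
have m0' := m0; have mY' := mY; have AB' := AB.
move=> dI; have dp : 0 < m + d < Y by lra. have dm : 0 < m - d < Y by lra.
have dm' : - m < d < m by lra.
have cc : {in `[A, B], continuous chi} by move=> t _; exact: continuous_chi.
have cK y : 0 < y < Y -> {in `[A, B], continuous (fun t => chi t * normc (h (t +i* y)) ^+ 2)}.
  by move=> yI t tI; exact: (rcontM (cc t tI) (@rcontX 2 _ _ (ccont_normc (conth (inAB tI) yI)))).
have ck : {in `[A, B], continuous (fun t => chi t * Re (H (t +i* d)))}.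
  by move=> t tI; exact: (rcontM (cc t tI) (ccontRe (contH (inAB tI) dm'))).
rewrite (eq_rint (g := fun t => (chi t * normc (h (t +i* (m + d))) ^+ 2 +
    chi t * normc (h (t +i* (m - d))) ^+ 2) - 2 * (chi t * Re (H (t +i* d))))); last first.
  by move=> t _; rewrite HE !sqr_normcE !CE; ring.
rewrite rintB; last first.
- by move=> t tI; exact: (rcontM (rcst 2 t) (ck t tI)).
- by move=> t tI; exact: (rcontD (cK _ dp t tI) (cK _ dm t tI)).
rewrite rintD; [|exact: cK|exact: cK].
rewrite (rintZ 2 ck) -/(k d); have := k_ge dI; lra.
Qed.

End Height.

End Core.
End AlmostConvexity.

(** * Boundedness and limits at 0 of almost convex functions *)

Section AlmostConvexFunctions.
Context {R : realType}.
Implicit Types (K : R -> R).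

(* The error term contains the very bound [S] sought; at a maximum point of [K]
   the condition [kap <= 1/2] absorbs it. *)
Lemma almost_convex_bound K (Y L kap V B0 : R) : 0 < Y -> continuous K ->
  (forall y, 0 <= K y) -> K 0 <= V -> (forall y, Y / 2 <= y <= Y -> K y <= B0) ->
  0 <= kap <= 2^-1 -> 0 <= L ->
  (forall S, (forall y, 0 < y < Y -> K y <= S) -> forall m d, 0 < d < m -> 2 * m < Y ->
     2 * K m <= K (m + d) + K (m - d) + kap * (L + S)) ->
  forall y, 0 <= y <= Y -> K y <= 2 * V + L + B0.
Proof.
move=> Y0 cK K0 KV KB kapI L0 H.
have [m mI Km] : exists2 m, m \in `[0, Y] & forall y, y \in `[0, Y] -> K y <= K m.
  by apply: EVT_max; [exact: ltW|exact: continuous_subspaceT].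
have V0 : 0 <= V by exact: le_trans KV.
have B00 : 0 <= B0.
  have YI : Y / 2 <= Y <= Y by lra.
  exact: le_trans (K0 Y) (KB _ YI).
move: mI; rewrite in_itv/= => mI.
suff : K m <= 2 * V + L + B0.
  by move=> Km' y yI; apply: le_trans Km'; apply: Km; rewrite in_itv.
have [mY|mY] := leP (Y / 2) m; first by have /KB ? : Y / 2 <= m <= Y; lra.
have [m0|m0] := eqVneq m 0; first by rewrite m0; lra.
have {}m0 : 0 < m by rewrite lt_neqAle eq_sym m0; lra.
apply/ler_addgt0Pl => e e0.
have e2 : 0 < e / 2 by rewrite divr_gt0.
have /cvgrPdist_lt /(_ _ e2) /nbhs_ballP[r /= r0 Hr] := cK 0.
pose y := Num.min (m / 2) (r / 2).
have y0 : 0 < y by rewrite lt_min !divr_gt0.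
have ym : y <= m / 2 by rewrite ge_min lexx.
have yr : y <= r / 2 by rewrite ge_min lexx orbT.
have Ky : K y < V + e / 2.
  have : `|K 0 - K y| < e / 2.
    by apply: Hr; rewrite /ball/= sub0r normrN gtr0_norm//; lra.
  by rewrite ltr_norml; lra.
(* The two points are [y], where [K] is below [V + e / 2], and [2 * m - y], where [K] is at most
   [K m]. Hence [K m <= V + e / 2 + (L + K m) / 2], which is solved for [K m]. *)
have dI : 0 < m - y < m by lra. have mY' : 2 * m < Y by lra.
have KS u : 0 < u < Y -> K u <= K m by move=> uI; apply: Km; rewrite in_itv/=; lra.
have := H (K m) KS m (m - y) dI mY'; rewrite subKr.
have /KS : 0 < m + (m - y) < Y by lra.
have := K0 m; have kapS : kap * (L + K m) <= 2^-1 * (L + K m).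
  by apply: ler_wpM2r; [rewrite addr_ge0|lra].
lra.
Qed.

(** The limit is the upper limit of [K] at 0, the infimum of the eventual upper bounds collected in
    [E]. Let [K m] be almost that large. For [y < m] the value at [2 * m - y] exceeds the upper
    limit only slightly, so almost convexity forces [K y] to be almost as large as well. *)
Lemma almost_convex_limit K (Y S c : R) : 0 < Y -> 0 <= c ->
  (forall y, 0 < y < Y -> 0 <= K y <= S) ->
  (forall m d, 0 < d < m -> 2 * m < Y -> 2 * K m <= K (m + d) + K (m - d) + c * m) ->
  exists l, forall e, 0 < e -> exists2 r, 0 < r & forall y, 0 < y < r -> `|K y - l| <= e.
Proof.
move=> Y0 c0 KS H.
pose E := [set s : R | exists2 r, 0 < r <= Y & forall y, 0 < y < r -> K y <= s].
have ES : E S by exists Y; [lra|move=> y /KS; lra].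
have lbE : lbound E 0.
  move=> s [r rI Hs]; have y0 : 0 < r / 2 < r by lra.
  have yY : 0 < r / 2 < Y by lra.
  by have := Hs _ y0; have := KS _ yY; lra.
have hE : has_inf E by split; [exists S|exists 0].
exists (inf E) => e e0.
have e5 : 0 < e / 5 by rewrite divr_gt0.
have [s [r1 r1I Hr1] se] := inf_adherent e5 hE.
pose r2 := Num.min (r1 / 2) (e / 5 / (c + 1)).
have c1 : 0 < c + 1 by lra.
have r20 : 0 < r2 by rewrite lt_min !divr_gt0//; lra.
have r2r : r2 <= r1 / 2 by rewrite ge_min lexx.
have r2c : r2 * (c + 1) <= e / 5 by rewrite -ler_pdivlMr// ge_min lexx orbT.
have [m mI Km] : exists2 m, 0 < m < r2 & inf E - e / 5 < K m.
  apply: contrapT => Hn; have : E (inf E - e / 5).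
    exists r2; first by lra.
    move=> y yI; rewrite leNgt; apply/negP => yK; apply: Hn; by exists y.
  by move/(ge_inf (ex_intro _ 0 lbE)); lra.
exists m; first by lra.
move=> y yI; have dI : 0 < m - y < m by lra.
have mY : 2 * m < Y by lra.
have := H m (m - y) dI mY; rewrite subKr.
have /Hr1 : 0 < m + (m - y) < r1 by lra.
have /Hr1 : 0 < y < r1 by lra.
have cm : c * m <= e / 5.
  apply: le_trans r2c; rewrite mulrC; apply: ler_pM; lra.
by rewrite ler_norml; lra.
Qed.

End AlmostConvexFunctions.

(** * The theorem in the upper half-plane *)

Section HalfPlane.
Context {R : realType}.
Local Notation C := (R[i]^o).
Local Notation normc := (@Normc.normc R).
Local Notation Re := (@complex.Re R).
Local Notation Im := (@complex.Im R).
Implicit Types (t u y w m d S : R) (z : C).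

Lemma rint_translates (A w : R) (n : nat) (f : R -> R) : 0 <= w -> continuous f ->
  rint A (A + n%:R * w) f = rint 0 w (fun s => \sum_(k < n) f (s + (A + k%:R * w))).
Proof.
move=> w0 cf; have cin (u v : R) (g : R -> R) : continuous g -> {in `[u, v], continuous g}.
  by move=> cg t _; exact: cg.
have csh (u : R) : continuous (fun s => f (s + u)).
  move=> s; exact: (rcont_comp (rcontD (idr s) (rcst u s)) (cf (s + u))).
have csum k : continuous (fun s => \sum_(j < k) f (s + (A + j%:R * w))).
  elim: k => [|k IH] s.
    under eq_fun do rewrite big_ord0; exact: rcst.
  under eq_fun do rewrite big_ord_recr /=; exact: (rcontD (IH s) (csh _ s)).
elim: n => [|n IH].
  rewrite mul0r addr0 rint_itv1 (eq_rint (g := fun=> 0)) ?rint_cst ?mul0r//.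
  by move=> s _; rewrite big_ord0.
have nw : A + n.+1%:R * w = A + n%:R * w + w by rewrite -natr1 mulrDl mul1r addrA.
rewrite nw (@rint_cat _ (A + n%:R * w)); last exact: cin.
- rewrite IH; under [in RHS]eq_rint do rewrite big_ord_recr /=.
  rewrite rintD; [|exact: cin (csum n)|exact: cin (csh _)].
  congr (_ + _); rewrite (rint_shift w0 (cin _ _ _ cf)).
  by rewrite add0r (addrC w).
- by rewrite lerDl mulr_ge0.
- by rewrite lerDl.
Qed.

Lemma le_rint_sub (A a b B : R) (f : R -> R) : A <= a -> a <= b -> b <= B ->
  {in `[A, B], continuous f} -> (forall t, A <= t <= B -> 0 <= f t) ->
  rint a b f <= rint A B f.
Proof.
move=> Aa ab bB cf f0.
have sub (u v : R) : A <= u -> v <= B -> {in `[u, v], continuous f}.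
  by move=> Au vB t; rewrite in_itv/= => tI; apply: cf; rewrite in_itv/=; lra.
have aB := le_trans ab bB.
rewrite (@rint_cat _ a A B)// (@rint_cat _ b a B)//; last exact: sub.
have p1 : 0 <= rint A a f.
  by apply: rint_ge0 => t; rewrite in_itv/= => tI; apply: f0; lra.
have p2 : 0 <= rint b B f.
  by apply: rint_ge0 => t; rewrite in_itv/= => tI; apply: f0; lra.
lra.
Qed.

Variables (Psi dPsi : C -> C) (A B w0 M V : R).
Hypotheses (AB : A < B) (w0_gt0 : 0 < w0) (Psi_cont : continuous Psi).
Hypothesis dPsiP : forall z, 0 < Im z -> cder Psi z (dPsi z).
Hypothesis PsiM : forall z, normc (Psi z) <= M.
Hypothesis Psi_inj : forall z w, 0 < w < w0 -> Psi (z + w%:C) != Psi z.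
Hypothesis Psi_var : forall (n : nat) t w, 0 < w < w0 -> A <= t ->
  t + n%:R * w <= B + w0 ->
  \sum_(k < n) normc (Psi (t + k.+1%:R * w)%:C - Psi (t + k%:R * w)%:C) <= V.

Local Notation chi := (chi A B).
Let L := B - A.
(** The estimate [4 * M / y] of Cauchy is spent twice, on the real and on the imaginary part of a
    quotient. *)
Let N := 8 * M.

Let M0 : 0 <= M. Proof. exact: le_trans (normc_ge0 (Psi 0)) (PsiM 0). Qed.
Let N0 : 0 <= N. Proof. exact: mulr_ge0 M0. Qed.
Let L0 : 0 < L. Proof. by rewrite subr_gt0. Qed.

Let inAB t : t \in `[A, B] -> A <= t <= B. Proof. by rewrite in_itv. Qed.

Let upper z z' : normc (z' - z) < Im z -> 0 < Im z'.
Proof.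
move=> H; have := le_lt_trans (ler_Im_normc (z' - z)) H.
by rewrite cImD cImN ltr_norml; lra.
Qed.

Lemma dPsi_continuous z : 0 < Im z -> {for z, continuous dPsi}.
Proof.
by move=> z0; apply: (cder_continuous z0) => z' /upper; exact: dPsiP.
Qed.

Lemma dPsi_le z : 0 < Im z -> normc (dPsi z) <= 4 * M / Im z.
Proof.
move=> z0; apply: (cauchy_bound z0 _ (dPsiP z0)) => z' //.
by move=> /upper/dPsiP; exists (dPsi z').
Qed.

(* By injectivity of the boundary map these quotients never vanish, so unlike
   [dPsi] they have a square root and boundary values. *)
Definition quot w z : C := w^-1%:C * (Psi (z + w%:C) - Psi z).

Lemma quot_continuous w : continuous (quot w).
Proof.
move=> z; have c1 := ccontD (cidc z) (ccst w%:C z).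
exact: (ccontM (ccst _ z) (ccontB (ccont_comp c1 (@Psi_cont _)) (@Psi_cont z))).
Qed.

Lemma quot_neq0 w z : 0 < w < w0 -> quot w z != 0.
Proof.
move=> wI; rewrite mulf_neq0 ?subr_eq0 ?Psi_inj// -normc_gt0 normcR normr_gt0 invr_eq0.
by case/andP: wI => /gt_eqF ->.
Qed.

(** The mean value theorem is applied to each part separately, hence two intermediate points. Being
    close to [t], they serve both the bound and the limit [w -> 0]. *)
Lemma quot_mvt w t y : 0 < w -> 0 < y -> exists x1 x2 : R,
  [/\ t <= x1 <= t + w, t <= x2 <= t + w &
      quot w (t +i* y) = Re (dPsi (x1 +i* y)) +i* Im (dPsi (x2 +i* y))].
Proof.
move=> w0' y0; have tw : t < t + w by rewrite ltrDl.
have E : (t +i* y : C) + w%:C = (t + w) +i* y by apply: complex_eqP; rewrite !CE/= ?addr0.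
have d (x : R) : cder Psi (x +i* y) (dPsi (x +i* y)) by exact: dPsiP.
have [|x1 x1I E1] := @MVT_segment R (fun s : R => Re (Psi (s +i* y)))
    (fun s => Re (dPsi (s +i* y))) t (t + w) (ltW tw) (fun x _ => cder_Re_t (d x)).
  by apply: derivable_within_continuous => s _; have [] := cder_Re_t (d s).
have [|x2 x2I E2] := @MVT_segment R (fun s : R => Im (Psi (s +i* y)))
    (fun s => Im (dPsi (s +i* y))) t (t + w) (ltW tw) (fun x _ => cder_Im_t (d x)).
  by apply: derivable_within_continuous => s _; have [] := cder_Im_t (d s).
exists x1, x2; split; [by rewrite in_itv in x1I|by rewrite in_itv in x2I|].
rewrite /quot E; apply: complex_eqP; rewrite ?cReZ ?cImZ !CE/=.
  by rewrite E1 (addrC t) addrK mulrC mulfK ?gt_eqF.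
by rewrite E2 (addrC t) addrK mulrC mulfK ?gt_eqF.
Qed.

Lemma quot_le w t y : 0 < w -> 0 < y -> normc (quot w (t +i* y)) <= N / y.
Proof.
move=> w0' y0; have [x1 [x2 [_ _ ->]]] := quot_mvt t w0' y0.
rewrite (le_trans (normc_le_ReIm _))//=.
have h1 := @dPsi_le (x1 +i* y) y0; have h2 := @dPsi_le (x2 +i* y) y0.
have -> : N / y = 4 * M / y + 4 * M / y by rewrite /N; ring.
by apply: lerD; [apply: le_trans h1; exact: ler_Re_normc|apply: le_trans h2; exact: ler_Im_normc].
Qed.

Local Notation K w y := (rint A B (fun t => chi t * normc (quot w (t +i* y)))).

Let cK w y : continuous (fun t => chi t * normc (quot w (t +i* y))).
Proof.
move=> t; have cq := ccont_comp (@continuous_reline R y t) (@quot_continuous w _).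
exact: (rcontM (@continuous_chi R A B t) (ccont_normc cq)).
Qed.

Lemma K_continuous w : continuous (fun y => K w y).
Proof.
move=> y; apply: (@param_continuous R R (fun y t => chi t * normc (quot w (t +i* y)))).
- exact: ltW.
- by near=> y'; move=> t _; exact: cK.
- move=> t _.
  have p1 : {for (y, t), continuous (fun p : R * R => p.1)} by exact: cvg_fst.
  have p2 : {for (y, t), continuous (fun p : R * R => p.2)} by exact: cvg_snd.
  have cq := ccont_comp (ccontMk p2 p1) (@quot_continuous w _).
  exact: (rcontM (rcont_comp p2 (@continuous_chi R A B _)) (ccont_normc cq)).
Unshelve. all: by end_near. Qed.

Lemma K_ge0 w y : 0 <= K w y.
Proof. by apply: rint_ge0 => t _; rewrite mulr_ge0 ?chi_ge0 ?normc_ge0. Qed.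

(* The steps are (B - A)/(n+1), so that [A, B] splits into translates of one
   period and the polygon sums of the boundary curve appear. *)
Let step (n : nat) : R := L / n.+1%:R.

Let step_gt0 n : 0 < step n. Proof. exact: divr_gt0. Qed.

(** The weight is at most [L ^+ 8]. For every shift [s] the quotients at the translates of [s] sum
    to at most [V / w], and [s] runs over an interval of length [w]. *)
Lemma K_at0 n : step n < w0 -> K (step n) 0 <= L ^+ 8 * V.
Proof.
move=> sw; set w := step n.
have wI : 0 < w < w0 by rewrite step_gt0.
have cq : continuous (fun t => normc (quot w t%:C)).
  by move=> t; exact: (ccont_normc (ccont_comp (ccontR (idr t)) (@quot_continuous w _))).
have cin (f : R -> R) u v : continuous f -> {in `[u, v], continuous f}.
  by move=> cf t _; exact: cf.
apply: (@le_trans _ _ (L ^+ 8 * rint A B (fun t => normc (quot w t%:C)))).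
  rewrite -rintZ; last exact: cin.
  apply: le_rint; [by apply: cin; exact: cK| |].
    by apply: cin => t; exact: (rcontM (rcst _ t) (cq t)).
  by move=> t /inAB tI; rewrite ler_wpM2r ?normc_ge0// chi_le.
apply: ler_wpM2l; first by rewrite exprn_ge0// ltW.
have BE : B = A + n.+1%:R * w by rewrite /w /step /L mulrC divfK ?pnatr_eq0// addrC subrK.
rewrite {1}BE rint_translates ?(ltW (step_gt0 n))//.
have Vw : forall s, s \in `[0, w] ->
    \sum_(k < n.+1) normc (quot w (s + (A + k%:R * w))%:C) <= V / w.
  move=> s; rewrite in_itv/= => sI.
  have h1 : A <= A + s by lra.
  (* The shifted partition overshoots [B] by [s <= w < w0], within the margin of [Psi_var]. *)
  have h2 : A + s + n.+1%:R * w <= B + w0 by rewrite addrAC -BE; lra.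
  have H := Psi_var wI h1 h2; rewrite ler_pdivlMr ?step_gt0// mulr_suml; apply: le_trans H.
  apply: ler_sum => k _; rewrite /quot Normc.normcM normcR ger0_norm ?invr_ge0 ?(ltW (step_gt0 n))//.
  rewrite mulrAC mulVf ?gt_eqF ?step_gt0// mul1r.
  have -> : (s + (A + k%:R * w))%:C + w%:C = (A + s + k.+1%:R * w)%:C :> C.
    by rewrite -rmorphD/= -natr1; congr (_%:C); ring.
  by have -> : s + (A + k%:R * w) = A + s + k%:R * w by ring.
have -> : V = V / w * (w - 0) by rewrite subr0 divfK// gt_eqF// step_gt0.
apply: le_trans (ler_norm _) _.
apply: rint_bound; first exact: ltW (step_gt0 n).
  move=> s _; move: (n.+1) => k; elim: k => [|k IH].
    under eq_fun do rewrite big_ord0; exact: rcst.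
  under eq_fun do rewrite big_ord_recr /=.
  exact: (rcontD IH (rcont_comp (rcontD (idr s) (rcst _ s)) (cq _))).
move=> s sI; rewrite ger0_norm ?Vw//.
by apply: sumr_ge0 => k _; exact: normc_ge0.
Qed.

Lemma quot_sqrt w : 0 < w < w0 -> exists h dh : C -> C,
  forall t y, A <= t <= B -> 0 < y < 1 ->
  [/\ h (t +i* y) ^+ 2 = quot w (t +i* y), cder h (t +i* y) (dh (t +i* y)) &
      {for (t +i* y : C), continuous dh}].
Proof.
(* The summand 2 puts the strip over [[A, B]] up to height 1 into the interior of the square, so
   [h ^+ 2 = quot w] holds in a neighbourhood of each of its points. *)
move=> wI; pose r := `|A| + `|B| + 2.
have [h Hh] := continuous_sqrt r (@quot_continuous w) (fun z => quot_neq0 z wI).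
pose dq z := w^-1%:C * (dPsi (z + w%:C) - dPsi z).
have Imw z : Im (z + w%:C) = Im z by rewrite cImD /= addr0.
have qD z : 0 < Im z -> cder (quot w) z (dq z).
  move=> z0; apply: (@cderZ _ w^-1%:C (fun z => Psi (z + w%:C) - Psi z) z (dPsi (z + w%:C) - dPsi z)).
  apply: cderB; last exact: dPsiP.
  by apply: cder_shift; apply: dPsiP; rewrite Imw.
exists h, (fun z => dq z / (h z *+ 2)) => t y tI yI.
have tr : `|t| < r /\ `|y| < r.
  have := ler_norm A; have := ler_norm B; have := ler_norm (- A); have := ler_norm (- B).
  rewrite !normrN /r !ltr_norml; lra.
have [tr1 tr2] := tr.
have [h2 ch] := Hh (t +i* y) (ltW tr1) (ltW tr2).
have y0 : 0 < Im (t +i* y) by case/andP: yI.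
have near2 : \forall z \near (t +i* y : C), h z ^+ 2 = quot w z.
  have c1 := ccontRe (cidc (t +i* y : C)); have c2 := ccontIm (cidc (t +i* y : C)).
  near=> z; have [] // := Hh z.
    have : `|Re z| < r; last exact: ltW.
    by near: z; exact: (cvgr_norm_lt _ c1).
  have : `|Im z| < r; last exact: ltW.
  by near: z; exact: (cvgr_norm_lt _ c2).
split; first exact: h2.
- by apply: (@cder_sqrt _ h (quot w) _ _ (quot_neq0 _ wI) near2 ch); exact: qD.
- have hz0 : h (t +i* y) *+ 2 != 0.
    rewrite mulrn_eq0/=; apply: contraNneq (quot_neq0 (t +i* y) wI) => hz.
    by rewrite -h2 hz expr0n.
  have c1 := ccontD (cidc (t +i* y : C)) (ccst w%:C _).
  have cd : {for (t +i* y : C) + w%:C, continuous dPsi}.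
    by apply: dPsi_continuous; rewrite Imw.
  have ch2 : {for (t +i* y : C), continuous (fun z => h z *+ 2)}.
    have -> : (fun z => h z *+ 2) = (fun z => h z + h z) by apply/funext => z; rewrite mulr2n.
    exact: (ccontD ch ch).
  exact: (ccontM (ccontM (ccst _ _) (ccontB (ccont_comp c1 cd) (dPsi_continuous y0)))
    (ccontV ch2 hz0)).
Unshelve. all: by end_near. Qed.

(** Four times the constant of [midpoint_defect]; its factor [Num.sqrt m] is at most 1 in the
    strip. *)
Let cdef S := 40 * L ^+ 2 * (L + S) * Num.sqrt N.

(** For the second estimate, [|x^2 - y^2| = |x - y| |x + y|] for the roots [x], [y]. Weighting the
    two factors by [lam] leaves the squared distance, controlled by the defect, and
    [|x + y|^2 / lam], controlled by the means through the parallelogram law. *)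
Lemma quot_defect w S Y m d lam : 0 < w < w0 -> Y <= 1 ->
  (forall y, 0 < y < Y -> K w y <= S) -> 0 < d < m -> 2 * m < Y -> 0 < lam ->
  2 * K w m <= K w (m + d) + K w (m - d) + cdef S * m /\
  rint A B (fun t => chi t * normc (quot w (t +i* (m + d)) - quot w (t +i* (m - d)))) <=
    lam / 2 * (K w (m + d) + K w (m - d) - 2 * K w m + cdef S * m) + 2 * S / lam.
Proof.
move=> wI Y1 KS dI mY lam0; have [h [dh H]] := quot_sqrt wI.
have Y01 y : 0 < y < Y -> 0 < y < 1 by lra.
have hq t y : A <= t <= B -> 0 < y < Y ->
    normc (h (t +i* y)) ^+ 2 = normc (quot w (t +i* y)).
  by move=> tI /Y01 yI; have [h2 _ _] := H t y tI yI; rewrite -normcX h2.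
have KE y : 0 < y < Y ->
    rint A B (fun t => chi t * normc (h (t +i* y)) ^+ 2) = K w y.
  by move=> yI; apply: eq_rint => t /inAB tI; rewrite hq.
have h1 t y : A <= t <= B -> 0 < y < Y ->
    cder h (t +i* y) (dh (t +i* y)) /\ {for (t +i* y : C), continuous dh}.
  by move=> tI /Y01 yI; have [_ ? ?] := H t y tI yI.
have h3 t y : A <= t <= B -> 0 < y < Y -> normc (h (t +i* y)) ^+ 2 <= N / y.
  by move=> tI yI; rewrite hq//; apply: quot_le; [case/andP: wI|case/andP: yI].
have h4 y : 0 < y < Y -> rint A B (fun t => chi t * normc (h (t +i* y)) ^+ 2) <= S.
  by move=> yI; rewrite KE//; exact: KS.
have m0 : 0 < m by lra.
have := @midpoint_defect R A B Y N S h dh (ltW AB) N0 h1 h3 h4 m m0 mY d dI.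
have pI : 0 < m + d < Y by lra. have qI : 0 < m - d < Y by lra. have mI : 0 < m < Y by lra.
rewrite !KE//.
set D := rint A B _ => Ddef.
have ch t y : A <= t <= B -> 0 < y < Y -> {for t, continuous (fun t => h (t +i* y))}.
  move=> tI yI; have [/cder_cont ch _] := h1 t y tI yI.
  exact: (ccont_comp (@continuous_reline R y t) ch).
have cD : {in `[A, B], continuous
    (fun t => chi t * normc (h (t +i* (m + d)) - h (t +i* (m - d))) ^+ 2)}.
  move=> t /inAB tI.
  exact: (rcontM (@continuous_chi R A B t) (@rcontX _ 2 _ _ (ccont_normc (ccontB (ch t _ tI pI) (ch t _ tI qI))))).
have S0 : 0 <= S by apply: le_trans (KS m mI); exact: K_ge0.
have D0 : 0 <= D by apply: rint_ge0 => t _; rewrite mulr_ge0 ?chi_ge0 ?sqr_ge0.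
have cS : 4 * (10 * L ^+ 2 * (L + S) * Num.sqrt N) * m * Num.sqrt m <= cdef S * m.
  have -> : 4 * (10 * L ^+ 2 * (L + S) * Num.sqrt N) * m * Num.sqrt m =
    cdef S * m * Num.sqrt m by rewrite /cdef; ring.
  rewrite -[leRHS]mulr1; apply: ler_wpM2l.
    apply: mulr_ge0; last exact: ltW.
    apply: mulr_ge0; last exact: sqrtr_ge0.
    apply: mulr_ge0; first by apply: mulr_ge0 => //; exact: sqr_ge0.
    by apply: addr_ge0 => //; exact: ltW.
  by rewrite -[leRHS]sqrtr1 ler_sqrt//; lra.
have {Ddef cS} Ddef : D <= K w (m + d) + K w (m - d) - 2 * K w m + cdef S * m.
  by apply: le_trans Ddef _; rewrite lerD2l.
split; first by lra.
have cKI y : {in `[A, B], continuous (fun t => chi t * normc (quot w (t +i* y)))}.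
  by move=> t _; exact: cK.
apply: (@le_trans _ _ (lam / 2 * D + lam^-1 * (K w (m + d) + K w (m - d)))); last first.
  apply: lerD; first by rewrite ler_wpM2l// divr_ge0// ltW.
  have -> : 2 * S / lam = lam^-1 * (S + S) by ring.
  rewrite ler_wpM2l ?invr_ge0 ?(ltW lam0)//; apply: lerD; exact: KS.
rewrite /D -rintD// -!rintZ//; last first.
  by move=> t tI; exact: (rcontD (cKI _ t tI) (cKI _ t tI)).
rewrite -rintD; last first.
- by move=> t tI; exact: (rcontM (rcst _ t) (rcontD (cKI _ t tI) (cKI _ t tI))).
- by move=> t tI; exact: (rcontM (rcst _ t) (cD t tI)).
apply: le_rint.
- move=> t tI; have cq y := ccont_comp (@continuous_reline R y t) (@quot_continuous w _).
  exact: (rcontM (@continuous_chi R A B t) (ccont_normc (ccontB (cq _) (cq _)))).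
- move=> t tI; exact: (rcontD (rcontM (rcst _ t) (cD t tI))
    (rcontM (rcst _ t) (rcontD (cKI _ t tI) (cKI _ t tI)))).
move=> t /inAB tI.
have [hp _ _] := H t _ tI (Y01 _ pI); have [hm _ _] := H t _ tI (Y01 _ qI).
rewrite -hp -hm !normcX; set x := h (t +i* (m + d)); set y := h (t +i* (m - d)).
have -> : x ^+ 2 - y ^+ 2 = (x - y) * (x + y) by ring.
rewrite Normc.normcM.
have par : normc (x - y) ^+ 2 + normc (x + y) ^+ 2 = 2 * (normc x ^+ 2 + normc y ^+ 2).
  by rewrite !sqr_normcE !CE; ring.
set p := normc (x - y) in par *; set q := normc (x + y) in par *.
have -> : lam / 2 * (chi t * p ^+ 2) +
    lam^-1 * (chi t * normc x ^+ 2 + chi t * normc y ^+ 2) =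
  chi t * (lam / 2 * p ^+ 2 + (lam * 2)^-1 * (p ^+ 2 + q ^+ 2)).
  by rewrite par; field; rewrite gt_eqF.
rewrite ler_wpM2l ?chi_ge0//.
have -> : lam / 2 * p ^+ 2 + (lam * 2)^-1 * (p ^+ 2 + q ^+ 2) =
  p * q + (lam * 2)^-1 * ((lam * p - q) ^+ 2 + p ^+ 2) by field; rewrite gt_eqF.
by rewrite lerDl mulr_ge0 ?addr_ge0 ?sqr_ge0// invr_ge0 mulr_ge0// ltW.
Qed.

(** The height that makes [kap <= 1/2], as [almost_convex_bound] requires; the summand 1 ensures
    that [Y] is positive and at most 1. *)
Let Y := (80 * L ^+ 2 * Num.sqrt N + 1)^-1.
Let kap := 40 * L ^+ 2 * Num.sqrt N * Y.

Let LN0 : 0 <= L ^+ 2 * Num.sqrt N.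
Proof. by apply: mulr_ge0; [exact: sqr_ge0|exact: sqrtr_ge0]. Qed.

Let Y0 : 0 < Y. Proof. by rewrite invr_gt0; have := LN0; lra. Qed.

Let Y1 : Y <= 1.
Proof. by rewrite invf_le1; have := LN0; lra. Qed.

Let kapI : 0 <= kap <= 2^-1.
Proof.
have E : kap = 40 * (L ^+ 2 * Num.sqrt N) / (80 * (L ^+ 2 * Num.sqrt N) + 1).
  by rewrite /kap /Y -!mulrA.
have := LN0; rewrite E; set u := L ^+ 2 * _ => u0.
apply/andP; split; first by rewrite divr_ge0//; lra.
by rewrite ler_pdivrMr; lra.
Qed.

(** The bound of [almost_convex_bound]: [L ^+ 8 * V] is the bound at height 0, and the last term
    bounds the mean at heights above [Y / 2] from [|quot| <= 2 * N / Y]. *)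
Let Sb := 2 * (L ^+ 8 * V) + L + L ^+ 9 * (2 * N / Y).

(** Below height [Y] the error [cdef S * m] is at most [kap * (L + S)], which is the form that can
    be absorbed. As [Sb] is the same for all [n], the bound survives the limit. *)
Lemma K_bound n : step n < w0 -> forall y, 0 <= y <= Y -> K (step n) y <= Sb.
Proof.
move=> sw; have wI : 0 < step n < w0 by rewrite step_gt0.
apply: (@almost_convex_bound R (fun y => K (step n) y) Y L kap) => //.
- exact: K_continuous.
- exact: K_ge0.
- exact: K_at0.
- move=> y /andP[yY _]; have y0 : 0 < y by apply: lt_le_trans yY; rewrite divr_gt0.
  apply: le_trans (ler_norm _) _.
  have -> : L ^+ 9 * (2 * N / Y) = L ^+ 8 * (2 * N / Y) * (B - A) by rewrite -/L; ring.
  apply: rint_bound; [exact: ltW|by move=> t _; exact: cK|].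
  move=> t /inAB tI; rewrite (ger0_norm (mulr_ge0 (chi_ge0 _ _ _) (normc_ge0 _))).
  apply: ler_pM; [exact: chi_ge0|exact: normc_ge0|exact: chi_le|].
  apply: le_trans (quot_le _ (step_gt0 n) y0) _.
  have -> : 2 * N / Y = N / (Y / 2) by field; rewrite gt_eqF.
  by rewrite ler_wpM2l// lef_pV2// ?posrE ?divr_gt0.
- exact: (ltW L0).
- move=> S KS m d dI mY; have [H _] := quot_defect wI Y1 KS dI mY ltr01.
  apply: le_trans H _; rewrite lerD2l.
  have mI : 0 < m < Y by lra.
  have S0 : 0 <= S by apply: le_trans (KS m mI); exact: K_ge0.
  have -> : cdef S * m = (40 * L ^+ 2 * Num.sqrt N * (L + S)) * m by rewrite /cdef; ring.
  have -> : kap * (L + S) = (40 * L ^+ 2 * Num.sqrt N * (L + S)) * Y by rewrite /kap; ring.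
  apply: ler_wpM2l; last by lra.
  by rewrite -(mulrA 40); apply: mulr_ge0; [exact: mulr_ge0|apply: addr_ge0 => //; exact: ltW].
Qed.

(* [`|w|] only serves to make [ext] continuous at [w = 0] from both sides. *)
Let ext w z : C := if w == 0 then dPsi z else quot `|w| z.

(** By [quot_mvt] the parts of a quotient are values of the parts of [dPsi] within [|w|] of the base
    point, so continuity of [dPsi] is enough. Shares of [r / 2] for [w] and for the base point keep
    these points within [r] of [t]. *)
Lemma ext_continuous (y t : R) : 0 < y ->
  {for (0 : R, t), continuous (fun p : R * R => ext p.1 (p.2 +i* y))}.
Proof.
move=> y0; rewrite /prop_for /continuous_at /= {2}/ext eqxx; apply/cvgcP => e e0.
have e2 : 0 < e / 2 by rewrite divr_gt0.
have z0 : 0 < Im (t +i* y) by [].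
have /cvgcP /(_ _ e2) /nbhscP [r r0 Hr] := dPsi_continuous z0.
have r2 : 0 < r / 2 by rewrite divr_gt0.
have close (s : R) : `|s - t| < r -> normc (dPsi (s +i* y) - dPsi (t +i* y)) < e / 2.
  move=> sr; apply: Hr; rewrite (le_lt_trans (normc_le_ReIm _))//= subrr normr0 addr0//.
exists ([set u : R | `|u - 0| < r / 2], [set v : R | `|v - t| < r / 2]).
  by split; exact: near_dist.
move=> [w s] /= []; rewrite subr0 => wr sr; rewrite /ext; case: eqVneq => [_|w1].
  by apply: lt_trans (close s _) _; lra.
have wp : 0 < `|w| by rewrite normr_gt0.
have [x1 [x2 [x1I x2I ->]]] := quot_mvt s wp y0.
have c1 : `|x1 - t| < r by move: sr; rewrite !ltr_norml; lra.
have c2 : `|x2 - t| < r by move: sr; rewrite !ltr_norml; lra.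
rewrite (le_lt_trans (normc_le_ReIm _))// (splitr e) ltrD// !CE/=.
  by apply: le_lt_trans (close _ c1); rewrite -cReN -cReD ler_Re_normc.
by apply: le_lt_trans (close _ c2); rewrite -cImN -cImD ler_Im_normc.
Qed.

Lemma ext_slice_continuous w y t : 0 < y -> {for t, continuous (fun t => ext w (t +i* y))}.
Proof.
move=> y0; rewrite /ext; case: eqP => _.
  exact: (ccont_comp (@continuous_reline R y t) (@dPsi_continuous (t +i* y) y0)).
exact: (ccont_comp (@continuous_reline R y t) (@quot_continuous _ (t +i* y))).
Qed.

Let stepE n z : ext (step n) z = quot (step n) z.
Proof. by rewrite /ext gt_eqF ?step_gt0// gtr0_norm. Qed.

Let step_cvg : step n @[n --> \oo] --> 0.
Proof. by rewrite -(mulr0 L); apply: cvgM; [exact: cvg_cst|exact: cvg_harmonic]. Qed.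

Local Notation K0 y := (rint A B (fun t => chi t * normc (dPsi (t +i* y)))).

Lemma K_cvg y : 0 < y -> K (step n) y @[n --> \oo] --> K0 y.
Proof.
move=> y0; have -> : (fun n => K (step n) y) =
    (fun w => rint A B (fun t => chi t * normc (ext w (t +i* y)))) \o step.
  by apply/funext => n /=; apply: eq_rint => t _; rewrite stepE.
apply: (cvg_comp _ _ step_cvg).
have -> : K0 y = rint A B (fun t => chi t * normc (ext 0 (t +i* y))).
  by apply: eq_rint => t _; rewrite /ext eqxx.
apply: (@param_continuous R R (fun w t => chi t * normc (ext w (t +i* y)))).
- exact: ltW.
- near=> w; move=> t _.
  exact: (rcontM (@continuous_chi R A B t) (ccont_normc (@ext_slice_continuous w y t y0))).
- move=> t _; have p2 : {for (0 : R, t), continuous (fun p : R * R => p.2)} by exact: cvg_snd.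
  exact: (rcontM (rcont_comp p2 (@continuous_chi R A B _)) (ccont_normc (@ext_continuous y t y0))).
Unshelve. all: by end_near. Qed.

Lemma K_diff_cvg y1 y2 : 0 < y1 -> 0 < y2 ->
  rint A B (fun t => chi t * normc (quot (step n) (t +i* y1) - quot (step n) (t +i* y2)))
    @[n --> \oo] -->
  rint A B (fun t => chi t * normc (dPsi (t +i* y1) - dPsi (t +i* y2))).
Proof.
move=> y10 y20.
pose F w t := chi t * normc (ext w (t +i* y1) - ext w (t +i* y2)).
have -> : (fun n => rint A B (fun t => chi t *
    normc (quot (step n) (t +i* y1) - quot (step n) (t +i* y2)))) =
    (fun w => rint A B (F w)) \o step.
  by apply/funext => n /=; apply: eq_rint => t _; rewrite /F !stepE.
apply: (cvg_comp _ _ step_cvg).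
have -> : rint A B (fun t => chi t * normc (dPsi (t +i* y1) - dPsi (t +i* y2))) =
  rint A B (F 0) by apply: eq_rint => t _; rewrite /F /ext eqxx.
apply: (@param_continuous R R F).
- exact: ltW.
- near=> w; move=> t _.
  exact: (rcontM (@continuous_chi R A B t) (ccont_normc (ccontB
    (@ext_slice_continuous w y1 t y10) (@ext_slice_continuous w y2 t y20)))).
- move=> t _; have p2 : {for (0 : R, t), continuous (fun p : R * R => p.2)} by exact: cvg_snd.
  exact: (rcontM (rcont_comp p2 (@continuous_chi R A B _)) (ccont_normc (ccontB
    (@ext_continuous y1 t y10) (@ext_continuous y2 t y20)))).
Unshelve. all: by end_near. Qed.

Let step_small : \forall n \near \oo, step n < w0.
Proof. by apply: (cvgr_lt 0 step_cvg). Qed.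

Lemma K0_bound y : 0 < y < Y -> 0 <= K0 y <= Sb.
Proof.
move=> yI; have y0 : 0 < y by lra. have yI' : 0 <= y <= Y by lra.
apply/andP; split; first by apply: rint_ge0 => t _; rewrite mulr_ge0 ?chi_ge0 ?normc_ge0.
apply: (ler_cvg_to (K_cvg y0) (cvg_cst Sb)).
by apply: filterS step_small => n /K_bound; apply.
Qed.

Lemma K0_defect m d lam : 0 < d < m -> 2 * m < Y -> 0 < lam ->
  2 * K0 m <= K0 (m + d) + K0 (m - d) + cdef Sb * m /\
  rint A B (fun t => chi t * normc (dPsi (t +i* (m + d)) - dPsi (t +i* (m - d)))) <=
    lam / 2 * (K0 (m + d) + K0 (m - d) - 2 * K0 m + cdef Sb * m) + 2 * Sb / lam.
Proof.
move=> dI mY lam0.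
have m0 : 0 < m by lra. have p0 : 0 < m + d by lra. have q0 : 0 < m - d by lra.
have H : \forall n \near \oo, 0 < step n < w0 /\ forall y, 0 < y < Y -> K (step n) y <= Sb.
  apply: filterS step_small => n sw; split; first by rewrite step_gt0.
  by move=> y yI; apply: K_bound => //; lra.
have cm := K_cvg m0; have cp := K_cvg p0; have cq := K_cvg q0.
have cc (x : R) : x @[_ --> \oo] --> x by exact: cvg_cst.
have c2 : 2 * K (step n) m @[n --> \oo] --> 2 * K0 m by apply: cvgM; [exact: cc|exact: cm].
have cs : K (step n) (m + d) + K (step n) (m - d) @[n --> \oo] --> K0 (m + d) + K0 (m - d).
  by apply: cvgD; [exact: cp|exact: cq].
split.
  have cs' : K (step n) (m + d) + K (step n) (m - d) + cdef Sb * m @[n --> \oo] -->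
      K0 (m + d) + K0 (m - d) + cdef Sb * m by apply: cvgD; [exact: cs|exact: cc].
  apply: (ler_cvg_to c2 cs'); apply: filterS H => n [wI KS].
  by have [] := quot_defect wI Y1 KS dI mY lam0.
have cr : lam / 2 * (K (step n) (m + d) + K (step n) (m - d) - 2 * K (step n) m + cdef Sb * m) +
    2 * Sb / lam @[n --> \oo] -->
    lam / 2 * (K0 (m + d) + K0 (m - d) - 2 * K0 m + cdef Sb * m) + 2 * Sb / lam.
  apply: cvgD; last exact: cc.
  apply: cvgM; first exact: cc.
  by apply: cvgD; last exact: cc; apply: cvgB; [exact: cs|exact: c2].
apply: (ler_cvg_to (K_diff_cvg p0 q0) cr); apply: filterS H => n [wI KS].
by have [] := quot_defect wI Y1 KS dI mY lam0.
Qed.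

Let Sb0 : 0 <= Sb.
Proof.
have yI : 0 < Y / 2 < Y by rewrite divr_gt0//= ltr_pdivrMr// ltr_pMr// ltr1n.
by have /andP[] := K0_bound yI; exact: le_trans.
Qed.

Let cdef0 : 0 <= cdef Sb.
Proof.
rewrite /cdef; apply: mulr_ge0; last exact: sqrtr_ge0.
apply: mulr_ge0; first by apply: mulr_ge0 => //; exact: sqr_ge0.
by apply: addr_ge0 => //; exact: ltW.
Qed.

(** Two heights are [m + d] and [m - d] for their midpoint [m]. Since [K0] has a limit at 0, its
    second difference there becomes small, after [lam] has been fixed to make [2 * Sb / lam]
    small. *)
Lemma weighted_cauchy e : 0 < e -> exists2 r, 0 < r &
  forall y1 y2, 0 < y1 < r -> 0 < y2 < r ->
  rint A B (fun t => chi t * normc (dPsi (t +i* y1) - dPsi (t +i* y2))) <= e.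
Proof.
move=> e0.
have [|l Hl] := @almost_convex_limit R (fun y => K0 y) Y Sb (cdef Sb) Y0 cdef0 K0_bound.
  by move=> m d dI mY; have [] := K0_defect dI mY ltr01.
pose lam := 4 * (Sb + 1) / e.
have Sb1 : 0 < Sb + 1 by have := Sb0; lra.
have lam0 : 0 < lam by rewrite divr_gt0// mulr_gt0.
have lamS : 2 * Sb / lam <= e / 2.
  have -> : 2 * Sb / lam = e / 2 * (Sb / (Sb + 1)) by rewrite /lam; field; rewrite !gt_eqF.
  rewrite -[leRHS]mulr1 ler_wpM2l ?divr_ge0 ?(ltW e0)//.
  by rewrite ler_pdivrMr// mul1r lerDl.
(* The second difference costs four times [e / (8 * lam)], the error [cdef Sb * m] another
   [e / (2 * lam)]; times [lam / 2] this makes [e / 2]. *)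
have [r1 r10 H1] := Hl (e / (8 * lam)) (divr_gt0 e0 (mulr_gt0 (ltr0n _ 8) lam0)).
have c1 : 0 < cdef Sb + 1 by have := cdef0; lra.
pose r := Num.min (Num.min r1 (Y / 2)) (e / (2 * lam) / (cdef Sb + 1)).
have r0 : 0 < r.
  by rewrite !lt_min r10 !divr_gt0// mulr_gt0.
have rr1 : r <= r1 by rewrite !ge_min lexx.
have rY : r <= Y / 2 by rewrite !ge_min lexx orbT.
have rc : r * (cdef Sb + 1) <= e / (2 * lam) by rewrite -ler_pdivlMr// ge_min lexx orbT.
exists r => //.
have main y1 y2 : 0 < y1 < r -> 0 < y2 < r -> y2 < y1 ->
    rint A B (fun t => chi t * normc (dPsi (t +i* y1) - dPsi (t +i* y2))) <= e.
  move=> y1I y2I y21; pose m := (y1 + y2) / 2; pose d := (y1 - y2) / 2.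
  have -> : y1 = m + d by rewrite /m /d; field.
  have -> : y2 = m - d by rewrite /m /d; field.
  have dI : 0 < d < m by rewrite /m /d; lra.
  have mr : m < r by rewrite /m; lra.
  have mY : 2 * m < Y by lra.
  have [_ H] := K0_defect dI mY lam0; apply: le_trans H _.
  have hm : 0 < m < r1 by lra.
  have hp : 0 < m + d < r1 by rewrite /m /d; lra.
  have hq : 0 < m - d < r1 by rewrite /m /d; lra.
  have cmr : cdef Sb * m <= e / (2 * lam).
    apply: le_trans rc; rewrite mulrC; apply: ler_pM; have := cdef0; lra.
  have := H1 _ hm; have := H1 _ hp; have := H1 _ hq; rewrite !ler_norml.
  move=> /andP[q1 q2] /andP[p1 p2] /andP[m1 m2].
  have -> : e = lam / 2 * (e / lam) + e / 2 by field; rewrite gt_eqF.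
  apply: lerD => //; apply: ler_wpM2l; first by rewrite divr_ge0// ltW.
  have E1 : e / (8 * lam) = e / lam / 8 by field; rewrite gt_eqF.
  have E2 : e / (2 * lam) = e / lam / 2 by field; rewrite gt_eqF.
  rewrite E1 in q1 q2 p1 p2 m1 m2; rewrite E2 in cmr; lra.
move=> y1 y2 y1I y2I; have [lt|lt|->] := ltgtP y2 y1; first exact: main.
  under eq_rint do rewrite normcB; exact: main.
by under eq_rint do rewrite subrr Normc.normc0 mulr0; rewrite rint_cst ?mul0r ?(ltW e0)// ltW.
Qed.

(** On [[a, b]] the two factors of [bump] are at least [a - A] and [B - b]. *)
Lemma unweight (a b : R) (f : R -> R) : A < a -> a <= b -> b < B ->
  {in `[A, B], continuous f} -> (forall t, A <= t <= B -> 0 <= f t) ->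
  ((a - A) * (B - b)) ^+ 4 * rint a b f <= rint A B (fun t => chi t * f t).
Proof.
move=> Aa ab bB cf f0; have bA : 0 < a - A by lra. have Bb : 0 < B - b by lra.
have cf' : {in `[a, b], continuous f}.
  by move=> t; rewrite in_itv/= => tI; apply: cf; rewrite in_itv/=; lra.
have cg : {in `[A, B], continuous (fun t => chi t * f t)}.
  by move=> t tI; exact: (rcontM (@continuous_chi R A B t) (cf t tI)).
apply: (@le_trans _ _ (rint a b (fun t => chi t * f t))); last first.
  by apply: le_rint_sub => //; [exact: ltW|exact: ltW|move=> t tI; rewrite mulr_ge0 ?chi_ge0 ?f0].
rewrite -rintZ//; apply: le_rint.
- by move=> t tI; exact: (rcontM (rcst _ t) (cf' t tI)).
- by move=> t; rewrite in_itv/= => tI; apply: cg; rewrite in_itv/=; lra.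
move=> t; rewrite in_itv/= => tI; apply: ler_wpM2r; first by apply: f0; lra.
by rewrite /chi lerXn2r// ?nnegrE ?mulr_ge0// ?(ltW bA) ?(ltW Bb)//; [lra|lra|apply: ler_pM; lra].
Qed.

Let slice y : 0 < y -> {in `[A, B], continuous (fun t => dPsi (t +i* y))}.
Proof.
by move=> y0 t _; exact: (ccont_comp (@continuous_reline R y t) (@dPsi_continuous (t +i* y) y0)).
Qed.

Theorem halfplane_L1_cauchy (a b e : R) : A < a -> a <= b -> b < B -> 0 < e ->
  exists2 r, 0 < r & forall y1 y2, 0 < y1 < r -> 0 < y2 < r ->
  rint a b (fun t => normc (dPsi (t +i* y1) - dPsi (t +i* y2))) <= e.
Proof.
move=> Aa ab bB e0; pose k := ((a - A) * (B - b)) ^+ 4.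
have k0 : 0 < k by rewrite exprn_gt0// mulr_gt0// subr_gt0.
have [r r0 Hr] := weighted_cauchy (mulr_gt0 k0 e0).
exists r => // y1 y2 y1I y2I; rewrite -(ler_pM2l k0); apply: le_trans (Hr _ _ y1I y2I).
apply: unweight => //; last by move=> t _; exact: normc_ge0.
move=> t tI; case/andP: y1I => y10 _; case/andP: y2I => y20 _.
exact: (ccont_normc (ccontB (slice y10 tI) (slice y20 tI))).
Qed.

Theorem halfplane_L1_bound (a b : R) : A < a -> a <= b -> b < B ->
  exists r s : R, [/\ 0 < r, 0 <= s & forall y, 0 < y < r ->
  rint a b (fun t => normc (dPsi (t +i* y))) <= s].
Proof.
move=> Aa ab bB; pose k := ((a - A) * (B - b)) ^+ 4.
have k0 : 0 < k by rewrite exprn_gt0// mulr_gt0// subr_gt0.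
exists Y, (Sb / k); split => //; first by rewrite divr_ge0 ?(ltW k0).
move=> y yI; rewrite ler_pdivlMr// mulrC; have /andP[_ KS] := K0_bound yI; apply: le_trans KS.
apply: unweight => //; last by move=> t _; exact: normc_ge0.
by move=> t tI; case/andP: yI => y0 _; exact: (ccont_normc (slice y0 tI)).
Qed.

End HalfPlane.

(** * Bounded variation of the boundary map *)

Section Boundary.
Context {R : realType}.
Local Notation C := (R[i]^o).
Local Notation normc := (@Normc.normc R).
Local Notation Re := (@complex.Re R).
Local Notation Im := (@complex.Im R).
Implicit Types (u v t : R) (z w : C).

(** [A] is dense in [B], so a nonempty relatively clopen part of [B] meets [A], hence contains it,
    and then contains [B]. *)
Lemma connected_between {T : topologicalType} (A B : set T) :
  connected A -> A `<=` B -> B `<=` closure A -> connected B.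
Proof.
move=> cA AB BA U [z Uz] [C1 oC1 C1E] [C2 cC2 C2E].
have AU : A `<=` U.
  rewrite -setIidPl; apply: cA.
  - move: (Uz); rewrite C1E => -[/BA Bz C1z].
    have [] := Bz C1; first exact: open_nbhs_nbhs.
    by move=> w [Aw C1w]; exists w; split => //; split => //; exact: AB.
  - by exists C1 => //; rewrite C1E setIA (setIidl AB).
  - by exists C2 => //; rewrite C2E setIA (setIidl AB).
apply/seteqP; split=> [w|w Bw]; first by rewrite C2E => -[].
rewrite C2E; split=> //; rewrite (closure_id C2).1//.
apply: (closureS _ (BA _ Bw)) => x /AU; rewrite C2E; by case.
Qed.

(** Adjoining to a component a point of its closure keeps it connected, so by maximality such a
    point of [A] is already in the component. *)
Lemma component_frontier {T : topologicalType} (A : set T) (x p : T) :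
  closure (connected_component A x) p -> ~ connected_component A x p -> ~ A p.
Proof.
set G := connected_component A x => clp nGp Ap; apply: nGp.
have [Gx|Gx] := pselect (A x); last first.
  by move: clp; rewrite /G connected_component_out// closure0.
suff H : G `|` [set p] `<=` G by apply: H; right.
apply: connected_component_max.
- by left; exact: connected_component_refl.
- by move=> y [/connected_component_sub|->].
- apply: (@connected_between _ G); first exact: component_connected.
    by move=> y; left.
  by move=> y [Gy|->//]; exact: subset_closure.
Qed.

Lemma within_comp {S T U : topologicalType} (A : set T) (f : T -> U) (g : S -> T) :
  {within A, continuous f} -> continuous g -> (forall s, A (g s)) -> continuous (f \o g).
Proof.
move=> /subspace_continuousP cf cg Ag s.
apply: (@cvg_comp _ _ _ g f (nbhs s) (within A (nbhs (g s)))); last exact: cf.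
move=> W /= /(cg s) gW; apply: (@filterS _ (nbhs s) _ _ _ _ gW) => u /= H; exact: (H (Ag u)).
Qed.

Lemma unit_diskE z : unit_disk z = (normc z < 1).
Proof. by rewrite /unit_disk /mkset normE -[1]/(1%:C) ltcR. Qed.

Lemma unit_circleE z : unit_circle z = (normc z = 1).
Proof.
rewrite /unit_circle /mkset normE -[1 in LHS]/(1%:C); apply/propext; split => [|->//].
exact: complexI.
Qed.

Lemma closure_unit_disk z : normc z <= 1 -> closure unit_disk z.
Proof.
move=> z1 W /nbhscP[e e0 HW].
pose h : R := Num.min (e / 2) 2^-1.
have h0 : 0 < h by rewrite lt_min divr_gt0//= invr_gt0.
have h1 : h <= 2^-1 by rewrite ge_min lexx orbT.
have he : h <= e / 2 by rewrite ge_min lexx.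
exists ((1 - h)%:C * z); split.
  rewrite unit_diskE Normc.normcM normcR ger0_norm; last by lra.
  by apply: (@le_lt_trans _ _ (1 - h)); [rewrite ler_piMr//; lra|lra].
apply: HW; have -> : (1 - h)%:C * z - z = (- h)%:C * z.
  by rewrite rmorphB rmorphN /=; ring.
rewrite Normc.normcM normcR normrN gtr0_norm//.
by apply: (@le_lt_trans _ _ h); [rewrite ler_piMr// ltW|lra].
Qed.

Lemma continuous_expi : continuous (@expi R).
Proof. by move=> t; exact: (ccontMk (@continuous_cos R t) (@continuous_sin R t)). Qed.

Lemma expi_neq1 t : 0 < t < 2 * pi -> expi t != 1 :> C.
Proof.
move=> tI; apply/eqP => /(congr1 Re) /= ct.
have tI2 : 0 < t / 2 < pi by lra.
have s0 := sin_gt0_pi tI2.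
have E : cos t = 1 - 2 * sin (t / 2) ^+ 2.
  have -> : t = t / 2 + t / 2 by field.
  rewrite cosD; have := cos2Dsin2 (t / 2); have -> : (t / 2 + t / 2) / 2 = t / 2 by field.
  by rewrite -!expr2; lra.
have : 0 < sin (t / 2) ^+ 2 by rewrite exprn_gt0.
lra.
Qed.

Lemma expi_inj u v : `|u - v| < 2 * pi -> expi u = expi v :> C -> u = v.
Proof.
wlog uv : u v / v <= u.
  move=> H uv1 E; have [vu|uv] := leP v u; first exact: H.
  by apply/esym; apply: H; [exact: ltW|rewrite distrC|].
rewrite le_eqVlt in uv; case/predU1P: uv => [->//|vu].
rewrite gtr0_norm ?subr_gt0// => uv1 E; exfalso.
have uI : 0 < u - v < 2 * pi by rewrite subr_gt0 vu.
have /eqP := expi_neq1 uI; apply.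
have n0 : expi v != 0 :> C by rewrite -normc_gt0 normc_expi.
by apply: (mulIf n0); rewrite -expiD subrK mul1r.
Qed.

Lemma expi_asin y : -1 <= y <= 1 -> expi (asin y) = Num.sqrt (1 - y ^+ 2) +i* y :> C.
Proof. by move=> yI; rewrite /expi cos_asin// asinK// in_itv. Qed.

(** Rotation by the conjugate of [expi v0] brings the value near 1, where the imaginary part
    determines the argument through [asin]. *)
Lemma expi_lift (k : R -> C) u0 v0 : continuous k -> (forall u, normc (k u) = 1) ->
  k u0 = expi v0 -> forall e, 0 < e -> exists2 r : R, 0 < r &
  forall u, `|u - u0| < r -> exists2 v, `|v - v0| < e & k u = expi v.
Proof.
move=> ck nk k0 e e0.
have e00 : expi v0 * conjc (expi v0) = 1 :> C.
  by apply: complex_eqP; rewrite !CE /expi /=; [rewrite mulrN opprK -!expr2 cos2Dsin2|ring].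
pose c u := k u * conjc (expi v0).
have cc : {for u0, continuous c} by exact: (ccontM (ck u0) (ccst _ _)).
have c0 : c u0 = 1 by rewrite /c k0 e00.
have nc u : Re (c u) ^+ 2 + Im (c u) ^+ 2 = 1.
  by rewrite -sqr_normcE /c Normc.normcM nk normcJ normc_expi mulr1 expr1n.
have cRe := ccontRe cc; have cIm := ccontIm cc.
have ca : {for Im (c u0), continuous (@asin R)}.
  by rewrite c0 /=; apply: continuous_asin; lra.
have cas := rcont_comp cIm ca.
have a0 : asin (Im (c u0)) = 0 :> R.
  rewrite c0 /= -[X in asin X]sin0 sinK// in_itv/=.
  by have := @pi_ge0 R => p0; apply/andP; split; lra.
have /cvgrPdist_lt /(_ _ e0) /nbhs_ballP[r1 /= r10 H1] := cas.
have /cvgrPdist_lt /(_ _ ltr01) /nbhs_ballP[r2 /= r20 H2] := cRe.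
exists (Num.min r1 r2); first by rewrite lt_min r10.
move=> u; rewrite lt_min => /andP[u1 u2].
have {}H1 := H1 u; have {}H2 := H2 u.
exists (v0 + asin (Im (c u))).
  rewrite addrC addKr; move: H1; rewrite a0 sub0r normrN; apply.
  by rewrite /ball/= distrC.
have Re0 : 0 < Re (c u).
  have : `|Re (c u0) - Re (c u)| < 1 by apply: H2; rewrite /ball/= distrC.
  by rewrite c0 /= ltr_norml; lra.
have Im1 : -1 <= Im (c u) <= 1.
  rewrite -ler_norml -(@ler_pXn2r _ 2)// ?nnegrE// real_normK ?num_real// expr1n -(nc u).
  by rewrite lerDr sqr_ge0.
(* The real part is positive, so it is the square root of [1 - Im (c u) ^+ 2]. *)
rewrite expiD expi_asin// -(nc u) addrK sqrtr_sqr gtr0_norm//.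
have -> : (Re (c u) +i* Im (c u)) = c u by case: (c u).
by rewrite /c mulrCA e00 mulr1.
Qed.

Section Variation.
Variables (gamma : R -> C) (G : set C) (Phi : C -> C) (s t a b V : R) (h g : C -> C).
Hypotheses (gcont : {within h @` unit_circle, continuous g})
  (hK : {in unit_circle, cancel h g}) (gammaE : gamma = h \o expi).
Hypothesis HG : jordan_interior gamma G.
Hypothesis Hinj : {in `]s, t[ &, injective gamma}.
Hypothesis Hlen : forall p : seq R, sorted <=%R p -> {subset p <= `]s, t[} ->
  polygon_length gamma p <= V.
Hypotheses (HPhi : set_bij unit_disk G Phi)
  (HPhi_bij : set_bij (closure unit_disk) (closure G) Phi)
  (HPhi_cont : {within closure unit_disk, continuous Phi}).
Hypotheses (Hab : a < b) (Hba : b < a + 2 * pi).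
Hypothesis Harc : forall u, a <= u <= b -> exists2 v, s < v < t & Phi (expi u) = gamma v.

Let expi_closure u : closure unit_disk (expi u : C).
Proof. by apply: closure_unit_disk; rewrite normc_expi. Qed.

(** [Phi] is injective on the closed disk and the open disk already covers [G]. The image of a
    boundary point is thus in the closure of [G] but not in [G], and a frontier point of a component
    of the complement of the curve lies on the curve. *)
Lemma boundary_value u : exists v, Phi (expi u) = gamma v.
Proof.
have [PhiS PhiI PhiJ] := HPhi_bij; have [_ _ DG] := HPhi.
have [_ [z _ GE]] := HG.
have : ~ G (Phi (expi u)).
  move=> /DG[w Dw wE].
  have w1 : w \in closure unit_disk by apply: mem_set; exact: subset_closure.
  have E : w = expi u := PhiI _ _ w1 (mem_set (@expi_closure u)) wE.
  by move: Dw; rewrite E unit_diskE normc_expi ltxx.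
have : closure G (Phi (expi u)) := PhiS _ (@expi_closure u).
rewrite GE => cl nG; have := component_frontier cl nG => /contrapT[v _ <-].
by exists v.
Qed.

(** The boundary correspondence as a map into the unit circle: [g] undoes the parametrization [h] of
    the curve. *)
Let kap u : C := g (Phi (expi u)).

Let kapE u v : Phi (expi u) = gamma v -> kap u = expi v.
Proof.
by move=> E; rewrite /kap E gammaE /= hK// inE unit_circleE normc_expi.
Qed.

Let kap_norm u : normc (kap u) = 1.
Proof. by have [v /kapE ->] := boundary_value u; rewrite normc_expi. Qed.

Let kap_h u : h (kap u) = Phi (expi u).
Proof. by have [v E] := boundary_value u; rewrite (kapE E) E gammaE. Qed.

Lemma boundary_continuous : continuous (fun u => Phi (expi u)).
Proof. exact: (within_comp HPhi_cont continuous_expi). Qed.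

Let kap_cont : continuous kap.
Proof.
apply: (within_comp gcont boundary_continuous) => u.
have [v ->] := boundary_value u; rewrite gammaE; exists (expi v) => //.
by rewrite unit_circleE normc_expi.
Qed.

(** The parameter interval of the arc is open, so the local lift stays inside it. This allows going
    beyond [a] and [b]. *)
Let near_arc u0 v0 : s < v0 < t -> kap u0 = expi v0 -> forall e, 0 < e ->
  exists2 r : R, 0 < r & forall u, `|u - u0| < r ->
  exists2 v, s < v < t & `|v - v0| < e /\ kap u = expi v.
Proof.
move=> vI k0 e e0.
pose e' := Num.min e (Num.min (v0 - s) (t - v0)).
have e'0 : 0 < e' by rewrite !lt_min e0/= !subr_gt0.
have [r r0 Hr] := expi_lift kap_cont kap_norm k0 e'0.
exists r => // u /Hr[v]; rewrite !lt_min => /andP[ve /andP[vs vt]] kv.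
by exists v => //; move: vs vt; rewrite !ltr_norml; lra.
Qed.

(** The parameter [theta] is unique because [gamma] is injective on the arc, and it is injective
    because the enlarged interval is shorter than a full turn. Once continuous, it is strictly
    monotone. *)
Lemma boundary_lift : exists e : R, exists theta : R -> R,
  [/\ 0 < e, b - a + 2 * e < 2 * pi,
   forall u, a - e <= u <= b + e -> s < theta u < t,
   forall u, a - e <= u <= b + e -> Phi (expi u) = gamma (theta u) &
   {in `[a - e, b + e] &, {homo theta : x y / x < y}} \/
   {in `[a - e, b + e] &, {homo theta : x y /~ x < y}}].
Proof.
have Hab' := Hab; have Hba' := Hba.
have aI : a <= a <= b by lra. have bI : a <= b <= b by lra.
have [va vaI /kapE ka] := Harc aI; have [vb vbI /kapE kb] := Harc bI.
have [ra ra0 Ha] := near_arc vaI ka ltr01.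
have [rb rb0 Hb] := near_arc vbI kb ltr01.
(* The halves keep the overhang where the local lifts at [a] and [b] are available; the quarter of
   the remaining gap keeps the total length below [2 * pi]. *)
pose e := Num.min (Num.min (ra / 2) (rb / 2)) ((a + 2 * pi - b) / 4).
have e0 : 0 < e by rewrite !lt_min !divr_gt0//; lra.
have ea : e <= ra / 2 by rewrite !ge_min lexx.
have eb : e <= rb / 2 by rewrite !ge_min lexx orbT.
have epi : e <= (a + 2 * pi - b) / 4 by rewrite !ge_min lexx !orbT.
have ex u : exists v, a - e <= u <= b + e -> s < v < t /\ kap u = expi v.
  have [uI|uI] := pselect (a - e <= u <= b + e); last by exists 0.
  have [ua|ua] := ltP u a.
    have ura : `|u - a| < ra by rewrite ltr_norml; lra.
    by have [v vI [_ kv]] := Ha u ura; exists v.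
  have [ub|ub] := leP u b.
    have uab : a <= u <= b by lra.
    by have [v vI /kapE kv] := Harc uab; exists v.
  have urb : `|u - b| < rb by rewrite ltr_norml; lra.
  by have [v vI [_ kv]] := Hb u urb; exists v.
have [theta Hth] := choice ex.
have thI u : a - e <= u <= b + e -> s < theta u < t by move=> /Hth[].
have thk u : a - e <= u <= b + e -> kap u = expi (theta u) by move=> /Hth[].
have uniq (v w : R) : s < v < t -> s < w < t -> expi v = expi w :> C -> v = w.
  move=> vI wI E; apply: Hinj; rewrite ?in_itv//.
  by rewrite gammaE /= E.
exists e, theta; split => //; first by lra.
  by move=> u uI; rewrite -kap_h (thk u uI) gammaE.
apply: itv_continuous_inj_mono.
  apply/subspace_continuousP => u /=; rewrite in_itv/= => uI.
  apply/cvgrPdist_lt => d d0.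
  have [r r0 Hr] := near_arc (thI u uI) (thk u uI) d0.
  apply/nbhs_ballP; exists r => // w /=; rewrite /ball/= distrC => wu.
  rewrite in_itv/= => wI.
  have [v vI [vd kv]] := Hr w wu.
  (* [theta] is only a choice of parameters; uniqueness identifies it with the nearby lift and makes
     it continuous. *)
  have E : theta w = v by apply: uniq => //; [exact: thI|rewrite -kv thk].
  have : `|theta u - theta w| < d by rewrite E distrC.
  exact.
move=> u w; rewrite !in_itv/= => uI wI E.
have kk : kap u = kap w by rewrite !thk// E.
apply: expi_inj; first by rewrite ltr_norml; lra.
have [_ PhiI _] := HPhi_bij; apply: PhiI; rewrite ?inE//.
by rewrite -!kap_h kk.
Qed.

(** A monotone [theta] sends the partition to an ordered list of parameters in the arc, so the sum
    is the length of an inscribed polygon. *)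
Lemma boundary_variation : exists e : R, [/\ 0 < e, b - a + 2 * e < 2 * pi &
  forall (n : nat) (u w : R), 0 < w -> a - e <= u -> u + n%:R * w <= b + e ->
  \sum_(k < n) normc (Phi (expi (u + k.+1%:R * w)) - Phi (expi (u + k%:R * w))) <= V].
Proof.
have [e [theta [e0 epi thI thE mono]]] := boundary_lift.
exists e; split => // n u w w0 ua ub.
have inI (k : nat) : (k <= n)%N -> a - e <= u + k%:R * w <= b + e.
  move=> kn; apply/andP; split; first by rewrite (le_trans ua)// lerDl mulr_ge0// ltW.
  by apply: le_trans ub; rewrite lerD2l ler_wpM2r ?ler_nat// ltW.
have sub (f : nat -> R) : (forall k, (k <= n)%N -> s < f k < t) ->
    {subset mkseq f n.+1 <= `]s, t[}.
  by move=> Hf x /mapP[k]; rewrite mem_iota add0n ltnS => /Hf kI ->; rewrite in_itv.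
have len (f : nat -> R) : polygon_length gamma (mkseq f n.+1) =
    \sum_(k < n) normc (gamma (f k.+1) - gamma (f k)).
  rewrite /polygon_length size_mkseq -[n.+1.-1]/n big_mkord; apply: eq_bigr => k _.
  have k1 : (k < n.+1)%N by rewrite ltnS ltnW.
  have k2 : (k.+1 < n.+1)%N by rewrite ltnS.
  by rewrite !nth_mkseq.
have srt (f : nat -> R) : (forall k, (k < n)%N -> f k <= f k.+1) -> sorted <=%R (mkseq f n.+1).
  move=> Hf; apply/(sortedP 0) => k; rewrite size_mkseq ltnS => kn.
  have k1 : (k < n.+1)%N by rewrite ltnS ltnW.
  have k2 : (k.+1 < n.+1)%N by rewrite ltnS.
  by rewrite !nth_mkseq//; exact: Hf.
case: mono => mono.
- pose f k := theta (u + k%:R * w).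
  have <- : polygon_length gamma (mkseq f n.+1) =
      \sum_(k < n) normc (Phi (expi (u + k.+1%:R * w)) - Phi (expi (u + k%:R * w))).
    by rewrite len; apply: eq_bigr => k _; rewrite /f !thE// inI// ltnW.
  apply: Hlen; last by apply: sub => k kn; apply: thI; exact: inI.
  apply: srt => k kn; apply: ltW; apply: mono; rewrite ?in_itv/= ?inI// ?(ltnW kn)//.
  by rewrite ltrD2l ltr_pM2r// ltr_nat.
(* For decreasing [theta] the points are listed backwards to be sorted. *)
- pose f k := theta (u + (n - k)%N%:R * w).
  have <- : polygon_length gamma (mkseq f n.+1) =
      \sum_(k < n) normc (Phi (expi (u + k.+1%:R * w)) - Phi (expi (u + k%:R * w))).
    rewrite len [RHS](reindex_inj rev_ord_inj); apply: eq_bigr => k _ /=.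
    rewrite /f subnSK// normcB !thE ?inI ?leq_subr//.
  apply: Hlen; last by apply: sub => k kn; apply: thI; apply: inI; exact: leq_subr.
  apply: srt => k kn; apply: ltW; apply: mono; rewrite ?in_itv/= ?inI ?leq_subr//.
  by rewrite ltrD2l ltr_pM2r// ltr_nat ltn_sub2l.
Qed.

End Variation.
End Boundary.

(** * Transfer to the disk *)

Section HalfPlaneLift.
Context {R : realType}.
Local Notation C := (R[i]^o).
Local Notation normc := (@Normc.normc R).
Local Notation Re := (@complex.Re R).
Local Notation Im := (@complex.Im R).
Implicit Types (t y r : R) (z w d : C) (f g : C -> C).

Lemma cder_near_eq f g z d : (\forall w \near z, f w = g w) -> cder f z d -> cder g z d.
Proof.
move=> fg [k [fk ck <-]]; apply: cder_near ck; have fgz := nbhs_singleton fg; apply: filterS fg => w <-.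
by rewrite -fgz.
Qed.

(* The exponential z |-> e^{iz}, frozen below the real axis so as to map the
   whole plane continuously into the closed disk. *)
Definition exp_disk z : C := cexp ((- Num.max (Im z) 0) +i* Re z).

Lemma normc_exp_disk z : normc (exp_disk z) = expR (- Num.max (Im z) 0).
Proof. exact: normc_cexp. Qed.

Lemma exp_disk_closure z : closure unit_disk (exp_disk z).
Proof.
apply: closure_unit_disk; rewrite normc_exp_disk -expR0 ler_expR oppr_le0.
by rewrite le_max lexx orbT.
Qed.

Lemma exp_disk_in z : 0 < Im z -> unit_disk (exp_disk z).
Proof.
by move=> z0; rewrite unit_diskE normc_exp_disk -[ltRHS]expR0 ltr_expR oppr_lt0 lt_max z0.
Qed.

Lemma continuous_exp_disk : continuous exp_disk.
Proof.
move=> z; have cI := ccontIm (cidc z).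
have cm : {for z, continuous (fun w => Num.max (Im w) 0)}.
  have -> : (fun w => Num.max (Im w) 0) = (fun w => (Im w + `|Im w|) / 2).
    by apply/funext => w; case: (lerP (Im w) 0) => I0;
      [rewrite ler0_norm// subrr mul0r|rewrite gtr0_norm//; field].
  have cn : {for z, continuous (fun w => `|Im w|)} by exact: (@cvg_norm _ _ _ (nbhs z)).
  exact: (rcontM (rcontD cI cn) (rcst _ z)).
exact: (ccont_comp (ccontMk (rcontN cm) (ccontRe (cidc z))) (cder_cont (cder_cexp _))).
Qed.

Lemma exp_disk_upper z : 0 <= Im z -> exp_disk z = cexp ('i%C * z).
Proof.
move=> z0; rewrite /exp_disk max_l//; congr cexp.
by apply: complex_eqP; rewrite !CE/=; ring.
Qed.

Lemma cder_exp_disk z : 0 < Im z -> cder exp_disk z ('i%C * exp_disk z).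
Proof.
move=> z0; apply: (@cder_near_eq (fun w => cexp ('i%C * w))).
  have cI := ccontIm (cidc z); have : \forall w \near z, 0 < Im w by exact: (cvgr_gt _ cI).
  by apply: filterS => w w0; rewrite exp_disk_upper// ltW.
rewrite exp_disk_upper ?ltW// mulrC; apply: (@cder_comp _ cexp (fun w => 'i%C * w)).
  by rewrite -[X in cder _ _ X]mulr1; apply: cderZ; exact: cder_id.
exact: cder_cexp.
Qed.

Lemma exp_diskD z t : exp_disk (z + t%:C) = expi t * exp_disk z.
Proof. by rewrite /exp_disk /cexp !CE/= addr0 addrC expiD; ring. Qed.

Lemma exp_disk_real t : exp_disk t%:C = expi t.
Proof. by rewrite /exp_disk /cexp /= maxxx oppr0 expR0 mul1r. Qed.

Lemma exp_disk_polar r t : 0 < r <= 1 -> exp_disk (t +i* (- ln r)) = r%:C * expi t.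
Proof.
move=> /andP[r0 r1]; rewrite /exp_disk /cexp /= max_l ?opprK ?lnK//.
by rewrite oppr_ge0 ln_le0.
Qed.

Lemma exp_disk_neq0 z : exp_disk z != 0.
Proof. exact: cexp_neq0. Qed.

Lemma exp_disk_neq z t : 0 < t < 2 * pi -> exp_disk (z + t%:C) != exp_disk z.
Proof.
move=> tI; rewrite exp_diskD -[X in _ != X]mul1r -subr_eq0 -mulrBl mulf_neq0 ?exp_disk_neq0//.
by rewrite subr_eq0 expi_neq1.
Qed.

Lemma bounded_closure_normc (G : set C) : bounded_set G ->
  exists M, forall z, closure G z -> normc z <= M.
Proof.
(* The bound obtained is an element of [R[i]], of which the real part is taken; the 1 pays for the
   passage to the closure. *)
move=> /ex_strict_bound_gt0[M M0 GM]; exists (Re M + 1) => z clz.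
have [w [Gw wz]] := clz _ (nbhs_normc z ltr01).
have := GM _ Gw; rewrite /= normE ltcE => /andP[_ /= wM].
have := normc_triB z w; rewrite normcB => zw.
by apply: ltW; rewrite -ltrBlDl; apply: le_lt_trans (lerB (lexx _) (ltW wM)) _;
  apply: le_lt_trans zw wz.
Qed.

End HalfPlaneLift.

(** * From heights tending to 0 to radii tending to 1 *)

Section RadialLimit.
Context {R : realType}.
Local Notation C := (R[i]^o).
Local Notation normc := (@Normc.normc R).
Local Notation Re := (@complex.Re R).
Local Notation Im := (@complex.Im R).
Implicit Types (u r e : R).

Variables (Phi : C -> C) (a b : R).
Local Notation D r u := (derive1 Phi (r%:C * expi u)).

Definition lifted_derive (z : C) : C := derive1 Phi (exp_disk z) * ('i%C * exp_disk z).
Local Notation dPsi := lifted_derive.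

(** The circle of radius [r] corresponds to height [- ln r]. The first factor is unimodular and
    independent of [r]. *)
Lemma derive_polar r u : 0 < r < 1 ->
  D r u = ('i%C * expi u)^-1 * (r^-1%:C * dPsi (u +i* (- ln r))).
Proof.
move=> rI; rewrite /dPsi exp_disk_polar; last by case/andP: rI => -> /ltW.
have r0 : (r%:C : C) != 0 by rewrite -normc_gt0 normcR normr_gt0 gt_eqF//; case/andP: rI.
have e0 : expi u != 0 :> C by rewrite -normc_gt0 normc_expi.
have i0 : 'i%C != 0 :> C by rewrite -normc_gt0 /= expr0n expr1n add0r sqrtr1.
rewrite fmorphV; set E := expi u in e0 *; set d := derive1 _ _.
by field; rewrite r0 e0 i0.
Qed.

Lemma normc_polar_unit u : normc ('i%C * expi u)^-1 = 1.
Proof.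
by rewrite Normc.normcV Normc.normcM normc_expi /= expr0n expr1n add0r sqrtr1 mulr1 invr1.
Qed.

(** The factors [r1^-1] and [r2^-1] differ, so besides the Cauchy property a uniform bound of the
    L^1 norms is needed. *)
Lemma derive_diff_le r1 r2 u : 0 < r1 < 1 -> 0 < r2 < 1 ->
  normc (D r1 u - D r2 u) <=
  r1^-1 * normc (dPsi (u +i* (- ln r1)) - dPsi (u +i* (- ln r2))) +
  `|r1^-1 - r2^-1| * normc (dPsi (u +i* (- ln r2))).
Proof.
move=> r1I r2I; rewrite !derive_polar// -mulrBr Normc.normcM normc_polar_unit mul1r.
set p := dPsi _; set q := dPsi _.
have -> : r1^-1%:C * p - r2^-1%:C * q = r1^-1%:C * (p - q) + (r1^-1 - r2^-1)%:C * q.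
  by rewrite (rmorphB (real_complex R)); ring.
rewrite (le_trans (normcD _ _))// !Normc.normcM !normcR ger0_norm// invr_ge0 ltW//.
by case/andP: r1I.
Qed.

Hypothesis dPsi_cont : forall z : C, 0 < Im z -> {for z, continuous dPsi}.
Hypothesis cauchy : forall e : R, 0 < e -> exists2 r : R, 0 < r &
  forall y1 y2 : R, 0 < y1 < r -> 0 < y2 < r ->
  rint a b (fun t => normc (dPsi (t +i* y1) - dPsi (t +i* y2))) <= e.
Hypothesis bounded : exists r s : R, [/\ 0 < r, 0 <= s & forall y : R, 0 < y < r ->
  rint a b (fun t => normc (dPsi (t +i* y))) <= s].

Let lnN r : 0 < r < 1 -> 0 < - ln r.
Proof. by move=> rI; rewrite oppr_gt0 ln_lt0. Qed.

Let cslice (y : R) : 0 < y -> continuous (fun t => dPsi (t +i* y)).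
Proof.
by move=> y0 t; exact: (ccont_comp (@continuous_reline R y t) (@dPsi_cont (t +i* y) y0)).
Qed.

Let cpolar r : 0 < r < 1 -> continuous (fun u : R => D r u).
Proof.
move=> rI u; have y0 := lnN rI.
have -> : (fun u => D r u) = fun u => ('i%C * expi u)^-1 * (r^-1%:C * dPsi (u +i* (- ln r))).
  by apply/funext => v; exact: derive_polar.
have n0 : 'i%C * expi u != 0 :> C.
  by rewrite -normc_gt0 Normc.normcM normc_expi /= expr0n expr1n add0r sqrtr1 mulr1.
exact: (ccontM (ccontV (ccontM (ccst _ u) (@continuous_expi R u)) n0)
  (ccontM (ccst _ u) (cslice y0 (x := u)))).
Qed.

Lemma radial_L1_cauchy e : 0 < e -> exists2 rho, rho < 1 & forall r1 r2,
  rho < r1 < 1 -> rho < r2 < 1 ->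
  {in `[a, b], continuous (fun u => normc (D r1 u - D r2 u))} /\
  rint a b (fun u => normc (D r1 u - D r2 u)) <= e.
Proof.
move=> e0; have e4 : 0 < e / 4 by rewrite divr_gt0.
have [p p0 Hp] := cauchy e4; have [q [s [q0 s0 Hq]]] := bounded.
(* With [|r1^-1 - r2^-1| <= eta] the second term of [derive_diff_le] contributes at most [e / 4]. *)
pose eta := e / (4 * (s + 1)).
have s1 : 0 < s + 1 by lra.
have eta0 : 0 < eta by rewrite divr_gt0// mulr_gt0.
have eta1 : 0 < 1 + eta by lra.
(* In turn: [r^-1 <= 2], [r^-1 <= 1 + eta], and heights [- ln r] below [p] and below [q]. *)
pose rho := Num.max (Num.max 2^-1 (1 + eta)^-1) (Num.max (expR (- p)) (expR (- q))).
exists rho.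
  rewrite !gt_max invf_lt1// ltr1n/= invf_lt1// ltrDl eta0/=.
  by rewrite -expR0 !ltr_expR !oppr_lt0 p0 q0.
have key r : rho < r < 1 -> [/\ 0 < r < 1, 2^-1 < r, (1 + eta)^-1 < r, - ln r < p & - ln r < q].
  rewrite !gt_max -!andbA => /and5P[r2 re rp rq r1].
  have r0 : 0 < r by apply: lt_trans r2; rewrite invr_gt0.
  split => //; first by rewrite r0 r1.
  - by rewrite ltrNl -ltr_expR lnK// posrE.
  - by rewrite ltrNl -ltr_expR lnK// posrE.
move=> r1 r2 /key[r1I r12 r1e r1p r1q] /key[r2I r22 r2e r2p r2q].
have y1 := lnN r1I; have y2 := lnN r2I.
have c0 : {in `[a, b], continuous (fun u => normc (D r1 u - D r2 u))}.
  by move=> u _; exact: (ccont_normc (ccontB (cpolar r1I (x := u)) (cpolar r2I (x := u)))).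
split => //.
have c1 : {in `[a, b], continuous
    (fun u => normc (dPsi (u +i* (- ln r1)) - dPsi (u +i* (- ln r2))))}.
  by move=> u _; exact: (ccont_normc (ccontB (cslice y1 (x := u)) (cslice y2 (x := u)))).
have c2 : {in `[a, b], continuous (fun u => normc (dPsi (u +i* (- ln r2))))}.
  by move=> u _; exact: (ccont_normc (cslice y2 (x := u))).
have c1' : {in `[a, b], continuous
    (fun u => r1^-1 * normc (dPsi (u +i* (- ln r1)) - dPsi (u +i* (- ln r2))))}.
  by move=> u uI; exact: (rcontM (rcst _ u) (c1 u uI)).
have c2' : {in `[a, b], continuous
    (fun u => `|r1^-1 - r2^-1| * normc (dPsi (u +i* (- ln r2))))}.
  by move=> u uI; exact: (rcontM (rcst _ u) (c2 u uI)).
have yp1 : 0 < - ln r1 < p by rewrite y1. have yp2 : 0 < - ln r2 < p by rewrite y2.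
have yq2 : 0 < - ln r2 < q by rewrite y2.
have H1 := Hp _ _ yp1 yp2; have H2 := Hq _ yq2.
apply: (@le_trans _ _ (r1^-1 * (e / 4) + `|r1^-1 - r2^-1| * s)).
  apply: (@le_trans _ _ (rint a b (fun u =>
      r1^-1 * normc (dPsi (u +i* (- ln r1)) - dPsi (u +i* (- ln r2))) +
      `|r1^-1 - r2^-1| * normc (dPsi (u +i* (- ln r2)))))).
    apply: le_rint => //; first by move=> u uI; exact: (rcontD (c1' u uI) (c2' u uI)).
    by move=> u _; exact: derive_diff_le.
  rewrite rintD// !rintZ//; apply: lerD; apply: ler_wpM2l => //.
  by rewrite invr_ge0 ltW//; case/andP: r1I.
have inv r : 0 < r < 1 -> (1 + eta)^-1 < r -> 1 <= r^-1 <= 1 + eta.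
  move=> /andP[r0' r1'] re; rewrite invf_ge1// (ltW r1')/=.
  by rewrite -[leRHS]invrK lef_pV2 ?posrE ?invr_gt0// ltW.
have /andP[i1 i1'] := inv _ r1I r1e; have /andP[i2 i2'] := inv _ r2I r2e.
have i12 : r1^-1 <= 2.
  by rewrite -[leRHS]invrK lef_pV2 ?posrE ?invr_gt0 ?(ltW r12)//; case/andP: r1I.
have d12 : `|r1^-1 - r2^-1| * s <= e / 4.
  apply: (@le_trans _ _ (eta * (s + 1))); last first.
    by rewrite /eta le_eqVlt; apply/orP; left; apply/eqP; field; rewrite gt_eqF.
  by apply: ler_pM => //; [rewrite ler_norml; lra|lra].
have : r1^-1 * (e / 4) <= 2 * (e / 4) by apply: ler_wpM2r => //; exact: ltW.
lra.
Qed.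

Lemma radial_L1_limit :
  (fun r : R * R => (\int[lebesgue_measure]_(u in `[a, b])
      (normc (D r.1 u - D r.2 u))%:E)%E)
    @ filter_prod (1^'-) (1^'-) --> (0%:E : \bar R).
Proof.
have main e : 0 < e -> \forall r \near filter_prod (1^'-) (1^'-),
    {in `[a, b], continuous (fun u => normc (D r.1 u - D r.2 u))} /\
    rint a b (fun u => normc (D r.1 u - D r.2 u)) <= e.
  move=> e0; have [rho rho1 H] := radial_L1_cauchy e0.
  exists ([set r : R | rho < r < 1], [set r : R | rho < r < 1]).
    have near1 : \forall r \near (1 : R)^'-, rho < r < 1.
      by near=> r; apply/andP; split; near: r; [exact: nbhs_left_gt|exact: nbhs_left_lt].
    by split.
  by move=> [r1 r2] /= [r1I r2I]; exact: H.
(* The limit is taken in the extended reals; the integrals are finite for radii close to 1, by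
   continuity of the integrand. *)
apply: cvg_EFin.
  apply: filterS (main _ ltr01) => r [/cont_integrable cI _].
  exact: (integrable_fin_num _ cI).
apply/cvgrPdist_le => e e0; apply: filterS (main _ e0) => r [_ re].
rewrite sub0r normrN /=.
have -> : fine (\int[lebesgue_measure]_(u in `[a, b]) (normc (D r.1 u - D r.2 u))%:E)%E =
  rint a b (fun u => normc (D r.1 u - D r.2 u)) by [].
by rewrite ger0_norm//; apply: rint_ge0 => u _; exact: normc_ge0.
Unshelve. all: by end_near. Qed.

End RadialLimit.

Theorem theorem3p1 (R : realType)
    (gamma : R -> R[i]^o) (G J J' : set R[i]^o) (s t c d : R)
    (Phi : R[i]^o -> R[i]^o) (a b : R)
    (Hgamma : jordan_curve gamma)
    (HG : jordan_interior gamma G)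
    (Hst : s < t)
    (HJ : is_arc gamma `]s, t[ J)
    (HJrect : rectifiable gamma `]s, t[)
    (Hcd : c <= d)
    (HJ' : is_arc gamma `[c, d] J')
    (HJ'J : J' `<=` J)
    (HPhi : conformal_onto unit_disk G Phi)
    (HPhi_ext : homeomorphism (closure unit_disk) (closure G) Phi)
    (Hab : a < b) (Hba : b < a + 2 * pi)
    (Harc : J' = [set Phi (expi u) | u in `[a, b]]) :
  (fun r : R * R =>
     (\int[lebesgue_measure]_(u in `[a, b])
        (Normc.normc (derive1 Phi (r.1%:C * expi u) - derive1 Phi (r.2%:C * expi u)))%:E)%E)
    @ filter_prod (1^'-) (1^'-) --> (0%:E : \bar R).
Proof.
have [h [[_ _ [g gcont hK]] gammaE]] := Hgamma.
have [Gbdd _] := HG; have [Phi_hol Phi_bij] := HPhi.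
have [Phi_bij' Phi_cont _] := HPhi_ext.
have [ginj JE] := HJ.
(* The empty subdivision shows that the length is nonnegative, so being below [+oo] makes it
   finite. *)
have lenV : arc_length gamma `]s, t[ \is a fin_num.
  rewrite ge0_fin_numE//; apply: ereal_sup_ubound; exists [::].
    by split => //.
  by rewrite /polygon_length big_geq.
set V := fine (arc_length gamma `]s, t[).
have Hlen (p : seq R) : sorted <=%R p -> {subset p <= `]s, t[} ->
    polygon_length gamma p <= V.
  move=> sp pI; rewrite -lee_fin /V fineK//.
  by apply: ereal_sup_ubound; exists p.
have Harc' (u : R) : a <= u <= b -> exists2 v, s < v < t & Phi (expi u) = gamma v.
  move=> uI; have : J (Phi (expi u)).
    by apply: HJ'J; rewrite Harc; exists u => //=; rewrite in_itv.
  by rewrite JE => -[v /= vI <-]; exists v; rewrite // in_itv in vI.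
have [e [e0 epi var]] := boundary_variation gcont hK gammaE HG ginj Hlen Phi_bij
  Phi_bij' Phi_cont Hab Hba Harc'.
have [M MG] := bounded_closure_normc Gbdd.
pose Psi := Phi \o exp_disk.
(* The half-plane results are used on [[a - e / 2, b + e / 2]]. The other half of [e] is the margin
   for shifted partitions, and translations by less than [2 * pi] move every point of [exp_disk]. *)
pose w0 := Num.min (e / 2) (2 * pi).
have w0_gt0 : 0 < w0 by rewrite lt_min divr_gt0//= mulr_gt0// pi_gt0.
have w0e : w0 <= e / 2 by rewrite ge_min lexx.
have w0pi : w0 <= 2 * pi by rewrite ge_min lexx orbT.
have AB : a - e / 2 < b + e / 2 by lra.
have Psi_cont : continuous Psi.
  exact: (within_comp Phi_cont (@continuous_exp_disk R) exp_disk_closure).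
have PsiP z : 0 < complex.Im z -> cder Psi z (lifted_derive Phi z).
  move=> z0; apply: cder_comp; first exact: cder_exp_disk.
  by apply: derivable_cder; apply: Phi_hol; exact: exp_disk_in.
have PsiM z : Normc.normc (Psi z) <= M.
  by apply: MG; have [+ _ _] := Phi_bij'; apply; exact: exp_disk_closure.
have Psi_inj z w : 0 < w < w0 -> Psi (z + w%:C) != Psi z.
  move=> wI; have wI' : 0 < w < 2 * pi by lra.
  apply: contra_neq (exp_disk_neq z wI'); have [_ Pinj _] := Phi_bij'.
  by apply: Pinj; rewrite inE; exact: exp_disk_closure.
have Psi_var (n : nat) u w : 0 < w < w0 -> a - e / 2 <= u ->
    u + n%:R * w <= b + e / 2 + w0 ->
    \sum_(k < n) Normc.normc (Psi (u + k.+1%:R * w)%:C - Psi (u + k%:R * w)%:C) <= V.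
  move=> /andP[w1 _] ua ub; under eq_bigr do rewrite /Psi /= !exp_disk_real.
  by apply: var => //; lra.
apply: radial_L1_limit.
- by move=> z; exact: dPsi_continuous PsiP _.
- move=> e' e'0; apply: (halfplane_L1_cauchy AB w0_gt0 Psi_cont PsiP PsiM Psi_inj Psi_var) => //; lra.
- apply: (halfplane_L1_bound AB w0_gt0 Psi_cont PsiP PsiM Psi_inj Psi_var); lra.
Qed.
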